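(* Let $(A,\mu)$ be a Lie algebroid, $\pi$ a bivector and $N$ a $(1,1)$-tensor such that $N\circ\pi^\sharp=\pi^\sharp\circ N^*$ and $N^2=\lambda\,\mathrm{id}_A$ for some $\lambda\in\mathbb R$. Then the pair $(\pi,N)$ is a Poisson–Nijenhuis structure on $(A,\mu)$ if and only if $j=-\pi+\underline N$ is a Nijenhuis vector-valued form with respect to the $L_\infty$-algebra $(\Gamma(\wedge^\bullet A)[2],l_2)$, with square $k=-\lambda\,\mathcal E$, where $\mathcal E$ is the Euler map.
   Context: Big bracket. For a smooth vector bundle $A\to M$, let $\mathcal F=C^\infty(T^*[2]A[1])$ with the graded Poisson bracket $\{\cdot,\cdot\}$ (the big bracket) of the canonical symplectic structure of $T^*[2]A[1]$. In local coordinates $x_i,\xi_a$ on $A[1]$ and associated moment coordinates $p^i,\theta^a$ one has $\{p^i,x_i\}=\{\theta^a,\xi_a\}=1$ and all other brackets of coordinates vanish. The coordinates $x_i,\xi_a,p^i,\theta^a$ have bidegrees $(0,0),(0,1),(1,1),(1,0)$; $\mathcal F^{k,l}$ is the space of functions of bidegree $(k,l)$, $\mathcal F^{k,0}=\Gamma(\wedge^kA)$, $\mathcal F^{0,l}=\Gamma(\wedge^lA^* )$. The bracket has bidegree $(-1,-1)$ and, with $|F|$ the total degree, satisfies $\{F,G\}=-(-1)^{|F||G|}\{G,F\}$, $\{F,GH\}=\{F,G\}H+(-1)^{|F||G|}G\{F,H\}$, $\{F,\{G,H\}\}=\{\{F,G\},H\}+(-1)^{|F||G|}\{G,\{F,H\}\}$;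 on $\Gamma(A\oplus A^* )$ it is the canonical pairing. A Lie algebroid structure on $A$ is identified with $\mu\in\mathcal F^{1,2}$ such that $\{\mu,\mu\}=0$, with anchor $\rho(X)f=\{\{X,\mu\},f\}$ and bracket $[X,Y]=\{\{X,\mu\},Y\}$. Poisson–Nijenhuis structures. $\pi\in\Gamma(\wedge^2A)$, $\langle\pi^\sharp\alpha,\beta\rangle=\pi(\alpha,\beta)$; $N^*$ is the transpose of $N:A\to A$. The pair $(\pi,N)$ is a Poisson–Nijenhuis structure on $(A,\mu)$ if $N\circ\pi^\sharp=\pi^\sharp\circ N^*$, $\pi$ is Poisson (its Schouten–Nijenhuis square vanishes), the Nijenhuis torsion of $N$ on $(A,\mu)$ vanishes ($[NX,NY]=N([NX,Y]+[X,NY]-N[X,Y])$ for all $X,Y\in\Gamma(A)$), and the Magri–Morosi concomitant $C(\pi,N)$ vanishes. Vanishing of $C(\pi,N)$ means $[\alpha,\beta]_{\pi_N}=[N^*\alpha,\beta]_\pi+[\alpha,N^*\beta]_\pi-N^*[\alpha,\beta]_\pi$ for all $\alpha,\beta\in\Gamma(A^* )$, where $[\alpha,\beta]_\pi=\mathcal L_{\pi^\sharp\alpha}\beta-\mathcal L_{\pi^\sharp\beta}\alpha-\mathrm d(\pi(\alpha,\beta))$ and $\pi_N(\alpha,\beta)=\pi(N^*\alpha,\beta)$. Vector-valued forms. $L=\Gamma(\wedge^\bullet A)[2]=\bigoplus_{i\ge-2}L_i$, $L_i=\Gamma(\wedge^{i+2}A)$; $l_2(P,Q)=\{\{\mu,P\},Q\}$,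 which is the only nonzero bracket of the $L_\infty$-algebra $(L,l_2)$. $\underline N(f)=0$ for $f\in C^\infty(M)$ and $\underline N(P_1\wedge\dots\wedge P_p)=\sum_{i=1}^p(-1)^{i-1}N(P_i)\wedge\widehat{P_i}$ (factor $P_i$ omitted in $\widehat{P_i}$). Vector-valued $k$-forms are graded symmetric $k$-linear maps $L^k\to L$ (elements of $L$ for $k=0$). For $K$ a $k$-form and $H$ an $h$-form, $\imath_KH(X_1,\dots,X_{k+h-1})=\sum_{\sigma\in Sh(k,h-1)}\epsilon(\sigma)H(K(X_{\sigma(1)},\dots,X_{\sigma(k)}),X_{\sigma(k+1)},\dots,X_{\sigma(k+h-1)})$ (unshuffles, Koszul sign), $\imath_KH=0$ if $h=0$, and $[K,H]=\imath_KH-(-1)^{\bar K\bar H}\imath_HK$ with $\bar K$ the degree of $K$ as a graded map. A degree-zero symmetric vector-valued form $n$ is a Nijenhuis form with respect to $l$ with square $k$ ($k$ a vector-valued form of degree zero) if $[n,[n,l]]=[k,l]$ and $[n,k]=0$. The Euler map is $\mathcal E(P)=pP$ for $P\in L_p$. *)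

(* Defs.v *)
(* Smooth vector bundles, the big bracket on functions of T^*[2]A[1], and
   vector-valued forms on Gamma(/\A)[2]. *)
From HB Require Import structures.
From mathcomp Require Import all_boot all_order all_algebra.
From mathcomp Require Import all_classical all_reals all_analysis.
Import numFieldNormedType.Exports.

Set Implicit Arguments.
Unset Strict Implicit.
Unset Printing Implicit Defensive.

Import Order.TTheory GRing.Theory Num.Theory.
Local Open Scope ring_scope.

(** * Smooth functions, manifolds, vector bundles *)

Section Smooth.
Variables (R : realType) (n : nat).

Definition basis_vec (c : 'I_n) : 'rV[R]_n := delta_mx 0 c.

Fixpoint times_differentiable (k : nat) (V : set 'rV[R]_n) (f : 'rV[R]_n -> R)
    : Prop :=
  if k is k'.+1 then
    (forall x, V x -> differentiable f x) /\
    (forall c, times_differentiable k' V (fun x => 'D_(basis_vec c) f x))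
  else True.

Definition smooth_on (V : set 'rV[R]_n) (f : 'rV[R]_n -> R) :=
  forall k, times_differentiable k V f.

End Smooth.

(* [chart i] and its inverse [param i] only matter on [dom i] and on its image
   [chart i @` dom i]. *)
Record manifold (R : realType) (n : nat) := Manifold {
  point_of :> topologicalType;
  chart_index : Type;
  dom : chart_index -> set point_of;
  chart : chart_index -> point_of -> 'rV[R]_n;
  param : chart_index -> 'rV[R]_n -> point_of;
  manifold_hausdorff : hausdorff_space point_of;
  manifold_second_countable : @second_countable point_of;
  dom_open : forall i, open (dom i);
  dom_cover : forall m, exists i, dom i m;
  cod_open : forall i, open (chart i @` dom i)%classic;
  chartK : forall i m, dom i m -> param i (chart i m) = m;
  chart_continuous : forall i m, dom i m -> {for m, continuous (chart i)};
  param_continuous : forall i x, (chart i @` dom i)%classic x ->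
    {for x, continuous (param i)};
  chart_smooth : forall i j c,
    smooth_on (chart i @` (dom i `&` dom j))%classic
              (fun x => chart j (param i x) 0 c)
}.

Definition cod R n (M : manifold R n) (i : chart_index M) : set 'rV[R]_n :=
  (chart i @` dom i)%classic.

(* A vector bundle of rank r given by its cocycle over an atlas all of whose
   chart domains trivialise it: a vector with fibre coordinates v in the j-th
   trivialisation has fibre coordinates [trans i j m *m v] in the i-th one. *)
Record vbundle R n (M : manifold R n) (r : nat) := VBundle {
  trans : chart_index M -> chart_index M -> M -> 'M[R]_r;
  trans_id : forall i m, dom i m -> trans i i m = 1%:M;
  trans_cocycle : forall i j k m, dom i m -> dom j m -> dom k m ->
    trans i j m *m trans j k m = trans i k m;
  trans_smooth : forall i j a b,
    smooth_on (chart i @` (dom i `&` dom j))%classic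
              (fun x => trans j i (param i x) a b)
}.

(** * The Grassmann algebra in xi_a, theta^a *)

Section Grassmann.
Variables (R : realType) (r : nat).

(* Coefficients on the products, in increasing order, of the odd generators
   indexed by 'I_(r + r): first the xi_a, then the theta^a. *)
Definition grass := {ffun {set 'I_(r + r)} -> R}.

Definition xi_idx (a : 'I_r) : 'I_(r + r) := lshift r a.
Definition th_idx (a : 'I_r) : 'I_(r + r) := rshift r a.

Definition mon (S : {set 'I_(r + r)}) : grass := [ffun T : {set 'I_(r + r)} => (T == S)%:R].
Definition xi (a : 'I_r) : grass := mon [set xi_idx a].
Definition th (a : 'I_r) : grass := mon [set th_idx a].

Definition inversions (S T : {set 'I_(r + r)}) : nat :=
  #|[set st : 'I_(r + r) * 'I_(r + r) |
      [&& st.1 \in S, st.2 \in T & (st.2 < st.1)%N]]|.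

Definition wedge (u v : grass) : grass :=
  [ffun S : {set 'I_(r + r)} => \sum_(T : {set 'I_(r + r)} | T \subset S)
     (-1) ^+ inversions T (S :\: T) * (u T * v (S :\: T))].

(* Left derivative with respect to the s-th odd generator. *)
Definition gder (s : 'I_(r + r)) (u : grass) : grass :=
  [ffun S : {set 'I_(r + r)} => if s \in S then 0
     else (-1) ^+ #|[set t in S | (t < s)%N]| * u (s |: S)].

Definition ginv (u : grass) : grass := [ffun S : {set 'I_(r + r)} => (-1) ^+ #|S| * u S].

Definition gproj (p : nat) (u : grass) : grass :=
  [ffun S : {set 'I_(r + r)} => if #|S| == p then u S else 0].

End Grassmann.

(** * Local functions and the bracket in coordinates *)

Section Local.
Variables (R : realType) (n r : nat).

(* A function on T^*[2]A[1] in one coordinate system: x, p |-> coefficients on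
   the monomials in xi and theta. *)
Definition lfun := 'rV[R]_n -> 'rV[R]_n -> grass R r.

Definition lmul (F G : lfun) : lfun := fun x p => wedge (F x p) (G x p).

Definition ldx (c : 'I_n) (F : lfun) : lfun := fun x p =>
  [ffun S : {set 'I_(r + r)} => 'D_(basis_vec R c) (fun y => F y p S) x].
Definition ldp (c : 'I_n) (F : lfun) : lfun := fun x p =>
  [ffun S : {set 'I_(r + r)} => 'D_(basis_vec R c) (fun q => F x q S) p].
Definition ldodd (s : 'I_(r + r)) (F : lfun) : lfun := fun x p =>
  gder s (F x p).
Definition linv (F : lfun) : lfun := fun x p => ginv (F x p).

(* {p^i, x_i} = {theta^a, xi_a} = 1; [linv (ldodd s F)] is the right derivative
   of F with respect to the s-th odd coordinate. *)
Definition lbracket (F G : lfun) : lfun :=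
  \sum_(c < n) (lmul (ldp c F) (ldx c G) - lmul (ldx c F) (ldp c G)) +
  \sum_(a < r) (lmul (linv (ldodd (th_idx a) F)) (ldodd (xi_idx a) G) +
                lmul (linv (ldodd (xi_idx a) F)) (ldodd (th_idx a) G)).

Inductive gen := Gp of 'I_n | Gxi of 'I_r | Gth of 'I_r.

Definition bideg_gen (g : gen) : nat * nat :=
  match g with Gp _ => (1, 1) | Gxi _ => (0, 1) | Gth _ => (1, 0) end%N.

Definition bideg (w : seq gen) : nat * nat :=
  (\sum_(g <- w) (bideg_gen g).1, \sum_(g <- w) (bideg_gen g).2)%N.

Definition eval_word (v : gen -> grass R r) (w : seq gen) : grass R r :=
  foldr (fun g u => wedge (v g) u) (mon R finset.set0) w.

End Local.

(** * Functions on T^*[2]A[1] *)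

Section BigBracket.
Variables (R : realType) (n : nat) (M : manifold R n) (r : nat).
Variable A : vbundle M r.

(* The coordinates of the i-th chart as functions of those of the j-th one, at
   the point m and with moments p in the chart j.  With tau = x_j(x_i) and
   g = [trans j i], so that xi_j = g xi_i, the canonical one-form is preserved
   iff theta_i = g^T theta_j and
     p_i^c = sum_d (d_c tau^d) p_j^d
             + sum_(a,b) (d_c g_ab) xi_(i,b) theta_j^a. *)
Definition coord_change (i j : chart_index M) (m : M) (p : 'rV[R]_n)
    (g : gen n r) : grass R r :=
  let xi_i b := \sum_(e < r) trans A i j m b e *: xi R e in
  match g with
  | Gxi b => xi_i b
  | Gth b => \sum_(a < r) trans A j i m a b *: th R a
  | Gp c =>
      (\sum_(d < n) 'D_(basis_vec R c)
                      (fun y => chart j (param i y) 0 d) (chart i m) * p 0 d)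
        *: mon R finset.set0
      + \sum_(a < r) \sum_(b < r)
          'D_(basis_vec R c) (fun y => trans A j i (param i y) a b) (chart i m)
            *: wedge (xi_i b) (th R a)
  end.

(* Coordinate expressions in all charts; only the values over [cod i] matter,
   and [feq] is the equality of functions. *)
Definition fam := chart_index M -> lfun R n r.

Definition feq (F G : fam) :=
  forall i x p, cod i x -> F i x p = G i x p.

(* F^{k,l}: in the coordinates of every chart i, F is a polynomial of bidegree
   (k,l) in p, xi, theta with smooth coefficients; the expression in a chart j
   is obtained by the change of coordinates (case i = j: no change). *)
Definition isF (k l : nat) (F : fam) : Prop := forall i : chart_index M,
  exists (s : nat) (c : 'I_s -> 'rV[R]_n -> R) (w : 'I_s -> seq (gen n r)),
    (forall t, smooth_on (cod i) (c t) /\ bideg (w t) = (k, l)) /\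
    (forall j m p, dom i m -> dom j m ->
       F j (chart j m) p =
       \sum_(t < s) c t (chart i m) *: eval_word (coord_change i j m p) (w t)).

Definition bracket (F G : fam) : fam := fun i => lbracket (F i) (G i).

Definition is_section (X : fam) := isF 1 0 X.
Definition is_oneform (alpha : fam) := isF 0 1 alpha.
Definition is_bivector (P : fam) := isF 2 0 P.

Definition is_lie_algebroid (mu : fam) :=
  isF 1 2 mu /\ feq (bracket mu mu) 0.

(** * Poisson-Nijenhuis structures *)

Definition tensor11 := chart_index M -> 'rV[R]_n -> 'M[R]_r.

Definition is_tensor11 (N : tensor11) :=
  (forall i a b, smooth_on (cod i) (fun x => N i x a b)) /\
  (forall i j m, dom i m -> dom j m ->
     trans A j i m *m N i (chart i m) = N j (chart j m) *m trans A j i m).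

(* The derivation theta^b |-> sum_a N_ab theta^a: it is N on Gamma(A), zero on
   functions, and sum_i (-1)^(i-1) N(P_i) /\ hat P_i on P_1 /\ ... /\ P_p. *)
Definition act (N : tensor11) (F : fam) : fam := fun i x p =>
  \sum_(a < r) \sum_(b < r)
     N i x a b *: wedge (th R a) (gder (th_idx b) (F i x p)).

(* The transpose N^* on Gamma(A^* ). *)
Definition tact (N : tensor11) (F : fam) : fam := fun i x p =>
  \sum_(a < r) \sum_(b < r)
     N i x a b *: wedge (xi R b) (gder (xi_idx a) (F i x p)).

Definition lie (mu X Y : fam) : fam := bracket (bracket X mu) Y.

(* pi^# alpha; for pi = X /\ Y it is <alpha,X> Y - <alpha,Y> X. *)
Definition sharp (pi alpha : fam) : fam := bracket alpha pi.

(* Lie algebroid differential and Lie derivative of (A, mu) on Gamma(/\A^* ):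
   {mu, .} and {{X, mu}, .}. *)
Definition dA (mu omega : fam) : fam := bracket mu omega.
Definition lieder (mu X omega : fam) : fam := bracket (bracket X mu) omega.

(* [alpha, beta]_P for the bivector P with P^# = sh; P(alpha, beta) is
   <P^# alpha, beta>, and <.,.> is the big bracket. *)
Definition koszul (mu : fam) (sh : fam -> fam) (alpha beta : fam) : fam :=
  lieder mu (sh alpha) beta - lieder mu (sh beta) alpha
  - dA mu (bracket (sh alpha) beta).

Definition compatible (pi : fam) (N : tensor11) :=
  forall alpha, is_oneform alpha ->
    feq (act N (sharp pi alpha)) (sharp pi (tact N alpha)).

(* {{P, mu}, Q} is the Schouten-Nijenhuis bracket of P and Q. *)
Definition is_poisson (mu pi : fam) :=
  feq (bracket (bracket pi mu) pi) 0.

Definition torsion_free (mu : fam) (N : tensor11) :=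
  forall X Y, is_section X -> is_section Y ->
    feq (lie mu (act N X) (act N Y))
        (act N (lie mu (act N X) Y + lie mu X (act N Y)
                - act N (lie mu X Y))).

(* pi_N(alpha, beta) = pi(N^* alpha, beta), i.e. pi_N^# = pi^# o N^*. *)
Definition concomitant_zero (mu pi : fam) (N : tensor11) :=
  forall alpha beta, is_oneform alpha -> is_oneform beta ->
    feq (koszul mu (fun a => sharp pi (tact N a)) alpha beta)
        (koszul mu (sharp pi) (tact N alpha) beta
         + koszul mu (sharp pi) alpha (tact N beta)
         - tact N (koszul mu (sharp pi) alpha beta)).

Definition poisson_nijenhuis (mu pi : fam) (N : tensor11) :=
  [/\ compatible pi N, is_poisson mu pi, torsion_free mu N
    & concomitant_zero mu pi N].

(** * Vector-valued forms on L = Gamma(/\A)[2] *)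

Definition in_degree (d : int) (P : fam) : Prop :=
  match (d + 2)%R : int with
  | Posz p => isF p 0 P
  | Negz _ => feq P 0
  end.

Definition inL (P : fam) := exists (s : nat) (Q : 'I_s -> fam),
  (forall t : 'I_s, isF t 0 (Q t)) /\ feq P (\sum_(t < s) Q t).

Definition allL (xs : seq fam) :=
  forall t, (t < size xs)%N -> inL (nth 0 xs t).

(* The component of an element of L in L_(p-2) = Gamma(/\^p A). *)
Definition component (p : nat) (P : fam) : fam := fun i x q =>
  gproj p (P i x q).

(* A formal sum over k of k-linear maps L^k -> L: the k-linear one is the
   restriction to sequences of length k. *)
Definition vform := seq fam -> fam.

(* K is a sum of graded symmetric multilinear maps, all of degree a. *)
Definition is_vform (a : int) (K : vform) :=
  [/\ forall s1 X Y s2, allL s1 -> allL s2 -> inL X -> inL Y -> feq X Y ->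
        feq (K (s1 ++ X :: s2)) (K (s1 ++ Y :: s2)),
      forall s1 X Y s2 (u : R), allL s1 -> allL s2 -> inL X -> inL Y ->
        feq (K (s1 ++ (u *: X + Y) :: s2))
            (u *: K (s1 ++ X :: s2) + K (s1 ++ Y :: s2)),
      forall s1 X Y s2 (d e : int), allL s1 -> allL s2 ->
        in_degree d X -> in_degree e Y ->
        feq (K (s1 ++ X :: Y :: s2))
            ((-1) ^+ `|(d * e)%R|%N *: K (s1 ++ Y :: X :: s2))
    & forall (ds : seq int) (xs : seq fam), size ds = size xs ->
        (forall t, (t < size xs)%N -> in_degree (nth 0 ds t) (nth 0 xs t)) ->
        in_degree (\sum_(d <- ds) d + a) (K xs)].

(* iota_K H.  A subset S of the positions is the unshuffle sending its elements
   to the arguments of K and the others to H; all arities k = #|S| of K are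
   summed at once.  The arguments are first decomposed into homogeneous
   components, of degrees p t - 2, which carry the Koszul sign. *)
Definition insertion (K H : vform) : vform := fun xs =>
  \sum_(p : {ffun 'I_(size xs) -> 'I_r.+1})
  \sum_(S : {set 'I_(size xs)})
    (-1) ^+ (\sum_(t in S) \sum_(u in ~: S | (u < t)%N) p u * p t)%N *:
    (let X t := component (p t) (nth 0 xs t) in
     H (K [seq X t | t <- enum S] :: [seq X t | t <- enum (~: S)])).

(* [K, H] for K of degree a and H of degree b. *)
Definition vbracket (a b : int) (K H : vform) : vform := fun xs =>
  insertion K H xs - (-1) ^+ `|(a * b)%R|%N *: insertion H K xs.

Definition vform_eq (K H : vform) := forall xs, allL xs -> feq (K xs) (H xs).

(* l is of degree 1. *)
Definition nijenhuis_form (l j k : vform) :=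
  [/\ is_vform 0 j, is_vform 0 k,
      vform_eq (vbracket 0 1 j (vbracket 0 1 j l)) (vbracket 0 1 k l)
    & vform_eq (vbracket 0 0 j k) (fun=> 0)].

Definition l2 (mu : fam) : vform := fun xs =>
  if xs is [:: P; Q] then bracket (bracket mu P) Q else 0.

Definition vform0 (P : fam) : vform := fun xs =>
  if xs is [::] then P else 0.

Definition vform1 (f : fam -> fam) : vform := fun xs =>
  if xs is [:: P] then f P else 0.

Definition euler (P : fam) : fam :=
  \sum_(p < r.+1) ((p%:R - 2) : R) *: component p P.

End BigBracket.

(* Main.v *)
From HB Require Import structures.
Require Import Defs.
From mathcomp Require Import all_boot all_order all_algebra.
From mathcomp Require Import all_classical all_reals all_analysis.
From mathcomp Require Import zify ring lra.
Import numFieldNormedType.Exports.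
Set Implicit Arguments.
Unset Strict Implicit.
Unset Printing Implicit Defensive.
Import Order.TTheory GRing.Theory Num.Theory.
Local Open Scope ring_scope.

(** Everything is computed at one point of one chart.  There mu amounts to its
    anchor rho and its structure functions s, and l2 is a bidifferential operation
    [jbracket rho s] on first jets ([l2_jet]).  N acts on multivectors as a
    derivation, and the commutator of this derivation with such an operation is an
    operation of the same kind, with anchor rho o N ([jbracket_commutator]).

    The equation [j, [j, l2]] = [k, l2] is split according to the number of
    arguments.  Since l2 has degree one, [k, l2] = lambda l2 is purely binary
    ([jet2_euler]).
    - Without argument, the left-hand side is l2(pi, pi), which is up to sign the
      Schouten square of pi ([nil_poisson]).
    - With one argument X it is -(l2(N pi, X) + 2 l2(pi, N X) - 2 N l2(pi, X)).
      The derivatives of X cancel because pi and N are compatible, and there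
      remains -2 sum_b C_b D_b X, with D_b the derivative along theta^b
      ([jbracket_mm_coef]).  The C_b are bivectors, and the C_b(alpha, beta) are
      the components of the Magri-Morosi concomitant ([concomitant_jet]).
    - With two arguments it is the double commutator of N with l2.  Its anchor is
      rho o N^2 = lambda rho, so that it differs from lambda l2 by a tensorial
      operation ([jbracket_double_commutator]), which on sections is twice the
      torsion of N ([torsion_jet]).
    A tensorial expression is zero if it is zero on sections or one-forms whose
    values at the point run through a basis; these are obtained from bump functions
    ([section_exists], [oneform_exists]).

    The other requirements hold without further conditions: [j, k] = 0 because N
    preserves the degree and pi has degree zero in L ([bracket_jk]), and j, k are
    vector-valued forms of degree zero because N maps multivectors with smooth
    coefficients to such multivectors in a way compatible with changes of charts
    ([isF_act]). *)

(** * The Grassmann algebra: product and derivatives *)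

Lemma sgn_odd (R : pzRingType) (m n : nat) : odd m = odd n -> (-1) ^+ m = (-1) ^+ n :> R.
Proof. by move=> e; rewrite -signr_odd e signr_odd. Qed.

Ltac parity := apply: sgn_odd; rewrite /= ?oddD /=;
  repeat (match goal with |- context [odd ?n] => case: (odd n) end); done.

Section GrassmannLaws.
Import mathcomp.boot.finset.
Variables (R : realType) (r : nat).
Implicit Types (u v w : grass R r) (S T U : {set 'I_(r + r)}) (s t : 'I_(r + r)).

Lemma grass_sum I (rI : seq I) (P : pred I) (F : I -> grass R r) S :
  (\sum_(i <- rI | P i) F i) S = \sum_(i <- rI | P i) F i S.
Proof. by rewrite sum_ffunE. Qed.

Lemma grassZ (a : R) u S : (a *: u) S = a * u S.
Proof. by rewrite ffunE. Qed.
Lemma grassD u v S : (u + v) S = u S + v S.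
Proof. by rewrite ffunE. Qed.
Lemma grassN u S : (- u) S = - u S.
Proof. by rewrite ffunE. Qed.
Lemma grass0 S : (0 : grass R r) S = 0.
Proof. by rewrite ffunE. Qed.
Let gE := (grassZ, ffunE).

Lemma grass_expand u : u = \sum_S u S *: mon R S.
Proof.
apply/ffunP => T; rewrite grass_sum (bigD1 T) //= !gE eqxx mulr1.
rewrite big1 ?addr0 // => S neST; rewrite !gE eq_sym (negPf neST).
by rewrite mulr0.
Qed.

Lemma wedge_is_linear u : linear (wedge u).
Proof.
move=> a v w; apply/ffunP => S; rewrite !gE /= mulr_sumr -big_split /=.
apply: eq_bigr => T _; rewrite !gE /= !mulrDr; congr (_ + _).
by rewrite [u T * _]mulrCA [LHS]mulrCA.
Qed.
HB.instance Definition _ u :=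
  GRing.isLinear.Build R (grass R r) (grass R r) _ (wedge u) (wedge_is_linear u).

Definition wedger v u := wedge u v.
Lemma wedger_is_linear v : linear (wedger v).
Proof.
move=> a u w; apply/ffunP => S; rewrite !gE /= mulr_sumr -big_split /=.
apply: eq_bigr => T _; rewrite !gE /= mulrDl mulrDr; congr (_ + _).
by rewrite -[a * _ * _]mulrA [LHS]mulrCA.
Qed.
HB.instance Definition _ v :=
  GRing.isLinear.Build R (grass R r) (grass R r) _ (wedger v) (wedger_is_linear v).

Lemma wedgeDl u v w : wedge (u + v) w = wedge u w + wedge v w.
Proof. exact: (linearD (wedger w)). Qed.
Lemma wedgeNl u w : wedge (- u) w = - wedge u w.
Proof. exact: (linearN (wedger w)). Qed.
Lemma wedgeZl a u w : wedge (a *: u) w = a *: wedge u w.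
Proof. exact: (linearZ_LR (wedger w)). Qed.
Lemma wedge0l w : wedge 0 w = 0.
Proof. exact: (linear0 (wedger w)). Qed.
Lemma wedge_suml I (rI : seq I) (P : pred I) (F : I -> grass R r) w :
  wedge (\sum_(i <- rI | P i) F i) w = \sum_(i <- rI | P i) wedge (F i) w.
Proof. exact: (linear_sum (wedger w)). Qed.
Lemma wedgeDr u v w : wedge u (v + w) = wedge u v + wedge u w.
Proof. exact: linearD. Qed.
Lemma wedgeNr u w : wedge u (- w) = - wedge u w.
Proof. exact: linearN. Qed.
Lemma wedgeZr a u w : wedge u (a *: w) = a *: wedge u w.
Proof. exact: linearZ_LR. Qed.
Lemma wedge0r w : wedge w 0 = 0.
Proof. exact: linear0. Qed.
Lemma wedge_sumr I (rI : seq I) (P : pred I) (F : I -> grass R r) u :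
  wedge u (\sum_(i <- rI | P i) F i) = \sum_(i <- rI | P i) wedge u (F i).
Proof. exact: linear_sum. Qed.

Lemma gder_is_linear s : linear (@gder R r s).
Proof.
move=> a u v; apply/ffunP => S; rewrite !gE /=.
by case: ifP => _; rewrite ?mulr0 ?addr0 // mulrDr mulrCA.
Qed.
HB.instance Definition _ s :=
  GRing.isLinear.Build R (grass R r) (grass R r) _ (@gder R r s) (gder_is_linear s).

Lemma ginv_is_linear : linear (@ginv R r).
Proof. by move=> a u v; apply/ffunP => S; rewrite !gE /= mulrDr mulrCA. Qed.
HB.instance Definition _ :=
  GRing.isLinear.Build R (grass R r) (grass R r) _ (@ginv R r) ginv_is_linear.

Lemma gproj_is_linear p : linear (@gproj R r p).
Proof.
move=> a u v; apply/ffunP => S; rewrite !gE /=.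
by case: ifP => _ //; rewrite mulr0 addr0.
Qed.
HB.instance Definition _ p :=
  GRing.isLinear.Build R (grass R r) (grass R r) _ (@gproj R r p) (gproj_is_linear p).

(** Every identity below is reduced in this way to a computation of signs on
    monomials. *)
Lemma grass_linear_ext (f g : {linear grass R r -> grass R r}) :
  (forall S, f (mon R S) = g (mon R S)) -> f =1 g.
Proof.
move=> fg u; rewrite (grass_expand u) !linear_sum.
by apply: eq_bigr => S _; rewrite !linearZ_LR fg.
Qed.

Lemma inversionsE S T :
  inversions S T = (\sum_(s in S) \sum_(t in T) (t < s))%N.
Proof.
rewrite /inversions cardsE -sum1_card pair_big_dep /=.
rewrite (eq_bigl (fun p => ((p.1 \in S) && (p.2 \in T)) && (p.2 < p.1)%N)).
  by rewrite big_mkcondr; apply: eq_bigr => p _; case: ltnP.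
by move=> [i j]; rewrite /in_mem /= andbA.
Qed.

Lemma big_setU_disj S T (F : 'I_(r + r) -> nat) : [disjoint S & T] ->
  (\sum_(s in S :|: T) F s = \sum_(s in S) F s + \sum_(s in T) F s)%N.
Proof.
by move=> dST; rewrite -bigU //; apply: eq_bigl => s; rewrite !inE.
Qed.

Lemma inversionsUl S T U : [disjoint S & T] ->
  inversions (S :|: T) U = (inversions S U + inversions T U)%N.
Proof. by move=> dST; rewrite !inversionsE big_setU_disj. Qed.

Lemma inversionsUr S T U : [disjoint S & T] ->
  inversions U (S :|: T) = (inversions U S + inversions U T)%N.
Proof.
move=> dST; rewrite !inversionsE -big_split; apply: eq_bigr => s _.
by rewrite big_setU_disj.
Qed.

Lemma inversions1l s T : inversions [set s] T = #|[set t in T | (t < s)%N]|.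
Proof.
rewrite inversionsE big_set1 cardsE -sum1_card [RHS]big_mkcondr.
by apply: eq_bigr => t _; case: ltnP.
Qed.

Lemma inversions1r s T : inversions T [set s] = #|[set t in T | (s < t)%N]|.
Proof.
rewrite inversionsE cardsE -sum1_card [RHS]big_mkcondr.
by apply: eq_bigr => t _; rewrite big_set1; case: ltnP.
Qed.

(** Each pair of generators is inverted in exactly one of the two orders; this
    is the origin of the Koszul signs. *)
Lemma inversionsC S T : [disjoint S & T] ->
  (inversions S T + inversions T S = #|S| * #|T|)%N.
Proof.
move=> dST; rewrite !inversionsE [X in (_ + X)%N]exchange_big -big_split /=.
rewrite -sum_nat_const; apply: eq_bigr => s sS; rewrite -big_split /=.
rewrite -sum1_card; apply: eq_bigr => t tT.
case: (ltngtP s t) => // /val_inj e; move: (disjointFr dST sS).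
by rewrite e tT.
Qed.

Lemma wedge_mon S T : wedge (mon R S) (mon R T) =
  if [disjoint S & T] then (-1) ^+ inversions S T *: mon R (S :|: T) else 0.
Proof.
apply/ffunP => V; rewrite gE.
transitivity (if (S \subset V) && (V :\: S == T)
              then (-1) ^+ inversions S T else 0 : R).
  case SV: (S \subset V) => /=.
    rewrite (bigD1 S) //= !gE eqxx mul1r big1 ?addr0.
      by case: eqP => [->|]; rewrite ?mulr1 ?mulr0.
    by move=> U /andP[_ /negPf neUS]; rewrite !gE neUS mul0r mulr0.
  rewrite big1 // => U UV; rewrite !gE; case: eqP => [e|_].
    by rewrite -e UV in SV.
  by rewrite mul0r mulr0.
case: (boolP [disjoint S & T]) => dST; last first.
  rewrite gE; case: ifP => // /andP[SV /eqP e].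
  by rewrite -e disjoint_sym disjoints_subset subsetDr in dST.
rewrite !gE /=.
have -> : (S \subset V) && (V :\: S == T) = (V == S :|: T).
  apply/andP/eqP => [[SV /eqP <-]|->].
    by rewrite setDE setUIr setUCr setIT; apply/esym/setUidPr.
  rewrite subsetUl setDUl setDv set0U; split=> //; apply/eqP/setDidPl.
  by rewrite disjoint_sym.
by case: eqP; rewrite ?mulr1 ?mulr0.
Qed.

Lemma disjointsU S T U :
  [disjoint S :|: T & U] = [disjoint S & U] && [disjoint T & U].
Proof. by rewrite !disjoints_subset subUset. Qed.

Lemma wedgeA u v w : wedge u (wedge v w) = wedge (wedge u v) w.
Proof.
move: u; apply: (grass_linear_ext (f := wedger (wedge v w))
  (g := wedger w \o wedger v)) => S /=; rewrite /wedger.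
move: v; apply: (grass_linear_ext (f := wedge (mon R S) \o wedger w)
  (g := wedger w \o wedge (mon R S))) => T /=; rewrite /wedger.
move: w; apply: (grass_linear_ext (f := wedge (mon R S) \o wedge (mon R T))
  (g := wedge (wedge (mon R S) (mon R T)))) => U /=.
rewrite !wedge_mon.
case: (boolP [disjoint T & U]) => dTU; case: (boolP [disjoint S & T]) => dST;
  rewrite ?wedge0l ?wedge0r ?wedgeZl ?wedgeZr ?wedge_mon ?disjointsU
    1?(disjoint_sym S (T :|: U)) ?disjointsU
    1?(disjoint_sym T S) 1?(disjoint_sym U S) ?dST ?dTU
    ?(negPf dST) ?(negPf dTU) ?andbF ?scaler0 //=.
rewrite andbT; case: ifP => dSU //; rewrite ?scaler0 //.
rewrite !scalerA -!exprD setUA inversionsUr // inversionsUl //.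
by congr (_ ^+ _ *: _); lia.
Qed.

Lemma inversions0l T : inversions set0 T = 0%N.
Proof. by rewrite inversionsE big_set0. Qed.
Lemma inversions0r T : inversions T set0 = 0%N.
Proof. by rewrite inversionsE big1 // => s _; rewrite big_set0. Qed.

Lemma wedge1l u : wedge (mon R set0) u = u.
Proof.
apply: (grass_linear_ext (f := wedge (mon R set0)) (g := idfun)) => S /=.
by rewrite wedge_mon -setI_eq0 set0I eqxx inversions0l expr0 scale1r set0U.
Qed.

Lemma wedge1r u : wedge u (mon R set0) = u.
Proof.
apply: (grass_linear_ext (f := wedger (mon R set0)) (g := idfun)) => S /=.
rewrite /wedger wedge_mon -setI_eq0 setI0 eqxx inversions0r expr0 scale1r.
by rewrite setU0.
Qed.

Lemma gder_mon s S : gder s (mon R S) =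
  if s \in S then (-1) ^+ #|[set t in S | (t < s)%N]| *: mon R (S :\ s) else 0.
Proof.
apply/ffunP => V; rewrite !gE.
case: (boolP (s \in S)) => sS; last first.
  rewrite gE; case: ifP => // sV; case: eqP => [e|]; last by rewrite mulr0.
  by rewrite -e setU11 in sS.
rewrite !gE /=; case: (boolP (s \in V)) => sV.
  case: eqP => [e|]; last by rewrite mulr0.
  by rewrite e !inE eqxx in sV.
have -> : (s |: V == S) = (V == S :\ s).
  by apply/eqP/eqP => [<-|->]; rewrite ?setU1K ?setD1K.
case: eqP => [->|_]; last by rewrite !mulr0.
congr ((-1) ^+ _ * _); apply: eq_card => t; rewrite !inE.
by case: (eqVneq t s) => [->|_]; rewrite ?ltnn ?andbF.
Qed.

Lemma ginv_mon S : ginv (mon R S) = (-1) ^+ #|S| *: mon R S.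
Proof. by apply/ffunP => V; rewrite !gE /=; case: eqP => [->|_]; rewrite ?mulr0. Qed.

Lemma ginv_wedge u v : ginv (wedge u v) = wedge (ginv u) (ginv v).
Proof.
move: u; apply: (grass_linear_ext (f := @ginv R r \o wedger v)
  (g := wedger (ginv v) \o @ginv R r)) => S /=; rewrite /wedger.
move: v; apply: (grass_linear_ext (f := @ginv R r \o wedge (mon R S))
  (g := wedge (ginv (mon R S)) \o @ginv R r)) => T /=.
rewrite !ginv_mon wedgeZl wedgeZr wedge_mon; case: ifP => dST.
  rewrite linearZ_LR /= ginv_mon !scalerA -!exprD; congr (_ ^+ _ *: _).
  by rewrite -cardsUI; move: dST; rewrite -setI_eq0 => /eqP ->; rewrite cards0 addn0 addnC.
by rewrite linear0 !scaler0.
Qed.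

Lemma gder_ginv s u : gder s (ginv u) = - ginv (gder s u).
Proof.
apply/ffunP => S; rewrite !gE /=; case: ifP => sS.
  by rewrite mulr0 oppr0.
by rewrite cardsU1 sS exprD expr1 mulN1r mulNr mulrN mulrCA.
Qed.

Lemma card_lt_gt S s : s \in S ->
  (#|[set t in S | t < s]| + #|[set t in S | s < t]|)%N.+1 = #|S|.
Proof.
move=> sS; rewrite (cardsD1 s S) sS add1n -cardsUI; congr _.+1.
rewrite [X in (_ + X)%N]eq_card0 ?addn0; last first.
  by move=> t; rewrite !inE; case: (ltngtP t s); rewrite ?andbF.
apply: eq_card => t; rewrite !inE -val_eqE /=.
by case: (ltngtP t s); rewrite /= ?andbF ?andbT ?orbF.
Qed.

Lemma card_ltU S T s : [disjoint S & T] ->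
  #|[set t in S :|: T | (t < s)%N]| =
  (#|[set t in S | (t < s)%N]| + #|[set t in T | (t < s)%N]|)%N.
Proof. by move=> dST; rewrite -!inversions1l inversionsUr. Qed.

Lemma card_ltD1 S s : 
  #|[set t in S :\ s | (t < s)%N]| = #|[set t in S | (t < s)%N]|.
Proof.
apply: eq_card => t; rewrite !inE.
by case: (eqVneq t s) => [->|_]; rewrite ?ltnn ?andbF.
Qed.

(** The graded Leibniz rule.  On monomials the delicate case is the one where s
    occurs in both factors: the product is zero, and the two terms cancel. *)
Lemma gder_wedge s u v :
  gder s (wedge u v) = wedge (gder s u) v + wedge (ginv u) (gder s v).
Proof.
move: u; apply: (grass_linear_ext (f := @gder R r s \o wedger v)
  (g := GRing.add_fun (wedger v \o @gder R r s) (wedger (gder s v) \o @ginv R r)))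
  => S /=; rewrite /wedger /=.
move: v; apply: (grass_linear_ext (f := @gder R r s \o wedge (mon R S))
  (g := GRing.add_fun (wedge (gder s (mon R S))) (wedge (ginv (mon R S)) \o @gder R r s)))
  => T /=.
rewrite ginv_mon wedgeZl wedge_mon !gder_mon.
have d1 (U V : {set 'I_(r + r)}) : s \notin U -> [disjoint U & V] = [disjoint U & V :\ s].
  move=> sU; rewrite -!setI_eq0; congr (_ == _); apply/setP => t; rewrite !inE.
  by case: (eqVneq t s) => // ->; rewrite (negPf sU).
case: (boolP (s \in S)) => sS; case: (boolP (s \in T)) => sT.
- have -> : [disjoint S & T] = false.
    by apply/negP => /disjointFr/(_ sS); rewrite sT.
  rewrite linear0 wedgeZl wedgeZr !wedge_mon.
  have -> : [disjoint S & T :\ s] = [disjoint S :\ s & T :\ s].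
    by rewrite disjoint_sym d1 ?(disjoint_sym (T :\ s)) // !inE eqxx.
  rewrite (d1 (S :\ s)) ?inE ?eqxx //.
  case: ifP => dST; last by rewrite !scaler0 addr0.
  have eU : S :|: T :\ s = S :\ s :|: T.
    by rewrite -{1}(setD1K sS) -{2}(setD1K sT) setUAC setUCA setUA setUAC [_ :|: S :\ s]setUC.
  rewrite eU !scalerA -scalerDl.
  have -> : inversions (S :\ s) T = (inversions (S :\ s) (T :\ s) + #|[set t in S | (s < t)%N]|)%N.
    rewrite -{1}(setD1K sT) inversionsUr ?disjoints1 ?inE ?eqxx // addnC.
    congr (_ + _)%N; rewrite inversions1r; apply: eq_card => t; rewrite !inE.
    by case: (eqVneq t s) => [->|_]; rewrite ?ltnn ?andbF.
  have -> : inversions S (T :\ s) = (inversions (S :\ s) (T :\ s) + #|[set t in T | (t < s)%N]|)%N.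
    rewrite -{1}(setD1K sS) inversionsUl ?disjoints1 ?inE ?eqxx // addnC.
    by rewrite inversions1l card_ltD1.
  rewrite -!exprD -(card_lt_gt sS).
  set a := #|_|; set b := #|_|; set c := #|_|; set i := inversions _ _.
  have -> : (-1) ^+ (((a + b).+1 + c + (i + c))%N) = - (-1) ^+ ((a + (i + b))%N) :> R.
    rewrite -[RHS]mulN1r -exprS; parity.
  by rewrite subrr scale0r.
- rewrite wedge0r scaler0 addr0 wedgeZl wedge_mon.
  have -> : [disjoint S :\ s & T] = [disjoint S & T].
    by rewrite disjoint_sym -d1 // disjoint_sym.
  case: ifP => dST; last by rewrite linear0 scaler0.
  rewrite linearZ_LR /= gder_mon inE sS /= !scalerA -!exprD card_ltU //.
  have -> : (S :|: T) :\ s = S :\ s :|: T.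
    by rewrite setDUl [T :\ s](setDidPl _) // disjoint_sym disjoints1.
  rewrite -{1}(setD1K sS) inversionsUl ?disjoints1 ?inE ?eqxx // inversions1l.
  by congr (_ *: _); parity.
- rewrite wedge0l add0r wedgeZr wedge_mon -d1 //.
  case: ifP => dST; last by rewrite linear0 !scaler0.
  rewrite linearZ_LR /= gder_mon inE sT orbT /= !scalerA -!exprD card_ltU //.
  have -> : (S :|: T) :\ s = S :|: T :\ s.
    by rewrite setDUl [S :\ s](setDidPl _) // disjoint_sym disjoints1.
  rewrite -{1}(setD1K sT) inversionsUr ?disjoints1 ?inE ?eqxx // inversions1r.
  have : (#|[set t in S | t < s]| + #|[set t in S | s < t]|)%N = #|S|.
    rewrite -cardsUI [X in (_ + X)%N]eq_card0 ?addn0; last first.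
      by move=> t; rewrite !inE; case: (ltngtP t s); rewrite ?andbF.
    apply: eq_card => t; rewrite !inE; case: (ltngtP t s) => [||/val_inj ->].
    + by rewrite andbF orbF andbT.
    + by rewrite andbF andbT.
    by rewrite (negPf sS).
  by move=> <-; congr (_ *: _); parity.
rewrite wedge0l wedge0r scaler0 addr0.
case: ifP => dST; last by rewrite linear0.
by rewrite linearZ_LR /= gder_mon inE (negPf sS) (negPf sT) scaler0.
Qed.

Lemma gder_gder s t u : gder s (gder t u) = - gder t (gder s u).
Proof.
apply/ffunP => S; rewrite !gE /= !inE.
case: (eqVneq s t) => [->|nst].
  by case: ifP => _; rewrite ?oppr0 // ?eqxx /= mulr0 oppr0.
case: (boolP (s \in S)) => sS; case: (boolP (t \in S)) => tS;
  rewrite /= ?mulr0 ?oppr0 //.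
rewrite setUCA !mulrA -mulNr -!exprD -[in RHS]mulN1r -exprS; congr (_ * _).
have e a b : a != b -> a \notin S -> 
    #|[set x in a |: S | (x < b)%N]| = ((a < b) + #|[set x in S | (x < b)%N]|)%N.
  move=> nab aS; rewrite card_ltU ?disjoints1 //; congr (_ + _)%N.
  rewrite -inversions1l inversionsE !big_set1 //.
rewrite !e // 1?eq_sym //; apply: sgn_odd.
by move: nst; rewrite -val_eqE /=; lia.
Qed.

End GrassmannLaws.

Ltac gring := apply/ffunP => ?;
  rewrite ?(grassD, grassN, grassZ, grass0); ring.

(** * Homogeneous elements, multivectors and bidegrees *)

Section GrassmannGrading.
Import mathcomp.boot.finset.
Variables (R : realType) (r : nat).
Implicit Types (u v w : grass R r) (S T U : {set 'I_(r + r)}) (s t : 'I_(r + r)).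
Let gE := (@grassZ R r, ffunE).

(** A condition on the support, so that zero is homogeneous of every degree. *)
Definition hdeg p u := forall S, u S != 0 -> #|S| = p.

Lemma hdeg0 p : hdeg p 0.
Proof. by move=> S; rewrite gE eqxx. Qed.

Lemma hdegP p a u v : hdeg p u -> hdeg p v -> hdeg p (a *: u + v).
Proof.
move=> hu hv S; rewrite !gE; case: (eqVneq (u S) 0) => [->|/hu //].
by rewrite mulr0 add0r => /hv.
Qed.

Lemma hdegZ p a u : hdeg p u -> hdeg p (a *: u).
Proof. by move=> hu; rewrite -[_ *: _]addr0; apply: hdegP => //; apply: hdeg0. Qed.

Lemma hdegD p u v : hdeg p u -> hdeg p v -> hdeg p (u + v).
Proof. by move=> hu hv; rewrite -[u]scale1r; apply: hdegP. Qed.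

Lemma hdeg_sum p I (rI : seq I) (P : pred I) (F : I -> grass R r) :
  (forall i, P i -> hdeg p (F i)) -> hdeg p (\sum_(i <- rI | P i) F i).
Proof. by move=> h; apply: big_ind => //; [apply: hdeg0 | apply: hdegD]. Qed.

Lemma hdeg_mon S : hdeg #|S| (mon R S).
Proof. by move=> T; rewrite gE; case: (eqVneq T S) => [->|]; rewrite ?eqxx. Qed.

Lemma hdeg_gproj p u : hdeg p (gproj p u).
Proof. by move=> S; rewrite gE; case: (eqVneq #|S| p); rewrite ?eqxx. Qed.

Lemma gproj_hdeg p q u : hdeg p u -> gproj q u = if q == p then u else 0.
Proof.
move=> hu; apply/ffunP => S; rewrite gE; case: (eqVneq (u S) 0) => [e|/hu ->].
  by rewrite e if_same; case: (q == p); rewrite ?gE.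
by rewrite eq_sym; case: (q == p); rewrite ?gE.
Qed.

(** This is how identities known on monomials are transported when they carry a
    condition on the degree. *)
Lemma hdeg_ind (P : grass R r -> Prop) p u : hdeg p u ->
  P 0 -> (forall a v w, P v -> P w -> P (a *: v + w)) ->
  (forall S, #|S| = p -> P (mon R S)) -> P u.
Proof.
move=> hu P0 PD PS; rewrite (grass_expand u).
rewrite -big_filter big_seq; elim/big_rec: _ => // S v; rewrite mem_filter => _ Pv.
case: (eqVneq (u S) 0) => [->|/hu /PS PSS]; first by rewrite scale0r add0r.
exact: PD.
Qed.

Lemma ginv_hdeg p u : hdeg p u -> ginv u = (-1) ^+ p *: u.
Proof.
move=> hu; apply/ffunP => S; rewrite !gE; case: (eqVneq (u S) 0) => [->|/hu -> //].
by rewrite !mulr0.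
Qed.

Lemma wedgeC p q u v : hdeg p u -> hdeg q v ->
  wedge u v = (-1) ^+ (p * q) *: wedge v u.
Proof.
move=> hu hv; pattern u; apply: (hdeg_ind hu) => {u hu} [|a u w eu ew|S cS].
- by rewrite wedge0l wedge0r scaler0.
- by rewrite wedgeDl wedgeZl wedgeDr wedgeZr eu ew scalerDr !scalerA mulrC.
pattern v; apply: (hdeg_ind hv) => {v hv} [|a u w eu ew|T cT].
- by rewrite wedge0l wedge0r scaler0.
- by rewrite wedgeDl wedgeZl wedgeDr wedgeZr eu ew scalerDr !scalerA mulrC.
rewrite !wedge_mon disjoint_sym; case: ifP => dTS; last by rewrite scaler0.
rewrite setUC scalerA -exprD -cS -cT -inversionsC 1?disjoint_sym //.
by congr (_ *: _); parity.
Qed.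

Lemma hdeg_wedge p q u v : hdeg p u -> hdeg q v -> hdeg (p + q) (wedge u v).
Proof.
move=> hu hv; pattern u; apply: (hdeg_ind hu) => {u hu} [|a u w eu ew|S cS].
- by rewrite wedge0l; apply: hdeg0.
- by rewrite wedgeDl wedgeZl; apply: hdegP.
pattern v; apply: (hdeg_ind hv) => {v hv} [|a u w eu ew|T cT].
- by rewrite wedge0r; apply: hdeg0.
- by rewrite wedgeDr wedgeZr; apply: hdegP.
rewrite wedge_mon; case: ifP => dST; last exact: hdeg0.
apply: hdegZ; rewrite -cS -cT -cardsUI.
move: dST; rewrite -setI_eq0 => /eqP ->; rewrite cards0 addn0.
exact: hdeg_mon.
Qed.

Lemma hdeg_gder p s u : hdeg p.+1 u -> hdeg p (gder s u).
Proof.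
move=> hu S; rewrite gE; case: ifP => sS; first by rewrite eqxx.
rewrite mulf_eq0 negb_or => /andP[_ /hu].
by rewrite cardsU1 sS => -[].
Qed.

Lemma gder_hdeg0 s u : hdeg 0 u -> gder s u = 0.
Proof.
move=> hu; apply/ffunP => S; rewrite !gE; case: ifP => // sS.
apply/eqP; rewrite mulf_eq0; apply/orP; right; apply: contraT => /hu /eqP.
by rewrite cards_eq0 => /eqP/setP/(_ s); rewrite setU11 inE.
Qed.

(** In positive degree every monomial contains a generator, and the derivative
    with respect to it keeps the coefficient up to sign. *)
Lemma hdeg_gder_eq0 p u : hdeg p.+1 u -> (forall s, gder s u = 0) -> u = 0.
Proof.
move=> hu du; apply/ffunP => S; rewrite gE; apply/eqP; apply: contraT => uS.
have /card_gt0P[s sS] : (0 < #|S|)%N by rewrite (hu _ uS).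
move/ffunP: (du s) => /(_ (S :\ s)); rewrite !gE setD1K // !inE eqxx /=.
by move/eqP; rewrite mulf_eq0 signr_eq0 (negPf uS).
Qed.

Lemma hdeg0E u : hdeg 0 u -> u = u set0 *: mon R set0.
Proof.
move=> hu; apply/ffunP => S; rewrite !gE; case: eqP => [->|/eqP neS].
  by rewrite mulr1.
rewrite mulr0; apply/eqP; apply: contraT => /hu /eqP.
by rewrite cards_eq0 (negPf neS).
Qed.

Lemma gder_gen s t : gder s (mon R [set t]) = (s == t)%:R *: mon R set0.
Proof.
rewrite gder_mon inE; case: eqP => [->|]; last by rewrite scale0r.
rewrite [#|_|](_ : _ = 0%N) ?expr0 ?setDv //.
by apply: eq_card0 => x; rewrite !inE; case: eqP => // ->; rewrite ltnn.
Qed.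

Lemma hdeg_gen s : hdeg 1 (mon R [set s]).
Proof. by rewrite -(cards1 s); apply: hdeg_mon. Qed.

Lemma hdeg_one : hdeg 0 (mon R set0).
Proof. by rewrite -(@cards0 'I_(r + r)); apply: hdeg_mon. Qed.

Lemma ginv_gen s : ginv (mon R [set s]) = - mon R [set s].
Proof. by rewrite ginv_mon cards1 expr1 scaleN1r. Qed.

Lemma wedge_gen_ginv s u : wedge (mon R [set s]) (ginv u) = wedge u (mon R [set s]).
Proof.
apply: (grass_linear_ext (f := wedge (mon R [set s]) \o @ginv R r)
  (g := wedger (mon R [set s]))) => S /=; rewrite /wedger.
rewrite ginv_mon wedgeZr (wedgeC (@hdeg_gen s) (@hdeg_mon S)) mul1n scalerA.
by rewrite -exprMn mulrNN mulr1 expr1n scale1r.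
Qed.

Lemma gder_ext u v : (forall s, gder s u = gder s v) -> u set0 = v set0 -> u = v.
Proof.
move=> e e0; apply/ffunP => S; case: (set_0Vmem S) => [-> //|[s sS]].
move/ffunP: (e s) => /(_ (S :\ s)); rewrite !gE setD1K // !inE eqxx /=.
by move/mulfI; apply; rewrite signr_eq0.
Qed.

(** The multivectors: no xi occurs. *)
Definition thonly u := forall a, gder (xi_idx a) u = 0.

Lemma thonlyP a u v : thonly u -> thonly v -> thonly (a *: u + v).
Proof. by move=> tu tv b; rewrite linearP /= tu tv scaler0 addr0. Qed.

Lemma thonly0 : thonly 0.
Proof. by move=> b; rewrite linear0. Qed.

Lemma thonlyZ a u : thonly u -> thonly (a *: u).
Proof. by move=> tu b; rewrite linearZ_LR /= tu scaler0. Qed.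

Lemma thonly_sum I (rI : seq I) (P : pred I) (F : I -> grass R r) :
  (forall i, P i -> thonly (F i)) -> thonly (\sum_(i <- rI | P i) F i).
Proof. by move=> h b; rewrite linear_sum big1 // => i /h/(_ b). Qed.

Lemma thonly_ginv u : thonly u -> thonly (ginv u).
Proof. by move=> tu b; rewrite gder_ginv tu linear0 oppr0. Qed.

Lemma thonly_wedge u v : thonly u -> thonly v -> thonly (wedge u v).
Proof. by move=> tu tv b; rewrite gder_wedge tu tv wedge0l wedge0r addr0. Qed.

Lemma thonly_gder s u : thonly u -> thonly (gder s u).
Proof. by move=> tu b; rewrite gder_gder tu linear0 oppr0. Qed.

Lemma neq_xi_th (a b : 'I_r) : (xi_idx a == th_idx b) = false.
Proof. by apply/negbTE/eqP => /(congr1 val) /=; move: (ltn_ord a); lia. Qed.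

Lemma eq_th_th (a b : 'I_r) : (th_idx a == th_idx b) = (a == b).
Proof. by rewrite -!val_eqE /= eqn_add2l. Qed.

Lemma eq_xi_xi (a b : 'I_r) : (xi_idx a == xi_idx b) = (a == b).
Proof. by rewrite -!val_eqE. Qed.

Lemma thonly_th a : thonly (th R a).
Proof. by move=> b; rewrite gder_gen neq_xi_th scale0r. Qed.

Lemma odd_idxP s : {a : 'I_r | s = xi_idx a} + {a : 'I_r | s = th_idx a}.
Proof.
case: (splitP s) => [j|k] e; [left; exists j | right; exists k];
  exact: val_inj.
Qed.

Lemma thonly_supp u S a : thonly u -> u S != 0 -> xi_idx a \notin S.
Proof.
move=> tu uS; apply/negP => aS; move/ffunP: (tu a) => /(_ (S :\ xi_idx a)).
rewrite !gE setD1K // !inE eqxx /= => /eqP.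
by rewrite mulf_eq0 signr_eq0 (negPf uS).
Qed.

Lemma thonly_card u S : thonly u -> u S != 0 -> (#|S| <= r)%N.
Proof.
move=> tu uS; rewrite -[X in (_ <= X)%N](card_ord r) -cardsT.
rewrite -(card_imset _ (@rshift_inj r r)); apply: subset_leq_card.
apply/fintype.subsetP => s sS; case: (odd_idxP s) => -[a e].
  by move: (thonly_supp a tu uS); rewrite -e sS.
by rewrite e; apply: imset_f; rewrite inE.
Qed.

Lemma thonly_gproj p u : thonly u -> thonly (gproj p u).
Proof.
move=> tu a; apply/ffunP => S; rewrite !gE; case: ifP => // aS.
case: ifP => _; last by rewrite mulr0.
by move/ffunP: (tu a) => /(_ S); rewrite !gE aS.
Qed.

Lemma thonly_hdeg_gt p u : thonly u -> hdeg p u -> (r < p)%N -> u = 0.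
Proof.
move=> tu hu lt; apply/ffunP => S; rewrite gE; apply/eqP; apply: contraT => uS.
by move: (thonly_card tu uS) lt; rewrite (hu _ uS) leqNgt => /negPf ->.
Qed.

(** Only r generators theta are available, so that nothing lies beyond degree r:
    the sums over p < r.+1 in insertions and in the Euler map lose nothing. *)
Lemma sum_gproj u : thonly u -> \sum_(p < r.+1) gproj p u = u.
Proof.
move=> tu; apply/ffunP => S; rewrite grass_sum.
case: (eqVneq (u S) 0) => [uS|uS].
  by rewrite uS big1 // => p _; rewrite gE uS if_same.
have lt : (#|S| < r.+1)%N by rewrite ltnS; apply: thonly_card uS.
rewrite (bigD1 (Ordinal lt)) //= gE eqxx big1 ?addr0 // => p ne.
by rewrite gE eq_sym; move: ne; rewrite -val_eqE /= => /negPf ->.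
Qed.

Definition scal u := u set0.

Lemma thonly_hdeg1E u : thonly u -> hdeg 1 u ->
  u = \sum_a scal (gder (th_idx a) u) *: th R a.
Proof.
move=> tu hu; apply: gder_ext => [s|]; last first.
  rewrite grass_sum big1 => [|a _]; last by rewrite !gE eq_sym -cards_eq0 cards1 mulr0.
  by apply/eqP; apply: contraT => /hu; rewrite cards0.
rewrite linear_sum; case: (odd_idxP s) => -[b ->].
  by rewrite tu big1 // => a _; rewrite linearZ_LR /= thonly_th scaler0.
rewrite (bigD1 b) //= linearZ_LR /= gder_gen eqxx scale1r big1 ?addr0.
  exact/hdeg0E/hdeg_gder.
move=> a ne; rewrite linearZ_LR /= gder_gen eq_th_th eq_sym (negPf ne).
by rewrite scale0r scaler0.
Qed.

Definition bihom k l u := forall S, u S != 0 ->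
  #|[set a | th_idx a \in S]| = k /\ #|[set a | xi_idx a \in S]| = l.

Lemma bihom_hdeg k l u : bihom k l u -> hdeg (k + l) u.
Proof.
move=> bu S uS; have [<- <-] := bu _ uS.
set A := [set a | _]; set B := [set a | _].
rewrite -(card_imset A (@rshift_inj r r)) -(card_imset B (@lshift_inj r r)).
set A' := imset _ _; set B' := imset _ _.
have inA b : (th_idx b \in A') = (th_idx b \in S).
  by rewrite /A' mem_imset ?inE //; apply: rshift_inj.
have inB b : (xi_idx b \in B') = (xi_idx b \in S).
  by rewrite /B' mem_imset ?inE //; apply: lshift_inj.
have ninA b : (xi_idx b \in A') = false.
  by apply/negP => /imsetP[c _ /eqP]; rewrite neq_xi_th.
have ninB b : (th_idx b \in B') = false.
  by apply/negP => /imsetP[c _ /eqP]; rewrite eq_sym neq_xi_th.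
have -> : S = A' :|: B'.
  apply/setP => s; rewrite inE; case: (odd_idxP s) => -[a ->].
    by rewrite ninA inB.
  by rewrite ninB orbF inA.
rewrite -cardsUI [X in (_ = _ + X)%N](_ : _ = 0%N) ?addn0 //.
apply: eq_card0 => s; rewrite !inE; case: (odd_idxP s) => -[a ->].
  by rewrite ninA.
by rewrite ninB andbF.
Qed.

Lemma bihom0 k l : bihom k l 0.
Proof. by move=> S; rewrite gE eqxx. Qed.

Lemma bihomP k l a u v : bihom k l u -> bihom k l v -> bihom k l (a *: u + v).
Proof.
move=> hu hv S; rewrite !gE; case: (eqVneq (u S) 0) => [->|/hu //].
by rewrite mulr0 add0r => /hv.
Qed.

Lemma bihom_sum k l I (rI : seq I) (P : pred I) (a : I -> R) (F : I -> grass R r) :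
  (forall i, P i -> bihom k l (F i)) ->
  bihom k l (\sum_(i <- rI | P i) a i *: F i).
Proof.
move=> h; elim/big_rec: _ => [|i u Pi bu]; first exact: bihom0.
by apply: bihomP => //; apply: h.
Qed.

Lemma bihom_one : bihom 0 0 (mon R set0).
Proof.
move=> S; rewrite gE; case: (eqVneq S set0) => [-> _|]; last by rewrite eqxx.
by split; apply: eq_card0 => a; rewrite !inE.
Qed.

Lemma wedge_gen_supp s u S : wedge (mon R [set s]) u S != 0 ->
  s \in S /\ u (S :\ s) != 0.
Proof.
have [sS|sS] := boolP (s \in S).
  rewrite gE (bigD1 [set s]) ?sub1set //= big1 ?addr0.
    by rewrite !mulf_eq0 !negb_or => /and3P[].
  by move=> T /andP[_ /negPf ne]; rewrite gE ne mul0r mulr0.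
rewrite gE big1 ?eqxx // => T TS; rewrite gE; case: eqP => [e|_].
  by rewrite e sub1set (negPf sS) in TS.
by rewrite mul0r mulr0.
Qed.

Lemma bihom_th k l a u : bihom k l u -> bihom k.+1 l (wedge (th R a) u).
Proof.
move=> bu S /wedge_gen_supp[aS /bu[<- <-]]; split.
  rewrite (cardsD1 a) inE aS add1n; congr _.+1; apply: eq_card => b.
  by rewrite !inE eq_th_th.
by apply: eq_card => b; rewrite !inE neq_xi_th.
Qed.

Lemma bihom_xi k l a u : bihom k l u -> bihom k l.+1 (wedge (xi R a) u).
Proof.
move=> bu S /wedge_gen_supp[aS /bu[<- <-]]; split; last first.
  rewrite (cardsD1 a) inE aS add1n; congr _.+1; apply: eq_card => b.
  by rewrite !inE eq_xi_xi.
by apply: eq_card => b; rewrite !inE eq_sym neq_xi_th.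
Qed.

Lemma bihom_gder_xi k l a u : bihom k l u -> bihom k l.-1 (gder (xi_idx a) u).
Proof.
move=> bu S; rewrite gE; case: ifP => aS; first by rewrite eqxx.
rewrite mulf_eq0 negb_or => /andP[_ /bu[<- <-]]; split.
  by apply: eq_card => b; rewrite !inE eq_sym neq_xi_th.
rewrite [X in _ = X.-1](cardsD1 a) !inE eqxx add1n /=; apply: eq_card => b.
by rewrite !inE eq_xi_xi; case: eqP => // ->.
Qed.

Lemma bihom_gder_th k l a u : bihom k l u -> bihom k.-1 l (gder (th_idx a) u).
Proof.
move=> bu S; rewrite gE; case: ifP => aS; first by rewrite eqxx.
rewrite mulf_eq0 negb_or => /andP[_ /bu[<- <-]]; split; last first.
  by apply: eq_card => b; rewrite !inE neq_xi_th.
rewrite [X in _ = X.-1](cardsD1 a) !inE eqxx add1n /=; apply: eq_card => b.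
by rewrite !inE eq_th_th; case: eqP => // ->.
Qed.

Lemma bihom_thonly k u : bihom k 0 u -> thonly u.
Proof.
move=> bu a; apply/ffunP => S; rewrite !gE; case: ifP => // aS.
apply/eqP; rewrite mulf_eq0; apply/orP; right; apply: contraT => /bu[_].
by move/eqP; rewrite cards_eq0 => /eqP/setP/(_ a); rewrite !inE eqxx.
Qed.

Lemma bihom_xionly l a u : bihom 0 l u -> gder (th_idx a) u = 0.
Proof.
move=> bu; apply/ffunP => S; rewrite !gE; case: ifP => // aS.
apply/eqP; rewrite mulf_eq0; apply/orP; right; apply: contraT => /bu[].
by move/eqP; rewrite cards_eq0 => /eqP/setP/(_ a); rewrite !inE eqxx.
Qed.

Lemma bihom01E u : bihom 0 1 u ->
  u = \sum_a scal (gder (xi_idx a) u) *: xi R a.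
Proof.
move=> bu; have hu := bihom_hdeg bu; apply: gder_ext => [s|]; last first.
  rewrite grass_sum big1 => [|a _]; last by rewrite !gE eq_sym -cards_eq0 cards1 mulr0.
  by apply/eqP; apply: contraT => /hu; rewrite cards0.
rewrite linear_sum; case: (odd_idxP s) => -[b ->]; last first.
  rewrite (bihom_xionly _ bu) big1 // => a _.
  by rewrite linearZ_LR /= gder_gen eq_sym neq_xi_th scale0r scaler0.
rewrite (bigD1 b) //= linearZ_LR /= gder_gen eqxx scale1r big1 ?addr0.
  exact/hdeg0E/hdeg_gder.
move=> a ne; rewrite linearZ_LR /= gder_gen eq_xi_xi eq_sym (negPf ne).
by rewrite scale0r scaler0.
Qed.

End GrassmannGrading.

(** * The action of N and the bracket l2 on first jets *)

Section PointwiseAction.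
Variables (R : realType) (r : nat).
Implicit Types (u v w : grass R r) (B C : 'M[R]_r).

(** The action of N at a point, where N has the matrix B; locked, since unfolding
    the double sum hides that it is a derivation. *)
Definition nact B u : grass R r := locked
  (\sum_(a < r) \sum_(b < r) B a b *: wedge (th R a) (gder (th_idx b) u)).

Lemma nactE B u : nact B u =
  \sum_(a < r) \sum_(b < r) B a b *: wedge (th R a) (gder (th_idx b) u).
Proof. by rewrite /nact -lock. Qed.

Lemma nact_is_linear B : linear (nact B).
Proof.
move=> k u v; rewrite !nactE scaler_sumr -big_split; apply: eq_bigr => a _ /=.
rewrite scaler_sumr -big_split; apply: eq_bigr => b _ /=.
by rewrite gder_is_linear wedgeDr wedgeZr scalerDr !scalerA mulrC.
Qed.
HB.instance Definition _ B :=
  GRing.isLinear.Build R (grass R r) (grass R r) _ (nact B) (nact_is_linear B).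

Lemma nactD B u v : nact B (u + v) = nact B u + nact B v.
Proof. exact: linearD. Qed.
Lemma nactZ B k u : nact B (k *: u) = k *: nact B u.
Proof. exact: linearZ_LR. Qed.
Lemma nact_sum B I (e : seq I) (P : pred I) (F : I -> grass R r) :
  nact B (\sum_(i <- e | P i) F i) = \sum_(i <- e | P i) nact B (F i).
Proof. exact: linear_sum. Qed.
Lemma ginvD u v : ginv (u + v) = ginv u + ginv v.
Proof. exact: linearD. Qed.

(** An even derivation: th R a moves past u at the price of the sign that the
    Leibniz rule of [gder] has introduced. *)
Lemma nact_wedge B u v :
  nact B (wedge u v) = wedge (nact B u) v + wedge u (nact B v).
Proof.
rewrite !nactE wedge_suml wedge_sumr -big_split; apply: eq_bigr => a _ /=.
rewrite wedge_suml wedge_sumr -big_split; apply: eq_bigr => b _ /=.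
rewrite wedgeZl wedgeZr -scalerDr gder_wedge wedgeDr; congr (_ *: (_ + _)).
  by rewrite wedgeA.
by rewrite wedgeA wedge_gen_ginv -wedgeA.
Qed.

Lemma nact_ginv B u : nact B (ginv u) = ginv (nact B u).
Proof.
rewrite !nactE linear_sum; apply: eq_bigr => a _; rewrite linear_sum.
apply: eq_bigr => b _; rewrite linearZ_LR /= gder_ginv wedgeNr ginv_wedge ginv_gen.
by rewrite wedgeNl.
Qed.

Lemma gder_xi_nact B a u : gder (xi_idx a) (nact B u) = nact B (gder (xi_idx a) u).
Proof.
rewrite !nactE linear_sum; apply: eq_bigr => c _; rewrite linear_sum.
apply: eq_bigr => b _; rewrite linearZ_LR /= gder_wedge gder_gen neq_xi_th scale0r.
by rewrite wedge0l add0r ginv_gen gder_gder wedgeNl wedgeNr opprK.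
Qed.

Lemma thonly_nact B u : thonly u -> thonly (nact B u).
Proof. by move=> tu a; rewrite gder_xi_nact tu linear0. Qed.

Lemma hdeg_nact p B u : hdeg p u -> hdeg p (nact B u).
Proof.
rewrite nactE; case: p => [|p] hu; apply: hdeg_sum => a _; apply: hdeg_sum => b _.
  by rewrite gder_hdeg0 // wedge0r scaler0; apply: hdeg0.
by apply: hdegZ; rewrite -add1n; apply: hdeg_wedge;
  [apply: hdeg_gen | apply: hdeg_gder].
Qed.

Lemma nact_hdeg0 B u : hdeg 0 u -> nact B u = 0.
Proof.
move=> hu; rewrite nactE big1 // => a _; rewrite big1 // => b _.
by rewrite gder_hdeg0 // wedge0r scaler0.
Qed.

Lemma gproj_nact p B u : gproj p (nact B u) = nact B (gproj p u).
Proof.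
apply: (grass_linear_ext (f := @gproj R r p \o nact B)
  (g := nact B \o @gproj R r p)) => S /=.
rewrite !(gproj_hdeg p (@hdeg_nact _ B _ (@hdeg_mon R r S))).
by rewrite !(gproj_hdeg p (@hdeg_mon R r S)); case: ifP => _ //; rewrite linear0.
Qed.

Lemma nact_th B b : nact B (th R b) = \sum_a B a b *: th R a.
Proof.
rewrite nactE; apply: eq_bigr => a _; rewrite (bigD1 b) //= big1 ?addr0.
  by rewrite gder_gen eqxx scale1r wedge1r.
move=> c ne; rewrite gder_gen eq_th_th (negPf ne) scale0r wedge0r.
by rewrite scaler0.
Qed.

(** The derivations compose like matrices in degree one only; this is where
    N^2 = lambda can be used. *)
Lemma nact_nact1 B C u : thonly u -> hdeg 1 u -> nact B (nact C u) = nact (B *m C) u.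
Proof.
move=> tu hu; rewrite (thonly_hdeg1E tu hu) !linear_sum; apply: eq_bigr => b _.
rewrite !linearZ_LR /= !nact_th linear_sum; congr (_ *: _).
under eq_bigr => a _ do rewrite linearZ_LR /= nact_th scaler_sumr.
rewrite exchange_big; apply: eq_bigr => a _ /=; rewrite mxE scaler_suml.
by apply: eq_bigr => c _; rewrite scalerA mulrC.
Qed.

Lemma nact_scalar1 k u : thonly u -> hdeg 1 u -> nact k%:M u = k *: u.
Proof.
move=> tu hu; rewrite {2}(thonly_hdeg1E tu hu) scaler_sumr.
rewrite (thonly_hdeg1E tu hu) linear_sum; apply: eq_bigr => b _.
rewrite linearZ_LR /= nact_th (bigD1 b) //= mxE eqxx big1 ?addr0 /=.
  rewrite -(thonly_hdeg1E tu hu) !scalerA mulrC; congr (_ *: _).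
by move=> a ne; rewrite mxE (negPf ne) scale0r.
Qed.

(** Contraction with the one-form of coefficients x. *)
Definition iota (x : 'rV[R]_r) u : grass R r :=
  locked (\sum_a x 0 a *: gder (th_idx a) u).

Lemma iotaE x u : iota x u = \sum_a x 0 a *: gder (th_idx a) u.
Proof. by rewrite /iota -lock. Qed.

Lemma iota_is_linear x : linear (iota x).
Proof.
move=> k u v; rewrite !iotaE scaler_sumr -big_split; apply: eq_bigr => a _ /=.
by rewrite gder_is_linear scalerDr !scalerA mulrC.
Qed.
HB.instance Definition _ x :=
  GRing.isLinear.Build R (grass R r) (grass R r) _ (iota x) (iota_is_linear x).

Lemma iotaD x u v : iota x (u + v) = iota x u + iota x v.
Proof. exact: linearD. Qed.
Lemma iotaZ x k u : iota x (k *: u) = k *: iota x u.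
Proof. exact: linearZ_LR. Qed.
Lemma iota_sum x I (e : seq I) (P : pred I) (F : I -> grass R r) :
  iota x (\sum_(i <- e | P i) F i) = \sum_(i <- e | P i) iota x (F i).
Proof. exact: linear_sum. Qed.

Lemma iotaDl x y u : iota (x + y) u = iota x u + iota y u.
Proof.
by rewrite !iotaE -big_split; apply: eq_bigr => a _ /=; rewrite mxE scalerDl.
Qed.

Lemma iotaZl k x u : iota (k *: x) u = k *: iota x u.
Proof.
by rewrite !iotaE scaler_sumr; apply: eq_bigr => a _ /=; rewrite mxE scalerA.
Qed.

Lemma iota0l u : iota 0 u = 0.
Proof. by rewrite -[0](scale0r (0 : 'rV_r)) iotaZl scale0r. Qed.

Lemma iota_delta a u : iota (delta_mx 0 a) u = gder (th_idx a) u.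
Proof.
rewrite iotaE (bigD1 a) //= mxE !eqxx scale1r big1 ?addr0 // => b ne.
by rewrite mxE (negPf ne) scale0r.
Qed.

Lemma iota_wedge x u v : iota x (wedge u v) = wedge (iota x u) v + wedge (ginv u) (iota x v).
Proof.
rewrite !iotaE wedge_suml wedge_sumr -big_split; apply: eq_bigr => a _ /=.
by rewrite gder_wedge scalerDr wedgeZl wedgeZr.
Qed.

Lemma iota_ginv x u : iota x (ginv u) = - ginv (iota x u).
Proof.
rewrite !iotaE linear_sum -sumrN; apply: eq_bigr => a _ /=.
by rewrite gder_ginv linearZ_LR scalerN.
Qed.

Lemma iota_nact B x u : iota x (nact B u) = iota (x *m B) u + nact B (iota x u).
Proof.
rewrite !nactE exchange_big /= linear_sum.
transitivity (\sum_b ((x *m B) 0 b *: gder (th_idx b) u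
   + \sum_a B a b *: wedge (th R a) (gder (th_idx b) (iota x u)))).
  apply: eq_bigr => b _; rewrite linear_sum mxE scaler_suml -big_split /=.
  apply: eq_bigr => a _; rewrite linearZ_LR /= iota_wedge ginv_gen wedgeNl.
  rewrite scalerDr; congr (_ + _).
    rewrite iotaE (bigD1 a) //= gder_gen eqxx scale1r big1 ?addr0.
      by rewrite wedgeZl wedge1l scalerA mulrC.
    by move=> c ne; rewrite gder_gen eq_th_th (negPf ne) scale0r scaler0.
  rewrite -wedgeNr; congr (_ *: wedge _ _); rewrite !iotaE !linear_sum.
  by apply: eq_bigr => c _; rewrite !linearZ_LR /= gder_gder opprK.
by rewrite big_split /= -iotaE; congr (_ + _); rewrite exchange_big.
Qed.

Lemma hdeg_iota p x u : hdeg p.+1 u -> hdeg p (iota x u).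
Proof.
by move=> hu; rewrite iotaE; apply: hdeg_sum => a _; apply: hdegZ; apply: hdeg_gder.
Qed.

Lemma thonly_iota x u : thonly u -> thonly (iota x u).
Proof.
by move=> tu; rewrite iotaE; apply: thonly_sum => a _; apply: thonlyZ; apply: thonly_gder.
Qed.

End PointwiseAction.

Section Jets.
Variables (R : realType) (n r : nat).
Implicit Types (u v w : grass R r) (du dv : 'I_n -> grass R r)
  (rho : 'I_n -> 'rV[R]_r) (s : 'I_r -> 'I_r -> 'I_r -> R)
  (B : 'M[R]_r) (dB : 'I_n -> 'M[R]_r).

Definition tensor_term (a b d : 'I_r) u v : grass R r :=
  wedge (th R d) (wedge (ginv (gder (th_idx a) u)) (gder (th_idx b) v)).

Lemma tensor_termE a b d u v : tensor_term a b d u v =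
  wedge (th R d) (wedge (ginv (iota (delta_mx 0 a) u)) (iota (delta_mx 0 b) v)).
Proof. by rewrite !iota_delta. Qed.

(** The Schouten bracket of a Lie algebroid with anchor rho and structure
    functions s, as an operation on first jets: u, v are the values at a point,
    du, dv the derivatives along the coordinates. *)
Definition jbracket rho s u du v dv : grass R r :=
  \sum_c (wedge (iota (rho c) u) (dv c) + wedge (ginv (du c)) (iota (rho c) v))
  + \sum_a \sum_b \sum_d s a b d *: tensor_term a b d u v.

(** The derivatives of N P, from the jets (B, dB) of N and (u, du) of P. *)
Definition jact B dB u du : 'I_n -> grass R r :=
  fun c => nact B (du c) + nact (dB c) u.

(** The tensorial operations.  The coefficients stay existential: it only matters
    that they do not depend on the arguments. *)
Definition tensorial (E : grass R r -> grass R r -> grass R r) :=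
  exists s, forall u v, E u v = \sum_a \sum_b \sum_d s a b d *: tensor_term a b d u v.

Lemma tensorial_tensor_term a b d : tensorial (tensor_term a b d).
Proof.
exists (fun x y z => [&& x == a, y == b & z == d]%:R) => u v.
rewrite (bigD1 a) //= (bigD1 b) //= (bigD1 d) //= !eqxx scale1r.
rewrite !big1 ?addr0 // => i ne.
- by rewrite big1 // => j _; rewrite big1 // => k _; rewrite (negPf ne) scale0r.
- by rewrite big1 // => k _; rewrite (negPf ne) andbF scale0r.
by rewrite (negPf ne) !andbF scale0r.
Qed.

Lemma tensorialP k E F : tensorial E -> tensorial F -> tensorial (fun u v => k *: E u v + F u v).
Proof.
move=> [s eE] [t eF]; exists (fun a b d => k * s a b d + t a b d) => u v.
rewrite eE eF scaler_sumr -big_split; apply: eq_bigr => a _ /=.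
rewrite scaler_sumr -big_split; apply: eq_bigr => b _ /=.
rewrite scaler_sumr -big_split; apply: eq_bigr => d _ /=.
by rewrite scalerDl scalerA.
Qed.

Lemma tform0 : tensorial (fun _ _ => 0).
Proof.
exists (fun _ _ _ => 0) => u v; rewrite big1 // => a _; rewrite big1 // => b _.
by rewrite big1 // => d _; rewrite scale0r.
Qed.

Lemma tensorial_ext E F : (forall u v, E u v = F u v) -> tensorial F -> tensorial E.
Proof. by move=> e [s eF]; exists s => u v; rewrite e. Qed.

Lemma tensorialD E F : tensorial E -> tensorial F -> tensorial (fun u v => E u v + F u v).
Proof.
move=> hE hF; apply: tensorial_ext (tensorialP 1 hE hF) => u v.
by rewrite scale1r.
Qed.

Lemma tensorialZ k E : tensorial E -> tensorial (fun u v => k *: E u v).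
Proof.
by move=> hE; apply: tensorial_ext (tensorialP k hE tform0) => u v; rewrite addr0.
Qed.

Lemma tensorial_sum (I : Type) (e : seq I) (E : I -> grass R r -> grass R r -> grass R r) :
  (forall i, tensorial (E i)) -> tensorial (fun u v => \sum_(i <- e) E i u v).
Proof.
move=> hE; elim: e => [|i e IH].
  by apply: tensorial_ext tform0 => u v; rewrite big_nil.
by apply: tensorial_ext (tensorialD (hE i) IH) => u v; rewrite big_cons.
Qed.

Definition commutator B (E : grass R r -> grass R r -> grass R r) u v :=
  E (nact B u) v + E u (nact B v) - nact B (E u v).

(** A derivation changes the three indices one at a time. *)
Lemma tensor_term_commutator B a b d : tensorial (commutator B (tensor_term a b d)).
Proof.
apply: (@tensorial_ext _ (fun u v => \sum_e B a e *: tensor_term e b d u v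
  + (\sum_e B b e *: tensor_term a e d u v - \sum_e B e d *: tensor_term a b e u v))).
  move=> u v; rewrite /commutator !tensor_termE !iota_nact !nact_wedge.
  rewrite linearD !wedgeDr !wedgeDl !wedgeDr nact_ginv nact_th.
  set X := wedge _ (wedge (ginv (iota (_ *m _) u)) _).
  set Y := wedge _ (wedge _ (iota (_ *m _) v)).
  have -> : X = \sum_e B a e *: tensor_term e b d u v.
    rewrite /X iotaE linear_sum wedge_suml wedge_sumr; apply: eq_bigr => e _.
    rewrite linearZ_LR wedgeZl wedgeZr /tensor_term /= iota_delta; congr (_ *: _).
    by rewrite -rowE mxE.
  have -> : Y = \sum_e B b e *: tensor_term a e d u v.
    rewrite /Y (iotaE (_ *m _)) !wedge_sumr; apply: eq_bigr => e _.
    rewrite !wedgeZr /tensor_term /= iota_delta; congr (_ *: _).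
    by rewrite -rowE mxE.
  rewrite wedge_suml.
  have -> : \sum_i wedge (B i d *: th R i)
     (wedge (ginv (iota (delta_mx 0 a) u)) (iota (delta_mx 0 b) v)) =
     \sum_e B e d *: tensor_term a b e u v.
    by apply: eq_bigr => e _; rewrite wedgeZl /tensor_term !iota_delta.
  gring.
apply: tensorialD; first by apply: tensorial_sum => e; apply/tensorialZ/tensorial_tensor_term.
apply: tensorialD; first by apply: tensorial_sum => e; apply/tensorialZ/tensorial_tensor_term.
apply: (@tensorial_ext _ (fun u v => -1 *: \sum_e B e d *: tensor_term a b e u v)).
  by move=> u v; rewrite scaleN1r.
by apply/tensorialZ/tensorial_sum => e; apply/tensorialZ/tensorial_tensor_term.
Qed.

(** Here a derivative of N has absorbed the one that stood on an argument. *)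
Lemma nact_tensorial B x : tensorial (fun u v => wedge (iota x u) (nact B v)).
Proof.
apply: (@tensorial_ext _ (fun u v => \sum_a \sum_d \sum_b (x 0 a * B d b) *: tensor_term a b d u v)).
  move=> u v; rewrite iotaE wedge_suml; apply: eq_bigr => a _.
  rewrite nactE wedge_sumr; apply: eq_bigr => d _; rewrite wedge_sumr.
  apply: eq_bigr => b _; rewrite wedgeZl wedgeZr scalerA; congr (_ *: _).
  by rewrite /tensor_term !wedgeA wedge_gen_ginv.
by do 3!apply: tensorial_sum => ?; apply/tensorialZ/tensorial_tensor_term.
Qed.

Lemma nact_tensorial' B x : tensorial (fun u v => wedge (ginv (nact B u)) (iota x v)).
Proof.
apply: (@tensorial_ext _ (fun u v => \sum_d \sum_a \sum_b (- (x 0 b * B d a)) *: tensor_term a b d u v)).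
  move=> u v; rewrite nactE linear_sum wedge_suml; apply: eq_bigr => d _.
  rewrite linear_sum wedge_suml; apply: eq_bigr => a _.
  rewrite iotaE wedge_sumr; apply: eq_bigr => b _.
  rewrite wedgeZr [X in wedge X _]linearZ_LR /= wedgeZl scalerA scaleNr -scalerN; congr (_ *: _).
  by rewrite /tensor_term ginv_wedge ginv_gen !wedgeNl wedgeA.
by do 3!apply: tensorial_sum => ?; apply/tensorialZ/tensorial_tensor_term.
Qed.

(** The terms where N meets a differentiated argument recombine into the same
    operation with anchor rho o N; all others are tensorial. *)
Lemma jbracket_commutator B dB rho s : exists s', forall u du v dv,
  jbracket rho s (nact B u) (jact B dB u du) v dv +
  jbracket rho s u du (nact B v) (jact B dB v dv) - nact B (jbracket rho s u du v dv)
  = jbracket (fun c => rho c *m B) s' u du v dv.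
Proof.
have h1 c := tensorialD (nact_tensorial (dB c) (rho c)) (nact_tensorial' (dB c) (rho c)).
have h2 : tensorial (fun u v => \sum_a \sum_b \sum_d
    s a b d *: commutator B (tensor_term a b d) u v).
  by do 3!apply: tensorial_sum => ?; apply/tensorialZ/tensor_term_commutator.
have [s' es'] := tensorialD (tensorial_sum (index_enum 'I_n) h1) h2.
exists s' => u du v dv; rewrite /jbracket -es'.
have -> : \sum_a \sum_b \sum_d s a b d *: commutator B (tensor_term a b d) u v
    = \sum_a \sum_b \sum_d s a b d *: tensor_term a b d (nact B u) v
    + \sum_a \sum_b \sum_d s a b d *: tensor_term a b d u (nact B v)
    - nact B (\sum_a \sum_b \sum_d s a b d *: tensor_term a b d u v).
  rewrite linear_sum -sumrN -!big_split; apply: eq_bigr => a _ /=.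
  rewrite linear_sum -sumrN -!big_split; apply: eq_bigr => b _ /=.
  rewrite linear_sum -sumrN -!big_split; apply: eq_bigr => d _ /=.
  by rewrite linearZ_LR /= -scalerN -!scalerDr.
set T1 := \sum_a \sum_b \sum_d s a b d *: tensor_term a b d (nact B u) v.
set T2 := \sum_a \sum_b \sum_d s a b d *: tensor_term a b d u (nact B v).
set T3 := \sum_a \sum_b \sum_d s a b d *: tensor_term a b d u v.
rewrite nactD.
set A1 := \sum_c _; set A2 := \sum_c _; set A3 := \sum_c _; set A4 := \sum_c _.
set A5 := \sum_i _.
have : A1 + A2 = nact B A3 + A4 + A5.
  rewrite nact_sum -!big_split; apply: eq_bigr => c _ /=.
  rewrite nactD !nact_wedge nact_ginv !iota_nact /jact ginvD !wedgeDl !wedgeDr.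
  gring.
move=> e; have -> : A1 = nact B A3 + A4 + A5 - A2 by rewrite -e addrK.
gring.
Qed.

Lemma jbracket_linear_r rho s u du k v dv w dw :
  jbracket rho s u du (k *: v + w) (fun c => k *: dv c + dw c) =
  k *: jbracket rho s u du v dv + jbracket rho s u du w dw.
Proof.
rewrite /jbracket scalerDr addrACA; congr (_ + _); rewrite scaler_sumr -big_split /=.
  apply: eq_bigr => c _; rewrite iotaD iotaZ !wedgeDr !wedgeZr; gring.
apply: eq_bigr => a _ /=; rewrite scaler_sumr -big_split; apply: eq_bigr => b _ /=.
rewrite scaler_sumr -big_split; apply: eq_bigr => d _ /=.
by rewrite /tensor_term gder_is_linear !wedgeDr !wedgeZr scalerDr !scalerA mulrC.
Qed.

Lemma jbracket_linear_l rho s u du k v dv w dw :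
  jbracket rho s (k *: v + w) (fun c => k *: dv c + dw c) u du =
  k *: jbracket rho s v dv u du + jbracket rho s w dw u du.
Proof.
rewrite /jbracket scalerDr addrACA; congr (_ + _); rewrite scaler_sumr -big_split /=.
  apply: eq_bigr => c _; rewrite iotaD iotaZ ginv_is_linear !wedgeDl !wedgeZl; gring.
apply: eq_bigr => a _ /=; rewrite scaler_sumr -big_split; apply: eq_bigr => b _ /=.
rewrite scaler_sumr -big_split; apply: eq_bigr => d _ /=.
rewrite /tensor_term gder_is_linear ginv_is_linear wedgeDl wedgeDr wedgeZl wedgeZr.
by rewrite scalerDr !scalerA mulrC.
Qed.

Lemma thonly_jbracket rho s u du v dv : thonly u -> thonly v ->
  (forall c, thonly (du c)) -> (forall c, thonly (dv c)) ->
  thonly (jbracket rho s u du v dv).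
Proof.
move=> tu tv tdu tdv; rewrite -[jbracket _ _ _ _ _ _]scale1r /jbracket scalerDr.
apply: thonlyP; last first.
  rewrite scale1r; apply: thonly_sum => a _; apply: thonly_sum => b _.
  apply: thonly_sum => d _; apply: thonlyZ; apply: thonly_wedge.
    exact: thonly_th.
  by apply: thonly_wedge; [apply: thonly_ginv|]; apply: thonly_gder.
apply: thonly_sum => c _; rewrite -[wedge (iota _ _) _]scale1r; apply: thonlyP.
  by apply: thonly_wedge => //; apply: thonly_iota.
by apply: thonly_wedge; [apply: thonly_ginv | apply: thonly_iota].
Qed.

Lemma hdeg_ginv p u : hdeg p u -> hdeg p (ginv u).
Proof. by move=> hu; rewrite (ginv_hdeg hu); apply: hdegZ. Qed.

Lemma iota_hdeg0 x u : hdeg 0 u -> iota x u = 0.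
Proof.
by move=> hu; rewrite iotaE big1 // => a _; rewrite gder_hdeg0 // scaler0.
Qed.

Lemma hdeg_jbracket rho s p q u du v dv : hdeg p u -> hdeg q v ->
  (forall c, hdeg p (du c)) -> (forall c, hdeg q (dv c)) ->
  hdeg (p + q).-1 (jbracket rho s u du v dv).
Proof.
move=> hu hv hdu hdv; apply: hdegD.
  apply: hdeg_sum => c _; apply: hdegD.
    case: p hu hdu => [|p] hu hdu.
      by rewrite iota_hdeg0 // wedge0l; apply: hdeg0.
    by rewrite addSn; apply: hdeg_wedge => //; apply: hdeg_iota.
  case: q hv hdv => [|q] hv hdv.
    by rewrite iota_hdeg0 // wedge0r; apply: hdeg0.
  by rewrite addnS; apply: hdeg_wedge; [apply: hdeg_ginv | apply: hdeg_iota].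
apply: hdeg_sum => a _; apply: hdeg_sum => b _; apply: hdeg_sum => d _.
apply: hdegZ; case: p hu hdu => [|p] hu _.
  by rewrite /tensor_term gder_hdeg0 // linear0 wedge0l wedge0r; apply: hdeg0.
case: q hv hdv => [|q] hv _.
  by rewrite /tensor_term [X in wedge _ (wedge _ X)]gder_hdeg0 // !wedge0r; apply: hdeg0.
have -> : (p.+1 + q.+1).-1 = (1 + (p + q))%N by lia.
apply: hdeg_wedge; first exact: hdeg_gen.
by apply: hdeg_wedge; [apply: hdeg_ginv|]; apply: hdeg_gder.
Qed.

Lemma jbracket_hdeg0 rho s u du v dv : hdeg 0 u -> hdeg 0 v -> jbracket rho s u du v dv = 0.
Proof.
move=> hu hv; rewrite /jbracket !big1 ?addr0 // => [a _|c _].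
  rewrite big1 // => b _; rewrite big1 // => d _.
  by rewrite /tensor_term [X in wedge _ (wedge _ X)]gder_hdeg0 // !wedge0r scaler0.
by rewrite !iota_hdeg0 // wedge0l wedge0r addr0.
Qed.

(** The degree p of a multivector and its degree p - 2 in L have the same parity,
    so that the Koszul sign of L is that of the exterior algebra. *)
Lemma jbracketC rho s p q u du v dv : (forall a b d, s b a d = - s a b d) ->
  hdeg p u -> hdeg q v ->
  (forall c, hdeg p (du c)) -> (forall c, hdeg q (dv c)) ->
  jbracket rho s u du v dv = (-1) ^+ (p * q) *: jbracket rho s v dv u du.
Proof.
move=> sN hu hv hdu hdv.
have h1 p' q' u' v' x : hdeg p' u' -> hdeg q' v' ->
    wedge (iota x u') v' = (-1) ^+ (p' * q') *: wedge (ginv v') (iota x u').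
  case: p' => [|p'] hu' hv'.
    by rewrite iota_hdeg0 // wedge0l wedge0r scaler0.
  rewrite (wedgeC (@hdeg_iota R r p' x u' hu') hv') (ginv_hdeg hv') wedgeZl scalerA.
  by congr (_ *: _); rewrite -exprD; apply: sgn_odd; rewrite oddD !oddM /=; case: (odd p'); case: (odd q').
rewrite /jbracket scalerDr; congr (_ + _); rewrite scaler_sumr.
  apply: eq_bigr => c _; rewrite addrC scalerDr; congr (_ + _).
    rewrite (h1 _ _ _ _ _ hv (hdu c)) scalerA (mulnC q p).
    by rewrite -exprMn mulrNN mulr1 expr1n scale1r.
  exact: h1.
rewrite exchange_big /=; apply: eq_bigr => a _; rewrite scaler_sumr.
apply: eq_bigr => b _; rewrite scaler_sumr; apply: eq_bigr => d _.
rewrite sN scalerA mulrC -scalerA scaleNr -scalerN; congr (_ *: _).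
rewrite /tensor_term -wedgeNr -wedgeZr; congr wedge.
case: p hu hdu => [|p] hu _.
  by rewrite (gder_hdeg0 _ hu) linear0 wedge0l wedge0r scaler0 oppr0.
case: q hv hdv => [|q] hv _.
  by rewrite (gder_hdeg0 _ hv) !linear0 wedge0l !linear0.
have hu' : hdeg p (gder (th_idx b) u) by apply: hdeg_gder.
have hv' : hdeg q (gder (th_idx a) v) by apply: hdeg_gder.
rewrite (ginv_hdeg hu') (ginv_hdeg hv') !wedgeZl (wedgeC hu' hv') -scaleN1r !scalerA.
congr (_ *: _); rewrite -exprS -!exprD; apply: sgn_odd.
by rewrite /= !oddD !oddM /=; case: (odd p); case: (odd q).
Qed.

(** The binary part of the bracket of [act N] with a form of binary part E. *)
Definition jcommutator B dB (E : grass R r -> ('I_n -> grass R r) ->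
    grass R r -> ('I_n -> grass R r) -> grass R r) u du v dv :=
  E (nact B u) (jact B dB u du) v dv + E u du (nact B v) (jact B dB v dv)
  - nact B (E u du v dv).

(** Taking the commutator twice replaces the anchor rho by rho o B^2, which is
    lambda times rho: the derivatives cancel. *)
Lemma jbracket_double_commutator B dB rho s (lambda : R) : B *m B = lambda%:M ->
  exists z, forall u du v dv,
    jcommutator B dB (jcommutator B dB (jbracket rho s)) u du v dv
      - lambda *: jbracket rho s u du v dv
    = \sum_a \sum_b \sum_d z a b d *: tensor_term a b d u v.
Proof.
move=> BB; have [s1 e1] := jbracket_commutator B dB rho s.
have [s2 e2] := jbracket_commutator B dB (fun c => rho c *m B) s1.
exists (fun a b d => s2 a b d - lambda * s a b d) => u du v dv.
have e1' x dx y dy : jcommutator B dB (jbracket rho s) x dx y dy =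
    jbracket (fun c => rho c *m B) s1 x dx y dy by exact: e1.
have -> : jcommutator B dB (jcommutator B dB (jbracket rho s)) u du v dv =
    jbracket (fun c => rho c *m B *m B) s2 u du v dv.
  by rewrite -e2 {1}/jcommutator !e1'.
rewrite /jbracket scalerDr opprD.
rewrite addrACA; set X := (X in X + _ = _); have -> : X = 0.
  rewrite /X scaler_sumr -sumrB big1 // => c _.
  rewrite -mulmxA BB mul_mx_scalar !iotaZl wedgeZl wedgeZr -scalerDr.
  by rewrite subrr.
rewrite add0r scaler_sumr -sumrB; apply: eq_bigr => a _.
rewrite scaler_sumr -sumrB; apply: eq_bigr => b _.
rewrite scaler_sumr -sumrB; apply: eq_bigr => d _.
by rewrite scalerBl scalerA.
Qed.

Lemma tensor_term_th a b d a' b' :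
  tensor_term a b d (th R a') (th R b') = (a == a')%:R *: ((b == b')%:R *: th R d).
Proof.
rewrite /tensor_term !gder_gen !eq_th_th [X in wedge _ (wedge X _)]linearZ_LR /=.
rewrite (ginv_hdeg (@hdeg_one R r)).
by rewrite expr0 scale1r wedgeZl !wedgeZr !wedge1r.
Qed.

Lemma tsum_th z a b : \sum_a' \sum_b' \sum_d z a' b' d *: tensor_term a' b' d (th R a) (th R b)
  = \sum_d z a b d *: th R d.
Proof.
rewrite (bigD1 a) //= [X in _ + X]big1 ?addr0; last first.
  move=> a' ne; rewrite big1 // => b' _; rewrite big1 // => d _.
  by rewrite tensor_term_th (negPf ne) scale0r scaler0.
rewrite (bigD1 b) //= [X in _ + X]big1 ?addr0; last first.
  move=> b' ne; rewrite big1 // => d _.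
  by rewrite tensor_term_th (negPf ne) scale0r !scaler0.
by apply: eq_bigr => d _; rewrite tensor_term_th !eqxx !scale1r.
Qed.

Lemma th_free (z : 'I_r -> R) : \sum_d z d *: th R d = 0 -> forall d, z d = 0.
Proof.
move=> /(congr1 (fun u => scal (gder (th_idx _) u))) e d.
have := e d; rewrite linear_sum (bigD1 d) //= linearZ_LR /= gder_gen eqxx scale1r.
rewrite big1 ?addr0 => [|a ne]; last first.
  by rewrite linearZ_LR /= gder_gen eq_th_th eq_sym (negPf ne) scale0r scaler0.
by rewrite linear0 /scal grassZ !ffunE eqxx mulr1.
Qed.

End Jets.

(** * The bracket with a bivector and the Koszul bracket *)

Section BivectorJets.
Variables (R : realType) (n r : nat).
Variables (rho : 'I_n -> 'rV[R]_r) (s : 'I_r -> 'I_r -> 'I_r -> R).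
Hypothesis s_anti : forall a b d, s b a d = - s a b d.
Implicit Types (u v w P : grass R r) (du dv dP : 'I_n -> grass R r)
  (al be x y : 'rV[R]_r) (dal dbe : 'I_n -> 'rV[R]_r) (b : 'I_r).

Definition bil u al be : R := scal (iota be (iota al u)).

Lemma scalD u v : scal (u + v) = scal u + scal v.
Proof. by rewrite /scal grassD. Qed.
Lemma scalZ k u : scal (k *: u) = k * scal u.
Proof. by rewrite /scal grassZ. Qed.
Lemma scalN u : scal (- u) = - scal u.
Proof. by rewrite /scal grassN. Qed.
Lemma scal_sum I (e : seq I) (Q : pred I) (F : I -> grass R r) :
  scal (\sum_(i <- e | Q i) F i) = \sum_(i <- e | Q i) scal (F i).
Proof. by rewrite /scal grass_sum. Qed.

Lemma bilD u v al be : bil (u + v) al be = bil u al be + bil v al be.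
Proof. by rewrite /bil !iotaD scalD. Qed.
Lemma bilZ k u al be : bil (k *: u) al be = k * bil u al be.
Proof. by rewrite /bil !iotaZ scalZ. Qed.
Lemma bilN u al be : bil (- u) al be = - bil u al be.
Proof. by rewrite -scaleN1r bilZ mulN1r. Qed.
Lemma bil_sum I (e : seq I) (Q : pred I) (F : I -> grass R r) al be :
  bil (\sum_(i <- e | Q i) F i) al be = \sum_(i <- e | Q i) bil (F i) al be.
Proof. by rewrite /bil !iota_sum scal_sum. Qed.

Lemma iota_iota x y u : iota x (iota y u) = - iota y (iota x u).
Proof.
rewrite (iotaE y u) iota_sum (iotaE y) -sumrN; apply: eq_bigr => a _.
rewrite iotaZ -scalerN; congr (_ *: _); rewrite !iotaE linear_sum -sumrN.
by apply: eq_bigr => c _; rewrite linearZ_LR /= gder_gder scalerN.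
Qed.

Lemma bil_anti u al be : bil u be al = - bil u al be.
Proof. by rewrite /bil iota_iota scalN. Qed.

Lemma iota_th al d : iota al (th R d) = al 0 d *: mon R finset.set0.
Proof.
rewrite iotaE (bigD1 d) //= gder_gen eqxx scale1r big1 ?addr0 // => a ne.
by rewrite gder_gen eq_th_th (negPf ne) scale0r scaler0.
Qed.

Lemma scal1 : scal (mon R (@finset.set0 'I_(r + r))) = 1.
Proof. by rewrite /scal ffunE eqxx. Qed.

Lemma half_double u : 2^-1 *: (u + u) = u.
Proof.
apply/ffunP => S.
by rewrite grassZ grassD -mulr2n -[u S *+ 2]mulr_natl mulrA mulVf ?mul1r.
Qed.

Lemma jl0l v dv : jbracket rho s 0 (fun=> 0) v dv = 0.
Proof.
rewrite /jbracket !big1 ?addr0 // => [a _|c _].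
  rewrite big1 // => b _; rewrite big1 // => d _.
  by rewrite /tensor_term !linear0 wedge0l !linear0.
by rewrite !linear0 !wedge0l addr0.
Qed.

Lemma wedge_nact_th A C v :
  wedge A (nact C v) = \sum_b wedge (wedge A (nact C (th R b))) (gder (th_idx b) v).
Proof.
rewrite nactE exchange_big linear_sum; apply: eq_bigr => b _ /=.
rewrite nact_th !wedge_sumr wedge_suml; apply: eq_bigr => a _.
by rewrite !wedgeZr wedgeZl wedgeA.
Qed.

(** The coefficient of the derivative of v with respect to th R b in the bracket
    of a bivector P with v. *)
Definition vec_coef P dP b : grass R r := locked
  (\sum_c rho c 0 b *: dP c
   - \sum_a \sum_d s a b d *: wedge (th R d) (gder (th_idx a) P)).

Lemma vec_coefE P dP b : vec_coef P dP b = \sum_c rho c 0 b *: dP c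
   - \sum_a \sum_d s a b d *: wedge (th R d) (gder (th_idx a) P).
Proof. by rewrite /vec_coef -lock. Qed.

Lemma jbracket_vec P dP v dv : hdeg 2 P -> (forall c, hdeg 2 (dP c)) ->
  jbracket rho s P dP v dv = \sum_c wedge (iota (rho c) P) (dv c)
    + \sum_b wedge (vec_coef P dP b) (gder (th_idx b) v).
Proof.
move=> hP hdP; rewrite /jbracket big_split /= -addrA; congr (_ + _).
transitivity (\sum_b \sum_c wedge (rho c 0 b *: dP c) (gder (th_idx b) v)
   + \sum_b \sum_a \sum_d s a b d *: tensor_term a b d P v).
  rewrite [in RHS]exchange_big [X in _ + X = _]exchange_big /=; congr (_ + _).
  apply: eq_bigr => c _; rewrite (ginv_hdeg (hdP c)) sqrrN expr1n scale1r.
  rewrite iotaE wedge_sumr; apply: eq_bigr => b _.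
  by rewrite wedgeZl wedgeZr.
rewrite -big_split; apply: eq_bigr => b _ /=.
rewrite vec_coefE wedgeDl wedge_suml wedgeNl wedge_suml -sumrN; congr (_ + _).
apply: eq_bigr => a _; rewrite wedge_suml -sumrN; apply: eq_bigr => d _.
have hg : hdeg 1 (gder (th_idx a) P) by apply: hdeg_gder.
rewrite wedgeZl /tensor_term (ginv_hdeg hg) expr1 scaleN1r wedgeNl wedgeNr scalerN.
by rewrite wedgeA.
Qed.

Lemma hdeg_vec_coef P dP b : hdeg 2 P -> (forall c, hdeg 2 (dP c)) -> hdeg 2 (vec_coef P dP b).
Proof.
move=> hP hdP; rewrite vec_coefE; apply: hdegD.
  by apply: hdeg_sum => c _; apply: hdegZ.
rewrite -scaleN1r; apply: hdegZ; apply: hdeg_sum => a _; apply: hdeg_sum => d _.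
apply: hdegZ; apply: (@hdeg_wedge _ _ 1 1); first exact: hdeg_gen.
exact: hdeg_gder.
Qed.

Lemma thonly_vec_coef P dP b : thonly P -> (forall c, thonly (dP c)) -> thonly (vec_coef P dP b).
Proof.
move=> tP tdP; rewrite vec_coefE addrC -scaleN1r; apply: thonlyP.
  apply: thonly_sum => a _; apply: thonly_sum => d _; apply: thonlyZ.
  by apply: thonly_wedge; [apply: thonly_th | apply: thonly_gder].
by apply: thonly_sum => c _; apply: thonlyZ.
Qed.

Section Action.
Variables (B : 'M[R]_r) (dB : 'I_n -> 'M[R]_r).
Variables (P : grass R r) (dP : 'I_n -> grass R r).
Hypothesis hP : hdeg 2 P.
Hypothesis hdP : forall c, hdeg 2 (dP c).
Hypothesis P_comp : forall x, iota (x *m B) P = nact B (iota x P).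

(* The bivector pi_N: the derivation acts on both factors of P, and the two
   results agree by compatibility, whence the factor one half. *)
Let P' := 2^-1 *: nact B P.
Let dP' c := 2^-1 *: jact B dB P dP c.

(** The coefficient of the derivative of v with respect to th R b in
    l2(N P, v) + 2 l2(P, N v) - 2 N l2(P, v), up to the factor 2; it turns out to
    be a component of the Magri-Morosi concomitant. *)
Definition mm_coef b : grass R r :=
  vec_coef P' dP' b + \sum_e B e b *: vec_coef P dP e - nact B (vec_coef P dP b)
  + \sum_c wedge (iota (rho c) P) (nact (dB c) (th R b)).

Lemma hdeg_jact p w dw c : hdeg p w -> (forall c, hdeg p (dw c)) ->
  hdeg p (jact B dB w dw c).
Proof. by move=> hw hdw; apply: hdegD; apply: hdeg_nact. Qed.

Let hP' : hdeg 2 P'. Proof. exact/hdegZ/hdeg_nact. Qed.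
Let hdP' c : hdeg 2 (dP' c). Proof. exact/hdegZ/hdeg_jact. Qed.

Lemma iota_half x : iota x P' = iota (x *m B) P.
Proof.
by rewrite /P' iotaZ iota_nact -P_comp half_double.
Qed.

(** The derivatives of v come with the contractions of P by rho o N in the first
    two terms and with N of the contraction of P by rho in the third: they cancel
    because P and N are compatible. *)
Lemma jbracket_mm_coef v dv :
  jbracket rho s (nact B P) (jact B dB P dP) v dv
  + 2 *: (jbracket rho s P dP (nact B v) (jact B dB v dv))
  - 2 *: nact B (jbracket rho s P dP v dv)
  = 2 *: \sum_b wedge (mm_coef b) (gder (th_idx b) v).
Proof.
have n2 : (2 : R) != 0 by rewrite pnatr_eq0.
have -> : jbracket rho s (nact B P) (jact B dB P dP) v dv = 2 *: jbracket rho s P' dP' v dv.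
  have := jbracket_linear_l rho s v dv 2 P' dP' 0 (fun=> 0).
  have -> : 2 *: P' + 0 = nact B P by rewrite addr0 scalerA divff // scale1r.
  have -> : (fun c => 2 *: dP' c + 0) = jact B dB P dP.
    by apply/funext => c; rewrite addr0 scalerA divff // scale1r.
  move=> ->; rewrite [X in _ + X = _](_ : _ = 0) ?addr0 //.
  by apply: jl0l.
rewrite -scalerDr -scalerBr; congr (_ *: _).
rewrite !jbracket_vec // nactD !nact_sum.
set a1 := \sum_c _; set b1 := \sum_b _; set a2 := \sum_c _; set b2 := \sum_b _.
set a3 := \sum_c _; set b3 := \sum_b _.
have -> : b2 = \sum_b (wedge (\sum_e B e b *: vec_coef P dP e) (gder (th_idx b) v)
                + wedge (vec_coef P dP b) (nact B (gder (th_idx b) v))).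
  rewrite big_split /=.
  have -> : \sum_(b < r) wedge (\sum_e B e b *: vec_coef P dP e) (gder (th_idx b) v)
      = \sum_b wedge (vec_coef P dP b) (iota (delta_mx 0 b *m B) v).
    under eq_bigr => b _ do rewrite wedge_suml.
    rewrite exchange_big; apply: eq_bigr => e _ /=.
    rewrite iotaE wedge_sumr; apply: eq_bigr => b _.
    by rewrite wedgeZl wedgeZr -rowE mxE.
  rewrite -big_split; apply: eq_bigr => b _ /=.
  by rewrite -wedgeDr -!iota_delta iota_nact.
have -> : b3 = \sum_b (wedge (nact B (vec_coef P dP b)) (gder (th_idx b) v)
                + wedge (vec_coef P dP b) (nact B (gder (th_idx b) v))).
  by apply: eq_bigr => b _; rewrite nact_wedge.
have -> : a2 = a3 - a1
    + \sum_b wedge (\sum_c wedge (iota (rho c) P) (nact (dB c) (th R b))) (gder (th_idx b) v).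
  under [X in _ + X]eq_bigr => b _ do rewrite wedge_suml.
  rewrite exchange_big -sumrB -big_split; apply: eq_bigr => c _ /=.
  rewrite nact_wedge iota_half P_comp -wedge_nact_th /jact wedgeDr; gring.
rewrite !big_split /=.
under [X in _ = X]eq_bigr => b _ do rewrite /mm_coef 3!wedgeDl wedgeNl.
rewrite !big_split /= sumrN; gring.
Qed.

Lemma hdeg_mm_coef b : hdeg 2 (mm_coef b).
Proof.
apply: hdegD; last first.
  apply: hdeg_sum => c _; apply: (@hdeg_wedge _ _ 1 1).
    exact: hdeg_iota.
  exact/hdeg_nact/hdeg_gen.
apply: hdegD; last first.
  by rewrite -scaleN1r; apply/hdegZ/hdeg_nact; apply: hdeg_vec_coef.
apply: hdegD; first exact: hdeg_vec_coef.
by apply: hdeg_sum => e _; apply: hdegZ; apply: hdeg_vec_coef.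
Qed.

Lemma thonly_mm_coef b : thonly P -> (forall c, thonly (dP c)) -> thonly (mm_coef b).
Proof.
move=> tP tdP.
have tP' : thonly P' by apply/thonlyZ/thonly_nact.
have tdP' c : thonly (dP' c).
  apply: thonlyZ; rewrite /jact -[nact B _]scale1r.
  by apply: thonlyP; apply: thonly_nact.
rewrite /mm_coef addrC -[\sum_c _]scale1r; apply: thonlyP.
  apply: thonly_sum => c _; apply: thonly_wedge; first exact: thonly_iota.
  exact/thonly_nact/thonly_th.
rewrite addrC -scaleN1r; apply: thonlyP; first exact/thonly_nact/thonly_vec_coef.
rewrite addrC -[\sum_e _]scale1r; apply: thonlyP; last exact: thonly_vec_coef.
by apply: thonly_sum => e _; apply: thonlyZ; apply: thonly_vec_coef.
Qed.

End Action.

Lemma bil_eq0 u : thonly u -> hdeg 2 u ->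
  (forall a a', bil u (delta_mx 0 a) (delta_mx 0 a') = 0) -> u = 0.
Proof.
move=> tu hu e; apply: (hdeg_gder_eq0 hu) => t.
case: (odd_idxP t) => -[a ->]; first exact: tu.
apply: (@hdeg_gder_eq0 _ _ 0); first exact: hdeg_gder.
move=> t'; case: (odd_idxP t') => -[a' ->]; first exact: thonly_gder.
have := e a a'; rewrite /bil !iota_delta => e'.
rewrite (@hdeg0E _ _ (gder _ _)); last by do 2!apply: hdeg_gder.
have e'' : gder (th_idx a') (gder (th_idx a) u) finset.set0 = 0 by exact: e'.
by rewrite e'' scale0r.
Qed.

(** The part of the Koszul bracket in which the one-forms are not
    differentiated. *)
Definition koszul_coef P dP al be : 'rV[R]_r := \row_b
  (\sum_c bil (dP c) al be * rho c 0 b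
   + \sum_a \sum_d s b a d * (bil P al (delta_mx 0 a) * be 0 d
                             - bil P be (delta_mx 0 a) * al 0 d)).

(** The link between the two sides of the equivalence: the coefficients of
    l2(P, .) are those of the Koszul bracket of P. *)
Lemma bil_vec_coef P dP b al be : hdeg 2 P ->
  bil (vec_coef P dP b) al be = koszul_coef P dP al be 0 b.
Proof.
move=> hP; rewrite mxE vec_coefE bilD bilN bil_sum; congr (_ + _).
  by apply: eq_bigr => c _; rewrite bilZ mulrC.
rewrite bil_sum -sumrN; apply: eq_bigr => a _; rewrite bil_sum -sumrN.
apply: eq_bigr => d _; rewrite bilZ s_anti mulNr opprK; congr (_ * _).
have hg : hdeg 1 (gder (th_idx a) P) by apply: hdeg_gder.
have hi x : hdeg 0 (iota x (gder (th_idx a) P)) by apply: hdeg_iota.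
have -> : bil (wedge (th R d) (gder (th_idx a) P)) al be =
    al 0 d * bil P (delta_mx 0 a) be - be 0 d * bil P (delta_mx 0 a) al.
  rewrite /bil -!iota_delta iota_wedge iota_th ginv_gen wedgeZl wedge1l wedgeNl.
  rewrite iotaD iotaZ -[- wedge _ _]scaleN1r iotaZ iota_wedge iota_th wedgeZl wedge1l.
  rewrite iota_delta (iota_hdeg0 _ (hi al)) wedge0r addr0 !scalD !scalZ.
  by rewrite mulN1r.
by rewrite !(bil_anti _ _ (delta_mx 0 a)) mulrN mulrN opprK addrC ![_ 0 d * _]mulrC.
Qed.

(** The Koszul bracket of two one-forms given by their first jets. *)
Definition koszul_row P dP al dal be dbe : 'rV[R]_r :=
  \sum_c (bil P al (rho c) *: dbe c - bil P be (rho c) *: dal c) + koszul_coef P dP al be.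

(** The cancellation of the derivatives of the one-forms in the concomitant, with
    p for pi and p' for pi_N: among the terms with derivatives, only those where N
    is differentiated remain. *)
Lemma koszul_cancel (p p' : 'rV[R]_r -> 'rV[R]_r -> R) (B : 'M[R]_r) (dB : 'I_n -> 'M[R]_r)
    al dal be dbe (h' h1 h2 h : 'rV[R]_r) b :
  (forall x y, p' x y = p x (y *m B)) -> (forall x y, p (x *m B) y = p x (y *m B)) ->
  ((\sum_c (p' al (rho c) *: dbe c - p' be (rho c) *: dal c) + h')
   - (\sum_c (p (al *m B) (rho c) *: dbe c
               - p be (rho c) *: (dal c *m B + al *m dB c)) + h1)
   - (\sum_c (p al (rho c) *: (dbe c *m B + be *m dB c)
               - p (be *m B) (rho c) *: dal c) + h2)
   + (\sum_c (p al (rho c) *: dbe c - p be (rho c) *: dal c) + h) *m B) 0 b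
  = h' 0 b + \sum_e h 0 e * B e b - (h1 0 b + h2 0 b)
    + \sum_c (p be (rho c) * (al *m dB c) 0 b - p al (rho c) * (be *m dB c) 0 b).
Proof.
move=> e1 e2; have -> : \sum_e h 0 e * B e b = (h *m B) 0 b by rewrite mxE.
have -> : \sum_c (p be (rho c) * (al *m dB c) 0 b - p al (rho c) * (be *m dB c) 0 b)
    = (\sum_c (p be (rho c) *: (al *m dB c) - p al (rho c) *: (be *m dB c))) 0 b.
  by rewrite summxE; apply: eq_bigr => c _; rewrite !(mxE, summxE).
rewrite mulmxDl mulmx_suml; set k := h *m B.
set S1 := \sum_c (p' _ _ *: _ - _); set S2 := \sum_c (p (al *m B) _ *: _ - _).
set S3 := \sum_c (p al _ *: (_ + _) - _); set S4 := \sum_c (_ *m B).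
set S5 := \sum_c _.
have -> : S1 = S2 + S3 - S4 + S5.
  rewrite /S1 /S2 /S3 /S4 /S5 -big_split -sumrB -big_split /=; apply: eq_bigr => c _.
  rewrite mulmxBl -!scalemxAl !e1 !e2 !scalerDr.
  apply/rowP => j; rewrite !mxE; ring.
by rewrite !mxE; ring.
Qed.

Section Concomitant.
Variables (B : 'M[R]_r) (dB : 'I_n -> 'M[R]_r).
Variables (P : grass R r) (dP : 'I_n -> grass R r).
Hypothesis hP : hdeg 2 P.
Hypothesis hdP : forall c, hdeg 2 (dP c).
Hypothesis P_comp : forall x, iota (x *m B) P = nact B (iota x P).

Let P' := 2^-1 *: nact B P.
Let dP' c := 2^-1 *: jact B dB P dP c.

Lemma bil_comp x y : bil P (x *m B) y = bil P x (y *m B).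
Proof.
rewrite [RHS]bil_anti {1}/bil P_comp iota_nact [nact B _]nact_hdeg0 ?addr0.
  by rewrite -[LHS]/(bil P x (y *m B)) bil_anti.
by do 2!apply: hdeg_iota.
Qed.

Lemma bil_nact u al be : hdeg 2 u ->
  bil (nact B u) al be = bil u (al *m B) be + bil u al (be *m B).
Proof.
move=> hu; rewrite /bil iota_nact iotaD scalD iota_nact [nact B _]nact_hdeg0 ?addr0 //.
by do 2!apply: hdeg_iota.
Qed.

(** Compatibility makes the derivatives of the one-forms cancel, as those of v did
    in [jbracket_mm_coef]; the rest is recognised by [bil_vec_coef]. *)
Lemma concomitantE al dal be dbe b :
  (koszul_row P' dP' al dal be dbe
   - koszul_row P dP (al *m B) (fun c => dal c *m B + al *m dB c) be dbe
   - koszul_row P dP al dal (be *m B) (fun c => dbe c *m B + be *m dB c)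
   + koszul_row P dP al dal be dbe *m B) 0 b
  = bil (mm_coef B dB P dP b) al be.
Proof.
have bP' x y : bil P' x y = bil P x (y *m B).
  by rewrite /bil /P' iota_half // -/(bil _ _ _) bil_comp.
rewrite /mm_coef -/P' -/dP' !bilD bilN bil_nact; last exact: hdeg_vec_coef.
rewrite !bil_vec_coef //; last exact/hdegZ/hdeg_nact.
have -> : bil (\sum_e B e b *: vec_coef P dP e) al be = \sum_e koszul_coef P dP al be 0 e * B e b.
  by rewrite bil_sum; apply: eq_bigr => e _; rewrite bilZ bil_vec_coef // mulrC.
have -> : bil (\sum_c wedge (iota (rho c) P) (nact (dB c) (th R b))) al be =
    \sum_c (bil P be (rho c) * (al *m dB c) 0 b
    - bil P al (rho c) * (be *m dB c) 0 b).
  rewrite bil_sum; apply: eq_bigr => c _.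
  rewrite /bil iota_wedge iota_nact [nact (dB c) (iota _ _)]nact_hdeg0; last first.
    by apply: hdeg_iota; apply: hdeg_gen.
  have h0 x : hdeg 0 (iota x (iota (rho c) P)) by do 2!apply: hdeg_iota.
  rewrite addr0 iota_th iotaD iota_wedge (iota_hdeg0 _ (h0 al)) wedge0l add0r.
  rewrite wedgeZr wedge1r iotaZ scalD scalZ -/(bil P (rho c) be).
  rewrite (ginv_hdeg (h0 al)) expr0 scale1r {1}(hdeg0E (h0 al)) wedgeZl wedge1l.
  rewrite -[_ finset.set0]/(bil P (rho c) al) iota_nact [nact (dB c) (iota _ _)]nact_hdeg0; last first.
    by apply: hdeg_iota; apply: hdeg_gen.
  rewrite addr0 iota_th !scalZ scal1 mulr1 iota_ginv (ginv_hdeg (h0 be)).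
  rewrite expr0 scale1r scalN -!/(bil _ _ _) !(bil_anti P _ (rho c)).
  by rewrite opprK addrC mulNr mulrC.
exact: (koszul_cancel _ _ _ _ _ _ _ _ _ _ bP' bil_comp).
Qed.
End Concomitant.
End BivectorJets.

(** * Calculus of smooth functions *)

Section SmoothCalculus.
Local Open Scope classical_set_scope.
Variable R : realType.

Lemma near_eq_differentiable (V W : normedModType R) (f g : V -> W) (x : V) :
  {near x, f =1 g} -> differentiable f x -> differentiable g x.
Proof.
move=> fg df; have := diff_locally df => /eqaddoP dfo.
have gx : g x = f x by rewrite (nbhs_singleton fg).
have eg : g \o shift x = cst (g x) + 'd f x +o_ 0 id.
  apply/eqaddoP => e e0; have := dfo e e0; apply: filter_app.
  have fg0 : \forall y \near (0 : V), f (y + x) = g (y + x).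
    by move: fg; rewrite (near_shift 0) subr0.
  near=> y; rewrite /= /cst !fctE /= gx.
  by rewrite (near fg0 y).
apply/diff_locallyP; rewrite (diff_unique (diff_continuous df) eg).
by split=> //; apply: diff_continuous.
Unshelve. all: by end_near. Qed.

Section TimesDifferentiable.
Variable n : nat.
Implicit Types (V U : set 'rV[R]_n) (f g : 'rV[R]_n -> R).

Lemma td_local k V f :
  (forall x, V x -> exists U, U x /\ times_differentiable k U f) ->
  times_differentiable k V f.
Proof.
elim: k V f => //= k IH V f H; split.
  by move=> x /H [U [Ux [df _]]]; apply: df.
move=> c; apply: IH => x /H [U [Ux [_ /(_ c) tU]]]; by exists U.
Qed.

Lemma td_eq k V f g : open V -> (forall x, V x -> f x = g x) ->
  times_differentiable k V f -> times_differentiable k V g.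
Proof.
move=> oV; elim: k f g => //= k IH f g fg [df tf].
have nfg x : V x -> \forall y \near x, f y = g y.
  by move=> Vx; apply: filterS fg _; apply: open_nbhs_nbhs.
split=> [x Vx|c].
  by apply: near_eq_differentiable (df x Vx); apply: nfg.
apply: IH (tf c) => x Vx; apply: near_eq_derive; exact: nfg.
Qed.

Lemma td_cst k V (a : R) : times_differentiable k V (fun=> a).
Proof.
elim: k a => //= k IH a; split=> [x _|c]; first exact: differentiable_cst.
have -> : (fun x => 'D_(basis_vec R c) (fun=> a) x) = (fun=> 0).
  by apply/funext => x; rewrite derive_cst.
exact: IH.
Qed.

Lemma derive_coordE (x v : 'rV[R]_n) (d : 'I_n) :
  'D_v (fun y : 'rV[R]_n => y 0 d) x = v 0 d.
Proof.
have di : derivable (@id 'rV[R]_n) x v by exact: derivable_id.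
have e := derive_mx di.
by move/(congr1 (fun m : 'rV[R]_n => m 0 d)): e; rewrite derive_id [in RHS]mxE.
Qed.

Lemma td_coord k V (d : 'I_n) : times_differentiable k V (fun x => x 0 d).
Proof.
case: k => //= k; split=> [x _|c]; first exact: differentiable_coord.
have -> : (fun x => 'D_(basis_vec R c) (fun y : 'rV[R]_n => y 0 d) x)
    = (fun=> (basis_vec R c) 0 d).
  by apply/funext => x; rewrite derive_coordE.
exact: td_cst.
Qed.

Lemma tdW k V f : times_differentiable k.+1 V f -> times_differentiable k V f.
Proof.
elim: k f => //= k IH f [df tf]; split=> // c; apply: IH; exact: tf.
Qed.

Lemma tdD k V f g : open V -> times_differentiable k V f ->
  times_differentiable k V g -> times_differentiable k V (fun x => f x + g x).
Proof.
move=> oV; elim: k f g => //= k IH f g [df tf] [dg tg]; split=> [x Vx|c].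
  by apply: differentiableD; [apply: df | apply: dg].
apply: td_eq oV _ (IH _ _ (tf c) (tg c)) => x Vx.
by rewrite deriveD //; apply: diff_derivable; [apply: df | apply: dg].
Qed.

Lemma tdM k V f g : open V -> times_differentiable k V f ->
  times_differentiable k V g -> times_differentiable k V (fun x => f x * g x).
Proof.
move=> oV; elim: k f g => //= k IH f g [df tf] [dg tg]; split=> [x Vx|c].
  by apply: differentiableM; [apply: df | apply: dg].
have wf : times_differentiable k V f by apply: tdW.
have wg : times_differentiable k V g by apply: tdW.
apply: td_eq oV _ (tdD oV (IH _ _ wf (tg c)) (IH _ _ wg (tf c))) => x Vx.
by rewrite deriveM //; apply: diff_derivable; [apply: df | apply: dg].
Qed.

Lemma td_sum k V (I : Type) (s : seq I) (F : I -> 'rV[R]_n -> R) : open V ->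
  (forall i, times_differentiable k V (F i)) ->
  times_differentiable k V (fun x => \sum_(i <- s) F i x).
Proof.
move=> oV H; elim: s => [|i s IH].
  have -> : (fun x => \sum_(i <- [::]) F i x) = (fun=> 0).
    by apply/funext => x; rewrite big_nil.
  exact: td_cst.
have -> : (fun x => \sum_(j <- i :: s) F j x) = (fun x => F i x + \sum_(j <- s) F j x).
  by apply/funext => x; rewrite big_cons.
exact: tdD.
Qed.

End TimesDifferentiable.

Lemma coord_differentiable (n m : nat) (g : 'rV[R]_n -> 'rV[R]_m) (x : 'rV[R]_n) :
  (forall d, differentiable (fun y => g y 0 d) x) -> differentiable g x.
Proof.
move=> dg.
have -> : g = \sum_(d < m) (fun y => g y 0 d *: basis_vec R d).
  apply/funext => y; rewrite fct_sumE {1}(row_sum_delta (g y)).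
  by [].
by apply: differentiable_sum => d; apply: differentiableZl.
Qed.

Lemma derive_coord (n m : nat) (g : 'rV[R]_n -> 'rV[R]_m) (x v : 'rV[R]_n) (d : 'I_m) :
  differentiable g x -> ('D_v g x) 0 d = 'D_v (fun y => g y 0 d) x.
Proof.
by move=> dg; rewrite derive_mx ?mxE //; apply: diff_derivable.
Qed.

Lemma derive_chain (n m : nat) (g : 'rV[R]_n -> 'rV[R]_m) (f : 'rV[R]_m -> R)
    (x v : 'rV[R]_n) :
  differentiable g x -> differentiable f (g x) ->
  'D_v (fun y => f (g y)) x =
  \sum_d 'D_(basis_vec R d) f (g x) * 'D_v (fun y => g y 0 d) x.
Proof.
move=> dg df; rewrite deriveE; last exact: differentiable_comp.
have eg : 'd g x v = 'D_v g x by rewrite deriveE.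
rewrite (diff_comp dg df) /= eg {1}(row_sum_delta ('D_v g x)) linear_sum; apply: eq_bigr => d _.
by rewrite linearZ_LR /= -deriveE // derive_coord // mulrC.
Qed.

Lemma td_comp (n m k : nat) (V : set 'rV[R]_n) (W : set 'rV[R]_m)
    (g : 'rV[R]_n -> 'rV[R]_m) (f : 'rV[R]_m -> R) : open V ->
  (forall x, V x -> W (g x)) ->
  (forall d, times_differentiable k V (fun x => g x 0 d)) ->
  times_differentiable k W f -> times_differentiable k V (fun x => f (g x)).
Proof.
move=> oV gVW; elim: k f => //= k IH f tg [df tf].
have dg x : V x -> differentiable g x.
  by move=> Vx; apply: coord_differentiable => d; apply: (tg d).1.
split=> [x Vx|c].
  by apply: (@differentiable_comp _ _ _ _ g f); [apply: dg | apply/df/gVW].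
have h : times_differentiable k V (fun x => \sum_(d < m)
    'D_(basis_vec R d) f (g x) * 'D_(basis_vec R c) (fun y => g y 0 d) x).
  apply: td_sum => // d; apply: tdM => //; last exact: (tg d).2.
  by apply: IH (tf d) => d'; apply: tdW; apply: tg.
apply: td_eq oV _ h => x Vx.
by rewrite derive_chain //; [apply: dg | apply/df/gVW].
Qed.

End SmoothCalculus.

(** * A flat function *)

Section FlatFunction.
Local Open Scope classical_set_scope.
Variable R : realType.

(** t^-j exp(-1/t), extended by zero to t <= 0: this class contains exp(-1/t) and
    is closed under differentiation. *)
Definition flat (j : nat) (t : R) : R :=
  if 0 < t then t^-1 ^+ j * expR (- t^-1) else 0.

(** From (s / (j + 2))^(j + 2) <= exp s at s = 1/t; it gives the derivative at 0. *)
Lemma flat_le j t : `|flat j t| <= j.+2%:R ^+ j.+2 * t ^+ 2.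
Proof.
rewrite /flat; case: ifP => t0; last first.
  by rewrite normr0 mulr_ge0 ?sqr_ge0 ?exprn_ge0.
have s0 : 0 <= t^-1 by rewrite invr_ge0 ltW.
rewrite ger0_norm ?mulr_ge0 ?exprn_ge0 ?expR_ge0 //.
have e1 : (t^-1 / j.+2%:R) ^+ j.+2 <= expR t^-1.
  have -> : expR t^-1 = expR (t^-1 / j.+2%:R) ^+ j.+2.
    by rewrite -expRM_natr -mulrA mulVf ?mulr1 // pnatr_eq0.
  apply: lerXn2r; rewrite ?nnegrE ?divr_ge0 ?expR_ge0 //.
  by apply: le_trans (expR_ge1Dx _); rewrite lerDr.
rewrite expRN ler_pdivrMr ?expR_gt0 // .
have K0 : 0 <= j.+2%:R ^+ j.+2 * t ^+ 2 by rewrite mulr_ge0 ?sqr_ge0 ?exprn_ge0.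
apply: le_trans (ler_wpM2l K0 e1).
rewrite expr_div_n mulrC mulrA mulfVK ?expf_neq0 ?pnatr_eq0 //.
by rewrite -[j.+2]addn2 exprD -mulrA -exprMn mulVf ?expr1n ?mulr1 ?gt_eqF.
Qed.

Lemma is_derive_flat (j : nat) (t : R) :
  is_derive t (1 : R) (flat j) (flat j.+2 t - j%:R * flat j.+1 t).
Proof.
case: (ltgtP t 0) => [t0|t0|->].
- have e : \forall y \near t, (fun=> 0) y = flat j y.
    near=> y; rewrite /flat; case: ifP => // y0.
    by have : y < 0 by [near: y; apply: lt_nbhsl]; rewrite ltNge (ltW y0).
  apply: (near_eq_is_derive e); rewrite /flat !ltNge (ltW t0) /= mulr0 subr0.
  exact: is_derive_cst.
- have e : \forall y \near t, (fun y => y^-1 ^+ j * expR (- y^-1)) y = flat j y.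
    near=> y; rewrite /flat; have -> // : 0 < y.
    by near: y; apply: lt_nbhsr.
  apply: (near_eq_is_derive e); rewrite /flat t0.
  have tn0 : t != 0 by rewrite gt_eqF.
  have d1 : is_derive t 1 (fun y : R => y^-1) (- (t ^- 2)).
    have := @is_deriveV R (@id R) t 1 1 tn0 (is_derive_id _ _).
    by move/(is_derive_eq); apply; rewrite [_ *: _]mulr1.
  have d2 : is_derive t 1 (fun y : R => - y^-1) (t ^- 2).
    by have := is_deriveN d1; move/is_derive_eq; apply; rewrite opprK.
  have d3 : is_derive t 1 (fun y : R => expR (- y^-1)) (expR (- t^-1) * t ^- 2).
    exact: (@is_derive1_comp _ expR (fun y => - y^-1)).
  have sE (a b : R) : a *: (b : R^o) = a * b by [].
  have d4 i : is_derive t 1 (fun y : R => y^-1 ^+ i) (- (i%:R * t^-1 ^+ i.+1)).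
    elim: i => [|i IH].
      by rewrite mul0r oppr0; exact: is_derive_cst.
    have -> : (fun y : R => y^-1 ^+ i.+1) = (fun y : R => y^-1 * y^-1 ^+ i).
      by apply/funext => y; rewrite exprS.
    have := is_deriveM d1 IH; move/is_derive_eq; apply.
    rewrite !sE -exprVn -[i.+1%:R]natr1 [t^-1 ^+ i.+2]exprSr.
    by rewrite !exprS; ring.
  have := is_deriveM (d4 j) d3; move/is_derive_eq; apply.
  rewrite !sE -exprVn [t^-1 ^+ j.+2]exprS exprS.
  by rewrite !exprS; ring.
have c0 : (fun h => h^-1 *: ((flat j \o shift 0) (h *: 1) - flat j 0)) @ 0^' --> (0 : R).
  have f0 : flat j 0 = 0 by rewrite /flat ltxx.
  apply/cvgrPdist_le => e e0; rewrite f0 /=.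
  set K : R := j.+2%:R ^+ j.+2.
  have K0 : 0 < K by rewrite exprn_gt0.
  have eK : 0 < e / K by rewrite divr_gt0.
  near=> h; rewrite sub0r normrN addr0 subr0 [h *: 1]mulr1 normrM normfV.
  have hn0 : h != 0 by near: h; exact: nbhs_dnbhs_neq.
  rewrite mulrC ler_pdivrMr ?normr_gt0 //; apply: le_trans (flat_le j h) _.
  rewrite -/K -real_normK ?num_real // expr2 mulrA ler_wpM2r //.
  rewrite mulrC -ler_pdivlMr //; near: h; exact: dnbhs0_le.
have -> : flat j.+2 0 - j%:R * flat j.+1 0 = 0 by rewrite /flat ltxx mulr0 subr0.
apply: DeriveDef; first by apply/cvg_ex; exists 0.
exact: cvg_lim c0.
Unshelve. all: by end_near. Qed.

End FlatFunction.

(** * Sections and one-forms with prescribed value at a point *)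

Section BumpFunctions.
Local Open Scope classical_set_scope.
Variables (R : realType) (n : nat).

Lemma td_flat (V : set 'rV[R]_n) (q : 'rV[R]_n -> R) (k j : nat) : open V ->
  smooth_on V q -> times_differentiable k V (fun x => flat j (q x)).
Proof.
move=> oV sq; elim: k j => //= k IH j.
have dq x : V x -> differentiable q x by apply: (sq 1%N).1.
have df t : differentiable (@flat R j) t.
  by apply/derivable1_diffP; apply: ex_derive; apply: is_derive_flat.
split=> [x Vx|c].
  by apply: (@differentiable_comp _ _ _ _ q (@flat R j)) => //; apply: dq.
have h : times_differentiable k V (fun x =>
    (flat j.+2 (q x) + (- j%:R) * flat j.+1 (q x)) * 'D_(basis_vec R c) q x).
  apply: tdM => //; last exact: (sq k.+1).2.
  by apply: tdD => //; apply: tdM => //; apply: td_cst.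
apply: td_eq oV _ h => x Vx.
have dfq : differentiable (@flat R j \o q) x.
  by apply: differentiable_comp => //; apply: dq.
rewrite -[fun y => flat j (q y)]/(@flat R j \o q) [RHS]deriveE //.
rewrite (diff_comp (dq x Vx) (df (q x))) /= diff1E // derive1E.
have -> : 'D_1 (@flat R j) (q x) = flat j.+2 (q x) - j%:R * flat j.+1 (q x).
  by case: (is_derive_flat j (q x)).
have -> : 'd q x (basis_vec R c) = 'D_(basis_vec R c) q x.
  by rewrite deriveE //; apply: dq.
by rewrite mulNr mulrC.
Qed.

(** exp(-1/q) with q = e^2 - sum_c (x_c - a_c)^2, divided by its value at a; a
    cube around the ball q >= 0 serves as the compact set. *)
Lemma bump_exists (W : set 'rV[R]_n) (a : 'rV[R]_n) : open W -> W a ->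
  exists (phi : 'rV[R]_n -> R) (K : set 'rV[R]_n),
  [/\ compact K, K `<=` W, smooth_on setT phi, phi a = 1
    & forall x, phi x != 0 -> K x].
Proof.
move=> oW Wa; have /nbhs_ballP[e' /= e'0 eW] : nbhs a W by apply: open_nbhs_nbhs.
pose e := e' / 2; have e0 : 0 < e by rewrite divr_gt0.
pose q (x : 'rV[R]_n) := e ^+ 2 + \sum_c - 1 * ((x 0 c + - a 0 c) * (x 0 c + - a 0 c)).
have sq : smooth_on setT q.
  move=> k; apply: tdD; [exact: openT|exact: td_cst|].
  apply: td_sum => [|c]; first exact: openT.
  apply: tdM; [exact: openT|exact: td_cst|].
  have h : times_differentiable k setT (fun x : 'rV[R]_n => x 0 c + - a 0 c).
    by apply: tdD; [exact: openT|exact: td_coord|exact: td_cst].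
  by apply: tdM => //; exact: openT.
have qa : q a = e ^+ 2.
  by rewrite /q big1 ?addr0 // => c _; rewrite subrr !mulr0.
have fa : flat 0 (q a) != 0.
  by rewrite /flat qa exprn_gt0 // expr0 mul1r gt_eqF // expR_gt0.
exists (fun x => (flat 0 (q a))^-1 * flat 0 (q x)).
exists [set x : 'rV[R]_n | forall c, `[(a 0 c - e), (a 0 c + e)]%classic (x ord0 c)].
split.
- by apply: (@rV_compact _ _ (fun c => `[(a 0 c - e), (a 0 c + e)]%classic)) => c;
    apply: segment_compact.
- move=> x Kx; apply: eW; split=> // i c; rewrite (ord1 i) /ball /=.
  have := Kx c; rewrite /= in_itv /= => /andP[h1 h2].
  have ee : e < e' by rewrite ltr_pdivrMr // ltr_pMr // ltr1n.
  have {}h1 : a 0 c - e <= x 0 c := h1; have {}h2 : x 0 c <= a 0 c + e := h2.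
  by rewrite ltr_norml; apply/andP; split; lra.
- move=> k; apply: tdM; [exact: openT|exact: td_cst|].
  by apply: td_flat; [exact: openT|].
- by rewrite mulVf.
move=> x; rewrite mulf_eq0 negb_or => /andP[_]; rewrite /flat.
case: ifP => [q0 _ c|]; last by rewrite eqxx.
have : (x 0 c - a 0 c) ^+ 2 <= e ^+ 2.
  rewrite -subr_ge0; apply: le_trans (ltW q0) _; rewrite /q lerD2l.
  rewrite (bigD1 c) //= mulN1r -expr2 gerDl sumr_le0 // => d _.
  by rewrite mulN1r -expr2 oppr_le0 sqr_ge0.
rewrite -(real_normK (num_real (x 0 c - a 0 c))).
rewrite ler_pXn2r ?nnegrE ?normr_ge0 ?(ltW e0) // ler_norml.
move=> /andP[h1 h2]; rewrite /= in_itv /= -[x ord0 c]/(x 0 c).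
by apply/andP; split; lra.
Qed.

End BumpFunctions.

Section ManifoldBumps.
Local Open Scope classical_set_scope.
Variables (R : realType) (n : nat) (M : manifold R n).

Definition overlap (i j : chart_index M) : set 'rV[R]_n :=
  chart i @` (dom i `&` dom j).

Lemma cod_dom i m : @dom R n M i m -> cod i (chart i m).
Proof. by move=> im; exists m. Qed.

Lemma cod_param i x : @cod R n M i x -> dom i (param i x) /\ chart i (param i x) = x.
Proof. by move=> [m im <-]; rewrite chartK. Qed.

Lemma param_open i (U : set M) x : open U -> cod i x -> U (param i x) ->
  \forall y \near x, cod i y /\ U (param i y).
Proof.
move=> oU cx Ux; apply: filterI.
  by apply: open_nbhs_nbhs; split=> //; apply: cod_open.
by apply: (param_continuous cx); apply: open_nbhs_nbhs.
Qed.

Lemma overlap_open i j : open (overlap i j).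
Proof.
rewrite openE => _ [m [im jm] <-].
have h := @param_open i (dom j) (chart i m) (@dom_open _ _ M j) (cod_dom im).
rewrite chartK // in h; apply: filterS (h jm) => y [cy jy].
by have [iy <-] := cod_param cy; exists (param i y).
Qed.

(** In another chart the support is closed because it is compact and M is
    Hausdorff; so every point has a neighbourhood either in the overlap, where the
    product is smooth, or off the support, where it is zero. *)
Lemma extend_smooth i j (phi f : 'rV[R]_n -> R) (K : set 'rV[R]_n) :
  compact K -> K `<=` cod i -> smooth_on setT phi ->
  (forall x, phi x != 0 -> K x) -> smooth_on (overlap j i) f ->
  smooth_on (cod j) (fun x => if `[< dom i (param j x) >]
                              then phi (chart i (param j x)) * f x else 0).
Proof.
move=> cK Ki sphi supp sf k; apply: td_local => x0 cx0.
have [ix0|nix0] := pselect (dom i (param j x0)).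
  have [jx0 ex0] := cod_param cx0.
  exists (overlap j i); split; first by exists (param j x0).
  have oo := @overlap_open j i.
  have h : times_differentiable k (overlap j i)
      (fun x => phi (chart i (param j x)) * f x).
    apply: tdM oo _ (sf k).
    apply: (@td_comp R n n k _ setT (fun x => chart i (param j x)) phi) => //.
      exact: overlap_open.
    by move=> d; exact: (@chart_smooth _ _ M j i d k).
  apply: td_eq oo _ h => _ [m [jm im] <-].
  by rewrite chartK //; case: asboolP.
have clK : closed (param i @` K).
  apply: compact_closed; first exact: manifold_hausdorff.
  apply: continuous_compact => //; apply: continuous_in_subspaceT => y.
  by rewrite inE => /Ki cy; apply: param_continuous.
have oU : open (~` (param i @` K)) by apply: closed_openC.
have nx0 : (~` (param i @` K)) (param j x0).
  move=> [y Ky e]; apply: nix0; rewrite -e.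
  by have [] := cod_param (Ki _ Ky).
have : nbhs x0 [set y | cod j y /\ (~` (param i @` K)) (param j y)].
  exact: param_open oU cx0 nx0.
rewrite nbhsE /= => -[U [oUx Ux] UH].
exists U; split=> //.
apply: td_eq oUx _ (td_cst k U 0) => x /UH [cx nKx].
case: asboolP => // ix; case: (eqVneq (phi (chart i (param j x))) 0) => [->|].
  by rewrite mul0r.
by move/supp => Kx; case: nKx; exists (chart i (param j x)) => //; rewrite chartK.
Qed.

Variables (r : nat) (A : vbundle M r).

Lemma bideg_th a : bideg [:: @Gth n r a] = (1, 0)%N.
Proof. by rewrite /bideg !big_cons !big_nil. Qed.

Lemma bideg_xi a : bideg [:: @Gxi n r a] = (0, 1)%N.
Proof. by rewrite /bideg !big_cons !big_nil. Qed.

Lemma sum_trans_id i m (F : 'I_r -> grass R r) a : dom i m ->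
  \sum_b trans A i i m b a *: F b = F a.
Proof.
move=> im; rewrite trans_id // (bigD1 a) //= mxE eqxx scale1r big1 ?addr0 // => b ne.
by rewrite mxE (negPf ne) scale0r.
Qed.

(** A bump function times a constant in the chart i, transported to the other
    charts by the cocycle. *)
Lemma section_exists i m a : dom i m ->
  exists X : fam M r, is_section A X /\ forall p, X i (chart i m) p = th R a.
Proof.
move=> im.
have [phi [K [cK Ki sphi phi1 supp]]] := bump_exists (@cod_open _ _ M i) (cod_dom im).
exists (fun j y p => if `[< dom i (param j y) >] then
  \sum_b (phi (chart i (param j y)) * trans A j i (param j y) b a) *: th R b else 0).
split=> [j|p]; last first.
  rewrite chartK //; case: asboolP => // _; rewrite phi1.
  by under eq_bigr do rewrite mul1r; rewrite sum_trans_id.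
exists r, (fun b x => if `[< dom i (param j x) >] then
  phi (chart i (param j x)) * trans A j i (param j x) b a else 0), (fun b => [:: Gth n b]).
split=> [b|j' m' p jm' jm''].
  split; last exact: bideg_th.
  apply: extend_smooth cK Ki sphi supp _ => k.
  have h : times_differentiable k (overlap j i)
     (fun x => trans A j i (param i (chart i (param j x))) b a).
    apply: (@td_comp R n n k _ (overlap i j) (fun x => chart i (param j x))
       (fun y => trans A j i (param i y) b a)).
    - exact: overlap_open.
    - by move=> _ [x [jx ix] <-]; rewrite chartK //; exists x.
    - by move=> d; exact: (@chart_smooth _ _ M j i d k).
    exact: (@trans_smooth _ _ _ _ A i j b a k).
  refine (td_eq (@overlap_open j i) _ h) => _ [x [jx ix] <-].
  by rewrite !chartK.
rewrite !chartK //; case: asboolP => [im'|_]; last first.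
  by rewrite big1 // => b _; rewrite scale0r.
under [RHS]eq_bigr => b _ do rewrite /= wedge1r scaler_sumr.
rewrite exchange_big; apply: eq_bigr => b _ /=.
rewrite -(trans_cocycle A jm'' jm' im') mxE mulr_sumr scaler_suml.
apply: eq_bigr => c _; rewrite scalerA; congr (_ *: _).
by rewrite -mulrA [trans _ _ _ _ c a * _]mulrC.
Qed.

Lemma oneform_exists i m a : dom i m ->
  exists al : fam M r, is_oneform A al /\ forall p, al i (chart i m) p = xi R a.
Proof.
move=> im.
have [phi [K [cK Ki sphi phi1 supp]]] := bump_exists (@cod_open _ _ M i) (cod_dom im).
exists (fun j y p => if `[< dom i (param j y) >] then
  \sum_b (phi (chart i (param j y)) * trans A i j (param j y) a b) *: xi R b else 0).
split=> [j|p]; last first.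
  rewrite chartK //; case: asboolP => // _; rewrite phi1 trans_id //.
  rewrite (bigD1 a) //= mxE eqxx mulr1 scale1r big1 ?addr0 // => b ne.
  by rewrite mxE eq_sym (negPf ne) mulr0 scale0r.
exists r, (fun b x => if `[< dom i (param j x) >] then
  phi (chart i (param j x)) * trans A i j (param j x) a b else 0), (fun b => [:: Gxi n b]).
split=> [b|j' m' p jm' jm''].
  split; last exact: bideg_xi.
  by apply: extend_smooth cK Ki sphi supp _; apply: trans_smooth.
rewrite !chartK //; case: asboolP => [im'|_]; last first.
  by rewrite big1 // => b _; rewrite scale0r.
under [RHS]eq_bigr => b _ do rewrite /= wedge1r scaler_sumr.
rewrite exchange_big; apply: eq_bigr => b _ /=.
rewrite -(trans_cocycle A im' jm' jm'') mxE mulr_sumr scaler_suml.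
by apply: eq_bigr => c _; rewrite scalerA mulrA.
Qed.

End ManifoldBumps.

(** * Local expressions of functions of given bidegree *)

Section LocalForm.
Local Open Scope classical_set_scope.
Variables (R : realType) (n : nat) (M : manifold R n) (r : nat) (A : vbundle M r).

(** The values of [coord_change i i]. *)
Definition gstd (p : 'rV[R]_n) (g : gen n r) : grass R r :=
  match g with
  | Gp c => p 0 c *: mon R finset.set0
  | Gxi b => xi R b
  | Gth b => th R b
  end.

Lemma near_cod i x : @cod R n M i x -> \forall y \near x, cod i y.
Proof. by move=> cx; apply: open_nbhs_nbhs; split=> //; apply: cod_open. Qed.

Lemma coord_change_id i m p g : @dom R n M i m -> coord_change A i i m p g = gstd p g.
Proof.
move=> im; case: g => [c|b|b] /=; last 2 first.
- rewrite trans_id // (bigD1 b) //= mxE eqxx scale1r big1 ?addr0 // => e ne.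
  by rewrite mxE eq_sym (negPf ne) scale0r.
- exact: sum_trans_id.
have cx := cod_dom im.
rewrite [X in _ + X]big1 ?addr0; last first.
  move=> a _; rewrite big1 // => b _.
  rewrite (_ : 'D_ _ _ _ = 0) ?scale0r //.
  rewrite (near_eq_derive _ (g := fun=> (1%:M : 'M[R]_r) a b)) ?derive_cst //.
  by near=> y; have [iy _] : dom i (param i y) /\ chart i (param i y) = y;
    [apply: cod_param; near: y; exact: near_cod | rewrite trans_id].
congr (_ *: _); rewrite (bigD1 c) //= big1 ?addr0 => [|d ne].
  have -> : 'D_(basis_vec R c) (fun y => chart i (param i y) 0 c) (chart i m) = 1.
    rewrite (near_eq_derive _ (g := fun y : 'rV[R]_n => y 0 c)).
      by rewrite derive_coordE mxE !eqxx.
    by near=> y; have [_ ->] // : dom i (param i y) /\ chart i (param i y) = y;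
      apply: cod_param; near: y; exact: near_cod.
  by rewrite mul1r.
have -> : 'D_(basis_vec R c) (fun y => chart i (param i y) 0 d) (chart i m) = 0.
  rewrite (near_eq_derive _ (g := fun y : 'rV[R]_n => y 0 d)).
    by rewrite derive_coordE mxE (negPf ne) andbF.
  by near=> y; have [_ ->] // : dom i (param i y) /\ chart i (param i y) = y;
    apply: cod_param; near: y; exact: near_cod.
by rewrite mul0r.
Unshelve. all: by end_near. Qed.

Lemma isF_local k l F i : isF A k l F ->
  exists (s : nat) (c : 'I_s -> 'rV[R]_n -> R) (w : 'I_s -> seq (gen n r)),
    (forall t, smooth_on (cod i) (c t) /\ bideg (w t) = (k, l)) /\
    (forall x p, cod i x -> F i x p = \sum_(t < s) c t x *: eval_word (gstd p) (w t)).
Proof.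
move=> /(_ i) [s [c [w [h1 h2]]]]; exists s, c, w; split=> // x p [m im <-].
rewrite (h2 _ _ _ im im); apply: eq_bigr => t _; congr (_ *: _).
elim: (w t) => //= g w' ->; congr (wedge _ _); exact: coord_change_id.
Qed.

Lemma bideg_cons (g : gen n r) w :
  bideg (g :: w) = ((bideg_gen g).1 + (bideg w).1, (bideg_gen g).2 + (bideg w).2)%N.
Proof. by rewrite /bideg !big_cons. Qed.

(** A momentum has bidegree (1,1), so that none occurs in such a word. *)
Lemma word_const (w : seq (gen n r)) p k l : bideg w = (k, l) -> (k == 0)%N || (l == 0)%N ->
  eval_word (gstd p) w = eval_word (gstd 0) w /\ bihom k l (eval_word (gstd 0) w).
Proof.
elim: w k l => [|g w IH] k l.
  by rewrite /bideg !big_nil => -[<- <-] _; split=> //; apply: bihom_one.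
rewrite bideg_cons; case: g => [c|b|b] [<- <-] kl.
- by rewrite /= !addn_eq0 in kl.
- have kl' : ((bideg w).1 == 0%N) || ((bideg w).2 == 0%N).
    by move: kl; rewrite /= addn_eq0 orbF => ->.
  have [e bw] := IH _ _ (surjective_pairing _) kl'.
  by rewrite /= e; split=> //; apply: bihom_xi.
- have kl' : ((bideg w).1 == 0%N) || ((bideg w).2 == 0%N).
    by move: kl; rewrite /= addn_eq0 => ->; rewrite orbT.
  have [e bw] := IH _ _ (surjective_pairing _) kl'.
  by rewrite /= e; split=> //; apply: bihom_th.
Qed.

Definition bihom_pred l (u : grass R r) :=
  if l is l'.+1 then bihom 0 l' u else u = 0.

(** A momentum has bidegree (1,1), so that at most one occurs in such a word. *)
Lemma word_affine (w : seq (gen n r)) l : bideg w = (1, l)%N ->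
  exists (u : 'I_n -> grass R r) (v : grass R r), [/\ forall c, bihom_pred l (u c),
    bihom 1 l v & forall p, eval_word (gstd p) w = \sum_c p 0 c *: u c + v].
Proof.
elim: w l => [|g w IH] l; first by rewrite /bideg !big_nil.
rewrite bideg_cons; case ew: (bideg w) => [k' l'].
case: g => [c|b|b] /= [e1 <-].
- have k0 : k' = 0%N by lia.
  rewrite {}k0 in ew.
  exists (fun d => (d == c)%:R *: eval_word (gstd 0) w), 0; split.
  + move=> d /=; rewrite -[_ *: _]addr0; apply: bihomP; last exact: bihom0.
    by have [] := word_const 0 ew isT.
  + exact: bihom0.
  + move=> p; have [-> _] := word_const p ew isT.
    rewrite addr0 wedgeZl wedge1l (bigD1 c) //= eqxx scale1r big1 ?addr0 // => d ne.
    by rewrite (negPf ne) scale0r scaler0.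
- have k1 : k' = 1%N by lia.
  rewrite {}k1 in ew; have [u [v [hu hv huv]]] := IH _ ew.
  exists (fun c => wedge (xi R b) (u c)), (wedge (xi R b) v); split.
  + move=> c /=; have := hu c; rewrite /bihom_pred.
    case: (l') => [->|l''] //=; first by rewrite wedge0r; apply: bihom0.
    exact: bihom_xi.
  + exact: bihom_xi.
  + move=> p; rewrite huv wedgeDr wedge_sumr; congr (_ + _).
    by apply: eq_bigr => c _; rewrite wedgeZr.
have k0 : k' = 0%N by lia.
rewrite {}k0 in ew; exists (fun=> 0), (wedge (th R b) (eval_word (gstd 0) w)); split.
- by move=> c; rewrite add0n; case: (l') => //= l''; apply: bihom0.
- by rewrite add0n; apply: bihom_th; have [] := word_const 0 ew isT.
move=> p; have [-> _] := word_const p ew isT.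
by rewrite big1 ?add0r // => c _; rewrite scaler0.
Qed.

Definition gdiff (f : 'rV[R]_n -> grass R r) x :=
  forall S, differentiable (fun y => f y S) x.

Definition gd (c : 'I_n) (f : 'rV[R]_n -> grass R r) x : grass R r :=
  [ffun S : {set 'I_(r + r)} => 'D_(basis_vec R c) (fun y => f y S) x].

Lemma gdiff_near f g x : (\forall y \near x, f y = g y) -> gdiff f x -> gdiff g x.
Proof.
move=> e df S; apply: near_eq_differentiable (df S).
by apply: filterS e => y ->.
Qed.

Lemma gd_near c f g x : (\forall y \near x, f y = g y) -> gd c f x = gd c g x.
Proof.
move=> e; apply/ffunP => S; rewrite !ffunE; apply: near_eq_derive.
by apply: filterS e => y ->.
Qed.

Lemma gdiff_scale (a : 'rV[R]_n -> R) f x : differentiable a x -> gdiff f x ->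
  gdiff (fun y => a y *: f y) x.
Proof.
move=> da df S.
have -> : (fun y => (a y *: f y) S) = (fun y => a y * f y S).
  by apply/funext => y; rewrite grassZ.
exact: differentiableM.
Qed.

Lemma gd_scale c (a : 'rV[R]_n -> R) f x : differentiable a x -> gdiff f x ->
  gd c (fun y => a y *: f y) x = 'D_(basis_vec R c) a x *: f x + a x *: gd c f x.
Proof.
move=> da df; apply/ffunP => S; rewrite grassD !grassZ !ffunE.
have -> : (fun y => (a y *: f y) S) = (fun y => a y * f y S).
  by apply/funext => y; rewrite grassZ.
rewrite deriveM; [|exact: diff_derivable|exact: diff_derivable].
by rewrite addrC [_ *: _]/(_ * _) mulrC; congr (_ + _); rewrite [_ *: _]/(_ * _).
Qed.

Lemma gdiffD f g x : gdiff f x -> gdiff g x -> gdiff (fun y => f y + g y) x.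
Proof.
move=> df dg S.
have -> : (fun y => (f y + g y) S) = (fun y => f y S + g y S).
  by apply/funext => y; rewrite grassD.
exact: differentiableD.
Qed.

Lemma gdD c f g x : gdiff f x -> gdiff g x ->
  gd c (fun y => f y + g y) x = gd c f x + gd c g x.
Proof.
move=> df dg; apply/ffunP => S; rewrite grassD !ffunE.
have -> : (fun y => (f y + g y) S) = (fun y => f y S + g y S).
  by apply/funext => y; rewrite grassD.
by rewrite deriveD //; apply: diff_derivable.
Qed.

Lemma gdiff_cst u x : gdiff (fun=> u) x.
Proof. by move=> S; apply: differentiable_cst. Qed.

Lemma gd_cst c u x : gd c (fun=> u) x = 0.
Proof. by apply/ffunP => S; rewrite !ffunE derive_cst. Qed.

Lemma gdiff_sum I (s : seq I) (F : I -> 'rV[R]_n -> grass R r) x :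
  (forall i, gdiff (F i) x) -> gdiff (fun y => \sum_(i <- s) F i y) x.
Proof.
move=> h; elim: s => [|i s IH].
  have -> : (fun y => \sum_(i <- [::]) F i y) = (fun=> 0).
    by apply/funext => y; rewrite big_nil.
  exact: gdiff_cst.
have -> : (fun y => \sum_(j <- i :: s) F j y) = (fun y => F i y + \sum_(j <- s) F j y).
  by apply/funext => y; rewrite big_cons.
exact: gdiffD.
Qed.

Lemma gd_sum c I (s : seq I) (F : I -> 'rV[R]_n -> grass R r) x :
  (forall i, gdiff (F i) x) ->
  gd c (fun y => \sum_(i <- s) F i y) x = \sum_(i <- s) gd c (F i) x.
Proof.
move=> h; elim: s => [|i s IH].
  have -> : (fun y => \sum_(i <- [::]) F i y) = (fun=> 0).
    by apply/funext => y; rewrite big_nil.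
  by rewrite gd_cst big_nil.
have -> : (fun y => \sum_(j <- i :: s) F j y) = (fun y => F i y + \sum_(j <- s) F j y).
  by apply/funext => y; rewrite big_cons.
by rewrite gdD ?big_cons ?IH //; apply: gdiff_sum.
Qed.

Lemma linear_expand (L : {linear grass R r -> grass R r}) u :
  L u = \sum_S u S *: L (mon R S).
Proof.
rewrite {1}(grass_expand u) linear_sum; apply: eq_bigr => S _.
by rewrite linearZ_LR.
Qed.

Lemma gdiff_linear (L : {linear grass R r -> grass R r}) f x :
  gdiff f x -> gdiff (fun y => L (f y)) x.
Proof.
move=> df.
have -> : (fun y => L (f y)) = (fun y => \sum_S f y S *: L (mon R S)).
  by apply/funext => y; rewrite {1}linear_expand.
by apply: gdiff_sum => S; apply: gdiff_scale => //; apply: gdiff_cst.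
Qed.

Lemma gd_linear (L : {linear grass R r -> grass R r}) c f x :
  gdiff f x -> gd c (fun y => L (f y)) x = L (gd c f x).
Proof.
move=> df.
have -> : (fun y => L (f y)) = (fun y => \sum_S f y S *: L (mon R S)).
  by apply/funext => y; rewrite {1}linear_expand.
rewrite gd_sum => [|S]; last by apply: gdiff_scale => //; apply: gdiff_cst.
rewrite [RHS]linear_expand; apply: eq_bigr => S _.
rewrite (@gd_scale c (fun y => f y S) (fun=> L (mon R S))) //.
by rewrite gd_cst scaler0 addr0 ffunE.
Qed.

Definition val (F : fam M r) i x : grass R r := F i x 0.
Definition der (F : fam M r) i x (c : 'I_n) : grass R r := gd c (val F i) x.

(** The class in which brackets are computed: it contains L and is stable under N
    and under the projections on components.  One derivative is enough, since
    iterated brackets never differentiate an element of L twice. *)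
Definition nice (F : fam M r) := forall i x, cod i x ->
  [/\ forall p, F i x p = val F i x, gdiff (val F i) x & thonly (val F i x)].

Lemma thonly_gd c f x : (\forall y \near x, thonly (f y)) -> gdiff f x ->
  thonly (gd c f x).
Proof.
move=> tf df a; rewrite -gd_linear // -(gd_cst c 0 x); apply: gd_near.
by apply: filterS tf => y; apply.
Qed.

Lemma hdeg_gd k c f x : (\forall y \near x, hdeg k (f y)) -> hdeg k (gd c f x).
Proof.
move=> hf S; rewrite ffunE => dS; apply/eqP; apply: contraT => kS.
move: dS; rewrite (near_eq_derive _ (g := fun=> 0)) ?derive_cst ?eqxx //.
apply: filterS hf => y hy; apply/eqP; apply: contraT => /hy e.
by rewrite e eqxx in kS.
Qed.

Lemma isF_nice k F : isF A k 0 F -> nice F.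
Proof.
move=> hF i x cx; have [s [c [w [h1 h2]]]] := isF_local i hF.
have h0 t : bihom k 0 (eval_word (gstd 0) (w t)).
  by have [_ /(word_const 0) []] := h1 t; rewrite ?eqxx ?orbT.
have h2' y p : cod i y -> F i y p = \sum_(t < s) c t y *: eval_word (gstd 0) (w t).
  move=> cy; rewrite h2 //; apply: eq_bigr => t _.
  by have [_ /(word_const p) [|-> //]] := h1 t; rewrite ?eqxx ?orbT.
split=> [p||].
- by rewrite /val !h2'.
- apply: (@gdiff_near (fun y => \sum_(t < s) c t y *: eval_word (gstd 0) (w t))).
    by apply: filterS (near_cod cx) => y cy; rewrite /val h2'.
  apply: gdiff_sum => t; apply: gdiff_scale; last exact: gdiff_cst.
  by have [sc _] := h1 t; apply: (sc 1%N).1.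
rewrite /val h2' //; apply: thonly_sum => t _; apply: thonlyZ.
exact: bihom_thonly (h0 t).
Qed.

Lemma isF_bihom k l F i x : isF A k l F -> (k == 0)%N || (l == 0)%N -> cod i x ->
  bihom k l (val F i x).
Proof.
move=> hF kl cx; have [s [c [w [h1 h2]]]] := isF_local i hF.
rewrite /val h2 //; apply: bihom_sum => t _.
by have [_ /(word_const 0) []] := h1 t.
Qed.

Lemma isF_hdeg k F i x : isF A k 0 F -> cod i x -> hdeg k (val F i x).
Proof.
move=> hF cx; have := bihom_hdeg (isF_bihom hF (orbT _) cx).
by rewrite addn0.
Qed.

End LocalForm.

(** * The big bracket in a chart *)

Section LocalBrackets.
Local Open Scope classical_set_scope.
Variables (R : realType) (n : nat) (M : manifold R n) (r : nat) (A : vbundle M r).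
Implicit Types (F G P Q mu : fam M r).

Lemma val_feq F G i x : feq F G -> cod i x -> val F i x = val G i x.
Proof. by move=> e cx; apply: e. Qed.

Lemma der_feq F G i x : feq F G -> cod i x -> der F i x = der G i x.
Proof.
move=> e cx; apply/funext => c; apply: gd_near.
by apply: filterS (near_cod cx) => y cy; apply: e.
Qed.

Lemma nice_feq F G : feq F G -> nice F -> nice G.
Proof.
move=> e nF i x cx; have [h1 h2 h3] := nF i x cx; split=> [p||].
- by rewrite /val -!e.
- by apply: gdiff_near h2; apply: filterS (near_cod cx) => y cy; apply: e.
by rewrite -(val_feq e).
Qed.

Lemma niceP k F G : nice F -> nice G -> nice (k *: F + G).
Proof.
move=> nF nG i x cx; have [f1 f2 f3] := nF i x cx; have [g1 g2 g3] := nG i x cx.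
split=> [p||].
- by rewrite /val -[LHS]/(k *: F i x p + G i x p) f1 g1.
- apply: gdiffD => //; exact: (gdiff_scale (differentiable_cst k x)).
exact: thonlyP.
Qed.

Lemma derP k F G i x c : nice F -> nice G -> cod i x ->
  der (k *: F + G) i x c = k *: der F i x c + der G i x c.
Proof.
move=> nF nG cx; have [_ f2 _] := nF i x cx; have [_ g2 _] := nG i x cx.
have dk := differentiable_cst k x.
rewrite /der -[val _ i]/(fun y => k *: val F i y + val G i y) gdD //; last first.
  exact: (gdiff_scale dk).
congr (_ + _); rewrite (gd_scale c dk f2).
by rewrite [X in X *: _]derive_cst scale0r add0r.
Qed.

Lemma nice0 : nice (0 : fam M r).
Proof.
move=> i x cx; split=> //; first exact: gdiff_cst.
exact: thonly0.
Qed.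

Lemma der0 i x c : der (0 : fam M r) i x c = 0.
Proof. exact: gd_cst. Qed.

Lemma nice_scale (u : R) F : nice F -> nice (u *: F).
Proof. by move=> nF; rewrite -[_ *: _]addr0; apply: niceP nF nice0. Qed.

Lemma der_scale (u : R) F i x : nice F -> cod i x -> der (u *: F) i x = fun c => u *: der F i x c.
Proof.
move=> nF cx; apply/funext => c; rewrite -[u *: F]addr0 derP //; last exact: nice0.
by rewrite der0 addr0.
Qed.

Lemma nice_sum I (s : seq I) (F : I -> fam M r) :
  (forall t, nice (F t)) -> nice (\sum_(t <- s) F t).
Proof.
move=> h; elim/big_rec: _ => [|t G _ nG]; first exact: nice0.
by rewrite -[F t]scale1r; apply: niceP.
Qed.

Lemma inL_nice P : inL A P -> nice P.
Proof.
move=> [s [Q [hQ e]]]; apply: (@nice_feq (\sum_(t < s) Q t)).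
  by move=> i x p cx; rewrite e.
by apply: nice_sum => t; apply: isF_nice (hQ t).
Qed.

Lemma thonly_val P i x : nice P -> cod i x -> thonly (val P i x).
Proof. by move=> nP cx; have [] := nP i x cx. Qed.

Lemma thonly_der P i x c : nice P -> cod i x -> thonly (der P i x c).
Proof.
move=> nP cx; have [_ dP _] := nP i x cx; apply: thonly_gd => //.
by apply: filterS (near_cod cx) => y cy; apply: thonly_val.
Qed.

Lemma hdeg_der k P i x c : (forall y, cod i y -> hdeg k (val P i y)) -> cod i x ->
  hdeg k (der P i x c).
Proof.
move=> hP cx; apply: hdeg_gd.
by apply: filterS (near_cod cx) => y cy; apply: hP.
Qed.

Variable N : tensor11 M r.
Hypothesis hN : is_tensor11 A N.

Definition derN i x (c : 'I_n) : 'M[R]_r :=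
  \matrix_(a, b) 'D_(basis_vec R c) (fun y => N i y a b) x.

Lemma N_diff i x a b : cod i x -> differentiable (fun y => N i y a b) x.
Proof. by move=> cx; apply: (hN.1 i a b 1%N).1. Qed.

Lemma actE F i x p : act N F i x p = nact (N i x) (F i x p).
Proof. by rewrite nactE. Qed.

Lemma nact_termE f i : (fun y => nact (N i y) (f y)) = (fun y =>
  \sum_(a < r) \sum_(b < r) N i y a b *: (wedge (th R a) \o @gder R r (th_idx b)) (f y)).
Proof. by apply/funext => y; rewrite nactE. Qed.

Lemma gdiff_nact_term f i x a b : cod i x -> gdiff f x ->
  gdiff (fun y => N i y a b *: (wedge (th R a) \o @gder R r (th_idx b)) (f y)) x.
Proof.
move=> cx df; apply: gdiff_scale; first exact: N_diff.
exact: gdiff_linear.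
Qed.

Lemma gdiff_nact f i x : cod i x -> gdiff f x -> gdiff (fun y => nact (N i y) (f y)) x.
Proof.
move=> cx df; rewrite nact_termE; apply: gdiff_sum => a; apply: gdiff_sum => b.
exact: gdiff_nact_term.
Qed.

Lemma gd_nact f i x c : cod i x -> gdiff f x ->
  gd c (fun y => nact (N i y) (f y)) x
    = nact (N i x) (gd c f x) + nact (derN i x c) (f x).
Proof.
move=> cx df; rewrite nact_termE gd_sum => [|a]; last first.
  by apply: gdiff_sum => b; apply: gdiff_nact_term.
rewrite !nactE -big_split; apply: eq_bigr => a _ /=.
rewrite gd_sum => [|b]; last exact: gdiff_nact_term.
rewrite -big_split; apply: eq_bigr => b _ /=.
have dl : gdiff (fun y => (wedge (th R a) \o @gder R r (th_idx b)) (f y)) x.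
  exact: gdiff_linear.
rewrite (gd_scale c (N_diff a b cx) dl) gd_linear //= mxE addrC.
by [].
Qed.

Lemma val_act F i : val (act N F) i = (fun y => nact (N i y) (val F i y)).
Proof. by apply/funext => y; rewrite /val actE. Qed.

Lemma nice_act F : nice F -> nice (act N F).
Proof.
move=> nF i x cx; have [f1 f2 f3] := nF i x cx; split=> [p||].
- by rewrite /val !actE f1.
- by rewrite val_act; apply: gdiff_nact.
by rewrite val_act; apply: thonly_nact.
Qed.

Lemma der_act F i x : nice F -> cod i x ->
  der (act N F) i x = jact (N i x) (derN i x) (val F i x) (der F i x).
Proof.
move=> nF cx; have [f1 f2 f3] := nF i x cx.
by apply/funext => c; rewrite /der val_act gd_nact.
Qed.

Lemma nice_component k F : nice F -> nice (component k F).
Proof.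
move=> nF i x cx; have [f1 f2 f3] := nF i x cx; split=> [p||].
- by rewrite /val /component f1.
- exact: (@gdiff_linear _ _ _ (@gproj R r k)).
exact: thonly_gproj.
Qed.

Lemma der_component k F i x c : nice F -> cod i x ->
  der (component k F) i x c = gproj k (der F i x c).
Proof.
move=> nF cx; have [f1 f2 f3] := nF i x cx.
exact: (@gd_linear _ _ _ (@gproj R r k)).
Qed.

Definition xrow (v : 'rV[R]_r) : grass R r := \sum_a v 0 a *: xi R a.

(** mu at one point: the anchor carried by the momenta, and the structure
    functions carried by sg. *)
Definition symbol mu i x (rho : 'I_n -> 'rV[R]_r) (sg : grass R r) :=
  bihom 1 2 sg /\ forall p, mu i x p = \sum_c p 0 c *: xrow (rho c) + sg.

Lemma symbol_exists mu i x : isF A 1 2 mu -> cod i x -> exists rho sg, symbol mu i x rho sg.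
Proof.
move=> hmu cx; have [s [c [w [h1 h2]]]] := isF_local i hmu.
suff [u [v [hu hv huv]]] : exists (u : 'I_n -> grass R r) (v : grass R r),
    [/\ forall d, bihom 0 1 (u d), bihom 1 2 v &
     forall p, \sum_(t < s) c t x *: eval_word (gstd p) (w t) = \sum_d p 0 d *: u d + v].
  exists (fun d => \row_a scal (gder (xi_idx a) (u d))), v; split=> // p.
  rewrite h2 // huv; congr (_ + _); apply: eq_bigr => d _; congr (_ *: _).
  rewrite {1}(bihom01E (hu d)); apply: eq_bigr => a _.
  by rewrite mxE.
elim: (index_enum _) => [|t e [u [v [hu hv huv]]]].
  exists (fun=> 0), 0; split; [by move=> d; apply: bihom0|exact: bihom0|].
  by move=> p; rewrite big_nil big1 ?addr0 // => d _; rewrite scaler0.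
have [_ wt] := h1 t; have [u' [v' [hu' hv' huv']]] := word_affine R wt.
exists (fun d => c t x *: u' d + u d), (c t x *: v' + v); split.
- by move=> d; apply: bihomP; [apply: hu'|].
- exact: bihomP.
move=> p; rewrite big_cons huv huv' scalerDr scaler_sumr addrACA -big_split.
congr (_ + _); apply: eq_bigr => d _ /=.
by rewrite scalerDr !scalerA mulrC.
Qed.

Lemma gd_affine (u : 'I_n -> grass R r) v q c :
  gd c (fun p : 'rV[R]_n => \sum_d p 0 d *: u d + v) q = u c.
Proof.
have dd d : gdiff (fun p : 'rV[R]_n => p 0 d *: u d) q.
  by apply: gdiff_scale; [exact: differentiable_coord | exact: gdiff_cst].
rewrite gdD ?gd_cst ?addr0; [|exact: gdiff_sum|exact: gdiff_cst].
rewrite gd_sum // (bigD1 c) //= big1 ?addr0 => [|d ne].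
  rewrite gd_scale; [|exact: differentiable_coord|exact: gdiff_cst].
  by rewrite gd_cst scaler0 addr0 derive_coordE mxE !eqxx scale1r.
rewrite gd_scale; [|exact: differentiable_coord|exact: gdiff_cst].
by rewrite gd_cst scaler0 addr0 derive_coordE mxE (negPf ne) andbF scale0r.
Qed.

Lemma bracketE F G i x p : bracket F G i x p =
  \sum_c (wedge (gd c (F i x) p) (gd c (fun y => G i y p) x)
          - wedge (gd c (fun y => F i y p) x) (gd c (G i x) p))
  + \sum_a (wedge (ginv (gder (th_idx a) (F i x p))) (gder (xi_idx a) (G i x p))
          + wedge (ginv (gder (xi_idx a) (F i x p))) (gder (th_idx a) (G i x p))).
Proof.
rewrite /bracket /lbracket -[LHS]/((\sum_c _ : lfun R n r) x p + (\sum_a _ : lfun R n r) x p).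
by rewrite !fct_sumE.
Qed.

Lemma gd_nice_p c P i x p : nice P -> cod i x -> gd c (P i x) p = 0.
Proof.
move=> nP cx; rewrite -(gd_cst c (val P i x) p); apply: gd_near.
by apply: filterE => q; have [h _ _] := nP i x cx.
Qed.

Lemma gd_nice_x c P i x p : nice P -> cod i x -> gd c (fun y => P i y p) x = der P i x c.
Proof.
move=> nP cx; apply: gd_near; apply: filterS (near_cod cx) => y cy.
by have [h _ _] := nP i y cy.
Qed.

Lemma bracket_nice F P i x p : nice P -> cod i x -> bracket F P i x p =
  \sum_c wedge (gd c (F i x) p) (der P i x c)
  + \sum_a wedge (ginv (gder (xi_idx a) (F i x p))) (gder (th_idx a) (val P i x)).
Proof.
move=> nP cx; have [h1 h2 h3] := nP i x cx.
rewrite bracketE; congr (_ + _).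
  by apply: eq_bigr => c _; rewrite (@gd_nice_x c P i x p nP cx) (@gd_nice_p c P i x p nP cx) wedge0r subr0.
by apply: eq_bigr => a _; rewrite h1 h3 wedge0r add0r.
Qed.

Lemma nice_bracket P G i x p : nice P -> cod i x -> bracket P G i x p =
  - (\sum_c wedge (der P i x c) (gd c (G i x) p))
  + \sum_a wedge (ginv (gder (th_idx a) (val P i x))) (gder (xi_idx a) (G i x p)).
Proof.
move=> nP cx; have [h1 h2 h3] := nP i x cx.
rewrite bracketE -sumrN; congr (_ + _).
  by apply: eq_bigr => c _; rewrite (@gd_nice_x c P i x p nP cx) (@gd_nice_p c P i x p nP cx) wedge0l add0r.
by apply: eq_bigr => a _; rewrite h1 h3 linear0 wedge0l addr0.
Qed.

Section Symbol.
Variables (mu : fam M r) (i : chart_index M) (x : 'rV[R]_n).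
Variables (rho : 'I_n -> 'rV[R]_r) (sg : grass R r).
Hypothesis cx : cod i x.
Hypothesis hmu : symbol mu i x rho sg.

Definition structure (a b d : 'I_r) : R :=
  scal (gder (th_idx d) (gder (xi_idx a) (gder (xi_idx b) sg))).

Lemma structure_anti a b d : structure b a d = - structure a b d.
Proof. by rewrite /structure (gder_gder (xi_idx b)) linearN scalN. Qed.

Lemma gd_mu c p : gd c (mu i x) p = xrow (rho c).
Proof.
rewrite -[RHS](gd_affine (fun c => xrow (rho c)) sg p).
by apply: gd_near; apply: filterE => q; rewrite hmu.2.
Qed.

Lemma gder_xrow a v : gder (xi_idx a) (xrow v) = v 0 a *: mon R finset.set0.
Proof.
rewrite linear_sum (bigD1 a) //= linearZ_LR /= gder_gen eqxx scale1r.
rewrite big1 ?addr0 // => b ne; rewrite linearZ_LR /= gder_gen eq_xi_xi eq_sym.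
by rewrite (negPf ne) scale0r scaler0.
Qed.

Lemma gder_mu a p : gder (xi_idx a) (mu i x p) =
  (\sum_c p 0 c * rho c 0 a) *: mon R finset.set0 + gder (xi_idx a) sg.
Proof.
rewrite hmu.2 linearD; congr (_ + _); rewrite linear_sum scaler_suml.
by apply: eq_bigr => c _; rewrite linearZ_LR /= gder_xrow scalerA.
Qed.

Lemma bihom_dsg a : bihom 1 1 (gder (xi_idx a) sg).
Proof. exact: (@bihom_gder_xi R r 1 2 a sg hmu.1). Qed.

Lemma hdeg_dsg a : hdeg 2 (gder (xi_idx a) sg).
Proof. exact: (@bihom_hdeg R r 1 1 _ (@bihom_dsg a)). Qed.

Lemma ginv_dmu a p : ginv (gder (xi_idx a) (mu i x p)) = gder (xi_idx a) (mu i x p).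
Proof.
rewrite gder_mu ginvD (ginv_hdeg (@hdeg_dsg a)) sqrrN expr1n scale1r.
by rewrite linearZ_LR /= (ginv_hdeg (@hdeg_one R r)) expr0 scale1r.
Qed.

Lemma ddsgE a b : gder (xi_idx a) (gder (xi_idx b) sg) = \sum_d structure a b d *: th R d.
Proof.
have h : bihom 1 0 (gder (xi_idx a) (gder (xi_idx b) sg)).
  exact: (@bihom_gder_xi R r 1 1 a _ (@bihom_dsg b)).
have := bihom_hdeg h; rewrite addn0 => h1.
by rewrite {1}(thonly_hdeg1E (bihom_thonly h) h1).
Qed.

(** The part of {mu, P} without momenta. *)
Definition mu_part P : grass R r :=
  \sum_c wedge (xrow (rho c)) (der P i x c)
  + \sum_a wedge (gder (xi_idx a) sg) (gder (th_idx a) (val P i x)).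

Lemma bracket_mu P q : nice P -> bracket mu P i x q =
  \sum_c q 0 c *: iota (rho c) (val P i x) + mu_part P.
Proof.
move=> nP; rewrite bracket_nice // /mu_part addrCA; congr (_ + _).
  by apply: eq_bigr => c _; rewrite gd_mu.
under eq_bigr => a _ do rewrite ginv_dmu gder_mu wedgeDl wedgeZl wedge1l scaler_suml.
rewrite big_split /=; congr (_ + _); rewrite exchange_big; apply: eq_bigr => c _ /=.
by rewrite iotaE scaler_sumr; apply: eq_bigr => a _; rewrite scalerA.
Qed.

Lemma gder_mu_part P b : nice P -> gder (xi_idx b) (mu_part P) =
  \sum_c rho c 0 b *: der P i x c
  + \sum_a wedge (gder (xi_idx b) (gder (xi_idx a) sg)) (gder (th_idx a) (val P i x)).
Proof.
move=> nP; rewrite linearD !linear_sum; congr (_ + _); apply: eq_bigr => c _ /=.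
  rewrite gder_wedge gder_xrow (thonly_der c nP cx) wedge0r addr0.
  by rewrite wedgeZl wedge1l.
by rewrite gder_wedge (thonly_gder _ (thonly_val nP cx)) wedge0r addr0.
Qed.

(** The second bracket with Q differentiates {mu, P} along a momentum or a xi;
    the momenta give the anchor applied to Q, the xi the remaining terms. *)
Lemma l2_jet P Q p : nice P -> nice Q ->
  bracket (bracket mu P) Q i x p =
  jbracket rho structure (val P i x) (der P i x) (val Q i x) (der Q i x).
Proof.
move=> nP nQ; rewrite bracket_nice // /jbracket big_split /= -addrA; congr (_ + _).
  apply: eq_bigr => c _; congr (wedge _ _).
  rewrite -[RHS](gd_affine (fun c => iota (rho c) (val P i x)) (mu_part P) p).
  by apply: gd_near; apply: filterE => q; rewrite bracket_mu.
transitivity (\sum_b (\sum_c wedge (rho c 0 b *: ginv (der P i x c)) (gder (th_idx b) (val Q i x))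
   + \sum_a \sum_d structure a b d *: tensor_term a b d (val P i x) (val Q i x))).
  apply: eq_bigr => b _; rewrite bracket_mu // linearD linear_sum big1 ?add0r; last first.
    by move=> c _; rewrite linearZ_LR /= (thonly_iota _ (thonly_val nP cx)) scaler0.
  rewrite /= gder_mu_part // ginvD wedgeDl linear_sum wedge_suml; congr (_ + _).
    by apply: eq_bigr => c _; rewrite linearZ_LR.
  rewrite linear_sum wedge_suml; apply: eq_bigr => a _.
  rewrite ddsgE wedge_suml linear_sum wedge_suml; apply: eq_bigr => d _.
  rewrite wedgeZl linearZ_LR /= ginv_wedge ginv_gen wedgeNl structure_anti scaleNr scalerN opprK.
  by rewrite wedgeZl /tensor_term wedgeA.
rewrite big_split /=; congr (_ + _).
  rewrite exchange_big; apply: eq_bigr => c _ /=; rewrite iotaE wedge_sumr.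
  by apply: eq_bigr => b _; rewrite wedgeZl wedgeZr.
by rewrite exchange_big.
Qed.

Lemma bracket_mu_anti k P q : nice P -> hdeg k.+1 (val P i x) ->
  (forall c, hdeg k.+1 (der P i x c)) ->
  bracket P mu i x q = (-1) ^+ k *: bracket mu P i x q.
Proof.
move=> nP hP hdP; rewrite nice_bracket // bracket_nice // scalerDr; congr (_ + _).
  rewrite -sumrN scaler_sumr; apply: eq_bigr => c _; rewrite gd_mu.
  have hx : hdeg 1 (xrow (rho c)).
    by apply: hdeg_sum => a _; apply: hdegZ; apply: hdeg_gen.
  rewrite (wedgeC (hdP c) hx) muln1 exprS mulN1r scaleNr opprK.
  by [].
rewrite scaler_sumr; apply: eq_bigr => a _; rewrite ginv_dmu gder_mu.
have hg : hdeg k (gder (th_idx a) (val P i x)) by apply: hdeg_gder.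
rewrite (ginv_hdeg hg) wedgeZl wedgeDr wedgeDl wedgeZr wedgeZl wedge1r wedge1l.
by rewrite (wedgeC hg (@hdeg_dsg a)) mulnC exprM sqrrN expr1n expr1n scale1r.
Qed.

End Symbol.
End LocalBrackets.

Section Schouten.
Variables (R : realType) (n : nat) (M : manifold R n) (r : nat).
Variables (mu : fam M r) (i : chart_index M) (x : 'rV[R]_n).
Variables (rho : 'I_n -> 'rV[R]_r) (sg : grass R r).
Hypothesis cx : cod i x.
Hypothesis hmu : symbol mu i x rho sg.

(** {P, mu} and {mu, P} agree up to sign, which relates the Schouten bracket
    {{P, mu}, Q} to l2. *)
Lemma schouten_jet k (P Q : fam M r) p : nice P -> nice Q -> hdeg k.+1 (val P i x) ->
  (forall c, hdeg k.+1 (der P i x c)) ->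
  bracket (bracket P mu) Q i x p =
  (-1) ^+ k *: jbracket rho (structure sg) (val P i x) (der P i x) (val Q i x) (der Q i x).
Proof.
move=> nP nQ hP hdP; rewrite -(l2_jet cx hmu p nP nQ) !(bracket_nice _ _ nQ cx) scalerDr.
have e q := bracket_mu_anti cx hmu q nP hP hdP.
congr (_ + _); rewrite scaler_sumr; apply: eq_bigr => c _; last first.
  by rewrite -wedgeZl e !linearZ_LR.
rewrite -wedgeZl; congr (wedge _ _).
set u := fun c => iota (rho c) (val P i x); set v := mu_part i x rho sg P.
transitivity (gd c (fun q : 'rV[R]_n => \sum_d q 0 d *: ((-1) ^+ k *: u d) + (-1) ^+ k *: v) p).
  apply: gd_near; apply: filterE => q; rewrite e (bracket_mu cx hmu) // scalerDr scaler_sumr.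
  by congr (_ + _); apply: eq_bigr => d _; rewrite !scalerA mulrC.
rewrite gd_affine -(gd_affine u v p); congr (_ *: _); apply: gd_near.
by apply: filterE => q; rewrite (bracket_mu cx hmu).
Qed.

End Schouten.

(** * The Koszul bracket and the concomitant in a chart *)

Section KoszulBracket.
Local Open Scope classical_set_scope.
Variables (R : realType) (n : nat) (M : manifold R n) (r : nat) (A : vbundle M r).
Implicit Types (F G P X al be mu : fam M r).

Lemma xrowP k (v w : 'rV[R]_r) : xrow (k *: v + w) = k *: xrow v + xrow w.
Proof.
rewrite /xrow scaler_sumr -big_split; apply: eq_bigr => a _ /=.
by rewrite !mxE scalerDl scalerA.
Qed.

Lemma xrow_is_linear : linear (@xrow R r).
Proof. by move=> k v w; apply: xrowP. Qed.
HB.instance Definition _ :=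
  GRing.isLinear.Build R 'rV[R]_r (grass R r) _ (@xrow R r) xrow_is_linear.

Lemma xrow_inj (v w : 'rV[R]_r) : xrow v = xrow w -> v = w.
Proof.
move=> e; apply/rowP => a; move/(congr1 (fun u => scal (gder (xi_idx a) u))): e.
by rewrite !gder_xrow !scalZ scal1 !mulr1.
Qed.

Lemma xrowN (v : 'rV[R]_r) : xrow (- v) = - xrow v.
Proof. exact: linearN. Qed.
Lemma xrowD (v w : 'rV[R]_r) : xrow (v + w) = xrow v + xrow w.
Proof. exact: linearD. Qed.
Lemma xrow_sum I (e : seq I) (Q : pred I) (F : I -> 'rV[R]_r) :
  xrow (\sum_(t <- e | Q t) F t) = \sum_(t <- e | Q t) xrow (F t).
Proof. exact: linear_sum. Qed.
Lemma xrowZ k (v : 'rV[R]_r) : xrow (k *: v) = k *: xrow v.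
Proof. exact: linearZ_LR. Qed.

Lemma gder_th_xrow a (v : 'rV[R]_r) : gder (th_idx a) (xrow v) = 0.
Proof.
rewrite linear_sum big1 // => b _; rewrite linearZ_LR /= gder_gen eq_sym neq_xi_th.
by rewrite scale0r scaler0.
Qed.

Lemma hdeg_xrow (v : 'rV[R]_r) : hdeg 1 (xrow v).
Proof. by apply: hdeg_sum => a _; apply: hdegZ; apply: hdeg_gen. Qed.

Definition coef al i y : 'rV[R]_r := \row_a scal (gder (xi_idx a) (val al i y)).
Definition dcoef al i x (c : 'I_n) : 'rV[R]_r :=
  \row_a 'D_(basis_vec R c) (fun y => coef al i y 0 a) x.

(** The analogue of [nice] for one-forms. *)
Definition xnice al := forall i x, cod i x ->
  (forall p, al i x p = xrow (coef al i x)) /\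
  (forall a, differentiable (fun y => coef al i y 0 a) x).

Lemma coefE al i x v : al i x 0 = xrow v -> coef al i x = v.
Proof.
move=> e; apply/rowP => a; rewrite mxE /val e gder_xrow scalZ scal1.
by rewrite mulr1.
Qed.

Lemma coef_xi al i x a : al i x 0 = xi R a -> coef al i x = delta_mx 0 a.
Proof.
move=> e; apply: coefE; rewrite e /xrow (bigD1 a) //= mxE !eqxx scale1r big1 ?addr0 // => b ne.
by rewrite mxE (negPf ne) andbF scale0r.
Qed.

Lemma oneform_xnice al : is_oneform A al -> xnice al.
Proof.
move=> hal i x cx; have [s [c [w [h1 h2]]]] := isF_local i hal.
have h2' y p : cod i y -> al i y p = \sum_(t < s) c t y *: eval_word (gstd 0) (w t).
  move=> cy; rewrite h2 //; apply: eq_bigr => t _.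
  by have [_ /(word_const p) [|-> //]] := h1 t.
have e y p : cod i y -> al i y p = xrow (coef al i y).
  move=> cy; rewrite (_ : al i y p = val al i y); last by rewrite /val !h2'.
  rewrite {1}(bihom01E (isF_bihom hal isT cy)).
  by apply: eq_bigr => a _; rewrite mxE.
split=> [p|a]; first exact: e.
have : differentiable (fun y => \sum_(t < s) c t y * scal (gder (xi_idx a) (eval_word (gstd 0) (w t)))) x.
  have -> : (fun y => \sum_(t < s) c t y * scal (gder (xi_idx a) (eval_word (gstd 0) (w t))))
     = \sum_(t < s) (fun y => c t y * scal (gder (xi_idx a) (eval_word (gstd 0) (w t)))).
    by apply/funext => y; rewrite fct_sumE.
  apply: differentiable_sum => t; apply: differentiableM; last exact: differentiable_cst.
  by have [sc _] := h1 t; apply: (sc 1%N).1.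
apply: near_eq_differentiable; apply: filterS (near_cod cx) => y cy.
rewrite mxE /val h2' // linear_sum scal_sum; apply: eq_bigr => t _.
by rewrite linearZ_LR /= scalZ.
Qed.

Lemma gd_coef c al i x p : xnice al -> cod i x ->
  gd c (fun y => al i y p) x = xrow (dcoef al i x c).
Proof.
move=> xal cx; have [_ da] := xal i x cx.
rewrite (@gd_near _ _ _ c _ (fun y => \sum_a coef al i y 0 a *: xi R a) x); last first.
  by apply: filterS (near_cod cx) => y cy; have [-> _] := xal i y cy.
rewrite gd_sum => [|a]; last by apply: gdiff_scale => //; apply: gdiff_cst.
apply: eq_bigr => a _.
rewrite (@gd_scale _ _ _ c (fun y => coef al i y 0 a) (fun=> xi R a)) //.
by rewrite gd_cst scaler0 addr0 mxE.
Qed.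

Lemma gd_xnice_p c al i x p : xnice al -> cod i x -> gd c (al i x) p = 0.
Proof.
move=> xal cx; rewrite -(gd_cst c (val al i x) p); apply: gd_near.
by apply: filterE => q; have [h _] := xal i x cx; rewrite /val !h.
Qed.

Lemma sharpE P al i x p : nice P -> xnice al -> cod i x ->
  sharp P al i x p = iota (coef al i x) (val P i x).
Proof.
move=> nP xal cx; rewrite /sharp bracket_nice // big1 ?add0r; last first.
  by move=> c _; rewrite gd_xnice_p // wedge0l.
rewrite iotaE; apply: eq_bigr => a _; have [-> _] := xal i x cx.
rewrite gder_xrow linearZ_LR /= (ginv_hdeg (@hdeg_one R r)) expr0 scale1r.
by rewrite wedgeZl wedge1l.
Qed.

Lemma gdiff_iota (v : 'rV[R]_n -> 'rV[R]_r) f x :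
  (forall a, differentiable (fun y => v y 0 a) x) -> gdiff f x ->
  gdiff (fun y => iota (v y) (f y)) x.
Proof.
move=> dv df.
have -> : (fun y => iota (v y) (f y)) =
    (fun y => \sum_a v y 0 a *: gder (th_idx a) (f y)).
  by apply/funext => y; rewrite iotaE.
apply: gdiff_sum => a; apply: gdiff_scale => //.
exact: gdiff_linear.
Qed.

Lemma gd_iota c (v : 'rV[R]_n -> 'rV[R]_r) f x :
  (forall a, differentiable (fun y => v y 0 a) x) -> gdiff f x ->
  gd c (fun y => iota (v y) (f y)) x =
    iota (\row_a 'D_(basis_vec R c) (fun y => v y 0 a) x) (f x)
    + iota (v x) (gd c f x).
Proof.
move=> dv df.
have -> : (fun y => iota (v y) (f y)) =
    (fun y => \sum_a v y 0 a *: gder (th_idx a) (f y)).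
  by apply/funext => y; rewrite iotaE.
have dg a : gdiff (fun y => gder (th_idx a) (f y)) x by apply: gdiff_linear.
rewrite gd_sum => [|a]; last by apply: gdiff_scale.
rewrite !iotaE -big_split; apply: eq_bigr => a _ /=.
by rewrite (gd_scale c (dv a) (dg a)) mxE gd_linear.
Qed.

(** The derivatives of the components of the two sections pi^# of a one-form cancel
    against those of pi(alpha, beta), except for the derivative of pi itself. *)
Lemma koszul_rowE (rho : 'I_n -> 'rV[R]_r) (s : 'I_r -> 'I_r -> 'I_r -> R)
    (u : grass R r) (du : 'I_n -> grass R r) (v w : 'rV[R]_r) (dv dw : 'I_n -> 'rV[R]_r) :
  (\sum_c (scal (iota (rho c) (iota v u)) *: dw c
      + scal (iota w (iota (dv c) u + iota v (du c))) *: rho c)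
    + \row_e \sum_a \sum_d s e a d * ((\row_a bil u v (delta_mx 0 a)) 0 a * w 0 d))
  - (\sum_c (scal (iota (rho c) (iota w u)) *: dv c
      + scal (iota v (iota (dw c) u + iota w (du c))) *: rho c)
    + \row_e \sum_a \sum_d s e a d * ((\row_a bil u w (delta_mx 0 a)) 0 a * v 0 d))
  - \sum_c (scal (iota (dw c) (iota v u))
      + scal (iota w (iota (dv c) u + iota v (du c)))) *: rho c
  = koszul_row rho s u du v dv w dw.
Proof.
set r1 := \row_e _; set r2 := \row_e _.
set S1 := \sum_c _; set S2 := \sum_c _; set S3 := \sum_c _.
have -> : S1 = S2 + S3 + (\sum_c (bil u v (rho c) *: dw c - bil u w (rho c) *: dv c)
    + \sum_c bil (du c) v w *: rho c).
  rewrite /S1 /S2 /S3 -!big_split /=; apply: eq_bigr => c _.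
  rewrite !iotaD !scalD -!/(bil _ _ _) (bil_anti _ v (dw c)) (bil_anti _ v w).
  apply/rowP => e; rewrite !mxE; ring.
have -> : koszul_row rho s u du v dv w dw =
    \sum_c (bil u v (rho c) *: dw c - bil u w (rho c) *: dv c)
    + (\sum_c bil (du c) v w *: rho c + (r1 - r2)).
  rewrite /koszul_row; congr (_ + _); apply/rowP => e.
  rewrite /r1 /r2 !mxE summxE; congr (_ + _).
    by apply: eq_bigr => c _; rewrite mxE.
  rewrite -sumrB; apply: eq_bigr => a _; rewrite -sumrB; apply: eq_bigr => d _.
  by rewrite !mxE mulrBr.
by apply/rowP => e; rewrite !mxE; ring.
Qed.

Section Bivector.
Variable P : fam M r.
Hypothesis nP : nice P.
Hypothesis hP : forall i x, cod i x -> hdeg 2 (val P i x).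

Lemma val_sharp al i x : xnice al -> cod i x ->
  val (sharp P al) i x = iota (coef al i x) (val P i x).
Proof. by move=> xal cx; rewrite /val sharpE. Qed.

Lemma nice_sharp al : xnice al -> nice (sharp P al).
Proof.
move=> xal i x cx; have [_ da] := xal i x cx; have [_ dP tP] := nP cx.
split=> [p||].
- by rewrite val_sharp // sharpE.
- apply: (@gdiff_near _ _ _ (fun y => iota (coef al i y) (val P i y))).
    by apply: filterS (near_cod cx) => y cy; rewrite val_sharp.
  exact: gdiff_iota.
by rewrite val_sharp //; apply: thonly_iota.
Qed.

Lemma der_sharp al i x c : xnice al -> cod i x ->
  der (sharp P al) i x c = iota (dcoef al i x c) (val P i x)
                           + iota (coef al i x) (der P i x c).
Proof.
move=> xal cx; have [_ da] := xal i x cx; have [_ dP tP] := nP cx.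
rewrite -[der P i x c]/(gd c (val P i) x) -gd_iota //; apply: gd_near.
by apply: filterS (near_cod cx) => y cy; rewrite val_sharp.
Qed.

End Bivector.

Section Symbol.
Variables (mu : fam M r) (i : chart_index M) (x : 'rV[R]_n).
Variables (rho : 'I_n -> 'rV[R]_r) (sg : grass R r).
Hypothesis cx : cod i x.
Hypothesis hmu : symbol mu i x rho sg.
Let s := structure sg.

Definition sec X : 'rV[R]_r := \row_a scal (gder (th_idx a) (val X i x)).

Lemma gder_th_dsg a b : gder (th_idx a) (gder (xi_idx b) sg) =
  xrow (\row_e - s e b a).
Proof.
have h : bihom 0 1 (gder (th_idx a) (gder (xi_idx b) sg)).
  exact: (@bihom_gder_th R r 1 1 a _ (bihom_dsg hmu (a := b))).
rewrite {1}(bihom01E h); apply: eq_bigr => e _; rewrite mxE; congr (_ *: _).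
by rewrite gder_gder scalN.
Qed.

Lemma iota_scal (v : 'rV[R]_r) u : hdeg 1 u -> iota v u = scal (iota v u) *: mon R finset.set0.
Proof.
move=> hu; have h : hdeg 0 (iota v u) by apply: hdeg_iota.
exact: hdeg0E h.
Qed.

Lemma gder_th_mu_part a X : nice X -> hdeg 1 (val X i x) -> (forall c, hdeg 1 (der X i x c)) ->
  gder (th_idx a) (mu_part i x rho sg X) =
  - xrow (\sum_c scal (gder (th_idx a) (der X i x c)) *: rho c
          + \row_e \sum_b s e b a * sec X 0 b).
Proof.
move=> nX hX hdX; rewrite linearD [X in X + _ = _]linear_sum [X in _ + X = _]linear_sum.
rewrite xrowD opprD; congr (_ + _).
  rewrite xrow_sum -sumrN; apply: eq_bigr => c _ /=.
  rewrite gder_wedge gder_th_xrow wedge0l add0r (ginv_hdeg (@hdeg_xrow _)).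
  have h : hdeg 0 (gder (th_idx a) (der X i x c)) by apply: hdeg_gder.
  rewrite {1}(hdeg0E h) wedgeZr wedge1r expr1 scaleN1r scalerN.
  by rewrite -xrowZ.
transitivity (\sum_b sec X 0 b *: xrow (\row_e - s e b a)).
  apply: eq_bigr => b _ /=; rewrite gder_wedge.
  have h : hdeg 0 (gder (th_idx b) (val X i x)) by apply: hdeg_gder.
  rewrite (gder_hdeg0 _ h) wedge0r addr0 gder_th_dsg {1}(hdeg0E h) wedgeZr wedge1r.
  by rewrite [sec _ _ _]mxE.
under eq_bigr do rewrite -xrowZ.
rewrite -xrow_sum -xrowN; congr xrow; apply/rowP => e.
rewrite summxE [in RHS]mxE [in RHS]mxE -sumrN; apply: eq_bigr => b _.
by rewrite [LHS]mxE [X in _ * X]mxE mulrN mulrC.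
Qed.

Lemma scal_iota (v : 'rV[R]_r) u : scal (iota v u) = \sum_a v 0 a * scal (gder (th_idx a) u).
Proof. by rewrite iotaE scal_sum; apply: eq_bigr => a _; rewrite scalZ. Qed.

Lemma lieder_jet X be p : nice X -> (forall y, cod i y -> hdeg 1 (val X i y)) -> xnice be ->
  lieder mu X be i x p = xrow (
    \sum_c (scal (iota (rho c) (val X i x)) *: dcoef be i x c
           + scal (iota (coef be i x) (der X i x c)) *: rho c)
    + \row_e \sum_a \sum_d s e a d * (sec X 0 a * coef be i x 0 d)).
Proof.
move=> nX hX xbe; have hX0 := hX x cx.
have hdX c : hdeg 1 (der X i x c) by apply: hdeg_der.
have eG q : bracket X mu i x q =
    \sum_c q 0 c *: iota (rho c) (val X i x) + mu_part i x rho sg X.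
  by rewrite (bracket_mu_anti cx hmu q nX hX0 hdX) expr0 scale1r (bracket_mu cx hmu).
have [ebe _] := xbe i x cx.
have -> : lieder mu X be i x p =
    \sum_c scal (iota (rho c) (val X i x)) *: xrow (dcoef be i x c)
    + \sum_a coef be i x 0 a *: xrow (\sum_c scal (gder (th_idx a) (der X i x c)) *: rho c
          + \row_e \sum_b s e b a * sec X 0 b).
  rewrite /lieder bracketE; congr (_ + _).
    apply: eq_bigr => c _; rewrite (gd_xnice_p c p xbe cx) wedge0r subr0 gd_coef //.
    have -> : gd c (bracket X mu i x) p = iota (rho c) (val X i x).
      rewrite -[RHS](gd_affine (fun c => iota (rho c) (val X i x)) (mu_part i x rho sg X) p).
      by apply: gd_near; apply: filterE.
    by rewrite {1}(iota_scal _ hX0) wedgeZl wedge1l.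
  apply: eq_bigr => a _; rewrite eG ebe gder_th_xrow wedge0r addr0 gder_xrow wedgeZr wedge1r.
  congr (_ *: _); rewrite linearD linear_sum big1 ?add0r /=; last first.
    move=> c _; rewrite linearZ_LR /= gder_hdeg0 ?scaler0 //.
    exact: hdeg_iota.
  by rewrite gder_th_mu_part // linearN /= (ginv_hdeg (@hdeg_xrow _)) expr1 scaleN1r opprK.
rewrite xrowD xrow_sum.
under [in RHS]eq_bigr do rewrite xrowD !xrowZ.
rewrite [in RHS]big_split /= -addrA; congr (_ + _).
under eq_bigr do rewrite -xrowZ scalerDr xrowD.
rewrite big_split /=; congr (_ + _).
  under eq_bigr do rewrite scaler_sumr xrow_sum.
  rewrite exchange_big; apply: eq_bigr => c _ /=.
  rewrite scal_iota scaler_suml; apply: eq_bigr => a _.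
  by rewrite scalerA xrowZ.
rewrite -xrow_sum; congr xrow; apply/rowP => e; rewrite summxE [in RHS]mxE exchange_big /=.
apply: eq_bigr => d _; rewrite [LHS]mxE [X in _ * X]mxE mulr_sumr; apply: eq_bigr => a _.
by rewrite mulrCA [coef _ _ _ _ _ * _]mulrC.
Qed.

Lemma dA_jet X be p : nice X -> (forall y, cod i y -> hdeg 1 (val X i y)) -> xnice be ->
  dA mu (bracket X be) i x p =
  xrow (\sum_c (scal (iota (dcoef be i x c) (val X i x))
                + scal (iota (coef be i x) (der X i x c))) *: rho c).
Proof.
move=> nX hX xbe.
have ef y q : cod i y -> bracket X be i y q = iota (coef be i y) (val X i y).
  move=> cy; have [ebe _] := xbe i y cy.
  rewrite nice_bracket // big1 ?oppr0 ?add0r; last first.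
    by move=> c _; rewrite gd_xnice_p // wedge0r.
  rewrite iotaE; apply: eq_bigr => a _; rewrite ebe gder_xrow wedgeZr wedge1r.
  have h : hdeg 0 (gder (th_idx a) (val X i y)) by apply: hdeg_gder; apply: hX.
  by rewrite (ginv_hdeg h) expr0 scale1r.
have [_ dbe] := xbe i x cx; have [_ dX _] := nX i x cx.
have hf c q : gd c (fun y => bracket X be i y q) x =
    iota (dcoef be i x c) (val X i x) + iota (coef be i x) (der X i x c).
  rewrite -[der X i x c]/(gd c (val X i) x) -gd_iota //; apply: gd_near.
  by apply: filterS (near_cod cx) => y cy; rewrite ef.
have gf c q : gd c (bracket X be i x) q = 0.
  rewrite -(gd_cst c (iota (coef be i x) (val X i x)) q); apply: gd_near.
  by apply: filterE => q'; rewrite ef.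
have hX0 := hX x cx.
have h0 (v : 'rV[R]_r) : hdeg 0 (iota v (val X i x)) by apply: hdeg_iota.
have hdX c : hdeg 1 (der X i x c) by apply: hdeg_der.
rewrite /dA bracketE [X in _ + X = _]big1 ?addr0; last first.
  move=> a _; rewrite ef // !(gder_hdeg0 _ (h0 _)).
  by rewrite !wedge0r addr0.
rewrite xrow_sum; apply: eq_bigr => c _; rewrite hf gf wedge0r subr0 (gd_mu hmu).
rewrite (iota_scal _ hX0) (iota_scal _ (hdX c)) -scalerDl wedgeZr wedge1r.
by rewrite xrowZ !scalZ scal1 !mulr1.
Qed.

Variable P : fam M r.
Hypothesis nP : nice P.
Hypothesis hP : forall i x, cod i x -> hdeg 2 (val P i x).
Variable sh : fam M r -> fam M r.
Hypothesis hsh : forall al, xnice al -> feq (sh al) (sharp P al).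

Lemma koszul_jet al be p : xnice al -> xnice be -> koszul mu sh al be i x p =
  xrow (koszul_row rho s (val P i x) (der P i x) (coef al i x) (dcoef al i x)
                (coef be i x) (dcoef be i x)).
Proof.
move=> xal xbe.
have nsh g : xnice g -> nice (sh g).
  move=> xg; apply: nice_feq (nice_sharp nP xg) => j y q cy.
  by rewrite hsh.
have vsh g y : xnice g -> cod i y -> val (sh g) i y = iota (coef g i y) (val P i y).
  by move=> xg cy; rewrite (val_feq (hsh xg) cy) val_sharp.
have hs g y : xnice g -> cod i y -> hdeg 1 (val (sh g) i y).
  by move=> xg cy; rewrite vsh //; apply: hdeg_iota; apply: hP.
have dsh g c : xnice g -> der (sh g) i x c =
    iota (dcoef g i x c) (val P i x) + iota (coef g i x) (der P i x c).
  by move=> xg; rewrite (der_feq (hsh xg) cx) der_sharp.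
rewrite -[LHS]/(lieder mu (sh al) be i x p - lieder mu (sh be) al i x p
                - dA mu (bracket (sh al) be) i x p).
rewrite !lieder_jet //; try by [apply: nsh | move=> y cy; apply: hs].
rewrite dA_jet //; try by [apply: nsh | move=> y cy; apply: hs].
rewrite -!xrowN -!xrowD; congr xrow; rewrite -koszul_rowE.
have ds g : xnice g -> der (sh g) i x = (fun c =>
    iota (dcoef g i x c) (val P i x) + iota (coef g i x) (der P i x c)).
  by move=> xg; apply/funext => c; apply: dsh.
have ss g : xnice g -> sec (sh g) = \row_a bil (val P i x) (coef g i x) (delta_mx 0 a).
  by move=> xg; apply/rowP => a; rewrite !mxE vsh // -iota_delta.
by rewrite !ds // !vsh // !ss.
Qed.

End Symbol.

Section Concomitant.
Variable N : tensor11 M r.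
Hypothesis hN : is_tensor11 A N.

Lemma tact_xrow i x p al (v : 'rV[R]_r) : al i x p = xrow v ->
  tact N al i x p = xrow (v *m N i x).
Proof.
move=> e; rewrite /tact e exchange_big /=; apply: eq_bigr => b _.
rewrite mxE scaler_suml; apply: eq_bigr => a _.
by rewrite gder_xrow wedgeZr wedge1r scalerA mulrC.
Qed.

Lemma coef_tact al i x : xnice al -> cod i x ->
  coef (tact N al) i x = coef al i x *m N i x.
Proof. by move=> xal cx; apply: coefE; apply: tact_xrow; rewrite (xal i x cx).1. Qed.

Lemma xnice_tact al : xnice al -> xnice (tact N al).
Proof.
move=> xal i x cx; split=> [p|b].
  by rewrite coef_tact //; apply: tact_xrow; rewrite (xal i x cx).1.
have [_ da] := xal i x cx.
have : differentiable (fun y => \sum_a coef al i y 0 a * N i y a b) x.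
  have -> : (fun y => \sum_a coef al i y 0 a * N i y a b)
      = \sum_a (fun y => coef al i y 0 a * N i y a b).
    by apply/funext => y; rewrite fct_sumE.
  apply: differentiable_sum => a; apply: differentiableM => //.
  exact: (N_diff hN).
apply: near_eq_differentiable; apply: filterS (near_cod cx) => y cy.
by rewrite coef_tact // mxE.
Qed.

Lemma dcoef_tact al i x c : xnice al -> cod i x ->
  dcoef (tact N al) i x c = dcoef al i x c *m N i x + coef al i x *m derN N i x c.
Proof.
move=> xal cx; have [_ da] := xal i x cx; apply/rowP => b.
have dt a : differentiable (fun y => coef al i y 0 a * N i y a b) x.
  by apply: differentiableM => //; apply: (N_diff hN).
rewrite [LHS]mxE (near_eq_derive _ (g := \sum_a (fun y => coef al i y 0 a * N i y a b))).
  rewrite derive_sum => [|a]; last exact: diff_derivable.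
  rewrite [in RHS]mxE [X in X + _]mxE [X in _ + X]mxE -big_split; apply: eq_bigr => a _ /=.
  rewrite deriveM; [|exact: diff_derivable|exact/diff_derivable/(N_diff hN)].
  have e1 : dcoef al i x c 0 a = 'D_(basis_vec R c) (fun y => coef al i y 0 a) x.
    by rewrite mxE.
  have e2 : derN N i x c a b = 'D_(basis_vec R c) (fun y => N i y a b) x by rewrite mxE.
  by rewrite e1 e2 addrC [_ * N i x a b]mulrC.
apply: filterS (near_cod cx) => y cy.
by rewrite fct_sumE coef_tact // mxE.
Qed.

Variable pi : fam M r.
Hypothesis npi : nice pi.
Hypothesis hpi : forall i x, cod i x -> hdeg 2 (val pi i x).

(** Compatibility is linear over functions in the one-form, hence it can be tested
    at a point on one-forms with prescribed value there. *)
Lemma compatible_jet : compatible A pi N ->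
  forall i x, cod i x -> forall v, iota (v *m N i x) (val pi i x) =
    nact (N i x) (iota v (val pi i x)).
Proof.
move=> hc i x [m im <-] v; have cm := cod_dom im; rewrite (row_sum_delta v) mulmx_suml.
have E a : iota (delta_mx 0 a *m N i (chart i m)) (val pi i (chart i m)) =
    nact (N i (chart i m)) (iota (delta_mx 0 a) (val pi i (chart i m))).
  have [al [hal eal]] := oneform_exists A a im.
  have xal := oneform_xnice hal.
  have ca := coef_xi (eal 0).
  have := hc al hal i (chart i m) 0 cm; rewrite actE !sharpE //; last exact: xnice_tact.
  by rewrite coef_tact // ca => ->.
elim: (index_enum _) => [|a e IH].
  by rewrite !big_nil !iota0l linear0.
by rewrite !big_cons !iotaDl IH -scalemxAl !iotaZl E nactD nactZ.
Qed.

Hypothesis P_comp : forall i x, cod i x -> forall v,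
  iota (v *m N i x) (val pi i x) = nact (N i x) (iota v (val pi i x)).

Let P' : fam M r := (2^-1 : R) *: act N pi.

Let vP' i x : val P' i x = 2^-1 *: nact (N i x) (val pi i x).
Proof. by rewrite -actE. Qed.

Let nP' : nice P'.
Proof.
exact/nice_scale/(nice_act hN).
Qed.

Let hP' i x : cod i x -> hdeg 2 (val P' i x).
Proof. by move=> cx; rewrite vP'; apply/hdegZ/hdeg_nact/hpi. Qed.

Let dP' i x : cod i x -> der P' i x =
  (fun c => 2^-1 *: jact (N i x) (derN N i x) (val pi i x) (der pi i x) c).
Proof.
by move=> cx; rewrite der_scale ?(der_act hN) //; apply: (nice_act hN).
Qed.

(** pi^# o N^* is the map of the bivector N pi / 2, so that all four brackets in
    the concomitant are Koszul brackets of bivectors. *)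
Lemma concomitant_jet mu i x rho sg al be p : cod i x -> symbol mu i x rho sg ->
  xnice al -> xnice be ->
  koszul mu (fun a => sharp pi (tact N a)) al be i x p -
  (koszul mu (sharp pi) (tact N al) be + koszul mu (sharp pi) al (tact N be)
         - tact N (koszul mu (sharp pi) al be)) i x p
  = xrow (\row_b bil (mm_coef rho (structure sg) (N i x) (derN N i x) (val pi i x) (der pi i x) b)
                      (coef al i x) (coef be i x)).
Proof.
move=> cx hmu xal xbe; have xtal := xnice_tact xal; have xtbe := xnice_tact xbe.
have sh' g : xnice g -> feq (sharp pi (tact N g)) (sharp P' g).
  move=> xg j y q cy; rewrite !sharpE //; last exact: xnice_tact.
  by rewrite coef_tact // vP' (iota_half (P_comp cy)).
rewrite (koszul_jet cx hmu nP' hP' sh' p xal xbe).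
have hsh g : xnice g -> feq (sharp pi g) (sharp pi g) by [].
rewrite -[X in _ - X]/(koszul mu (sharp pi) (tact N al) be i x p
   + koszul mu (sharp pi) al (tact N be) i x p - tact N (koszul mu (sharp pi) al be) i x p).
rewrite (tact_xrow (koszul_jet cx hmu npi hpi hsh p xal xbe)).
rewrite !(koszul_jet cx hmu npi hpi hsh) // !coef_tact // vP' dP' //.
have dt g : xnice g -> dcoef (tact N g) i x =
    (fun c => dcoef g i x c *m N i x + coef g i x *m derN N i x c).
  by move=> xg; apply/funext => c; rewrite dcoef_tact.
rewrite !dt // -!xrowN -!xrowD -xrowN -xrowD; congr xrow; apply/rowP => b.
have hdpi c : hdeg 2 (der pi i x c) by apply: hdeg_der cx => y cy; apply: hpi.
have E := concomitantE rho (structure_anti sg) (derN N i x) (hpi cx) hdpi (P_comp cx)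
  (coef al i x) (dcoef al i x) (coef be i x) (dcoef be i x) b.
rewrite [RHS]mxE -E.
have r4 (V1 V2 V3 V4 : 'rV[R]_r) : V1 - (V2 + V3 - V4) = V1 - V2 - V3 + V4.
  by rewrite !opprD opprK !addrA.
by rewrite r4.
Qed.

End Concomitant.
End KoszulBracket.

(** * Insertions with at most two arguments *)

Section SmallInsertions.
Variables (R : realType) (n : nat) (M : manifold R n) (r : nat).
Implicit Types (K H : vform M r) (X Y : fam M r) (xs : seq (fam M r)).

Import mathcomp.boot.finset.

Definition insterm K H xs (p : {ffun 'I_(size xs) -> 'I_r.+1}) (S : {set 'I_(size xs)}) : fam M r :=
  (-1) ^+ (\sum_(t in S) \sum_(u in ~: S | (u < t)%N) p u * p t)%N *:
    (let X t := component (p t) (nth 0 xs t) in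
     H (K [seq X t | t <- enum S] :: [seq X t | t <- enum (~: S)])).

Lemma insertionE K H xs : insertion K H xs =
  \sum_(p : {ffun 'I_(size xs) -> 'I_r.+1}) \sum_(S : {set 'I_(size xs)}) insterm K H p S.
Proof. by []. Qed.

Lemma sum_set0 (V : nmodType) (F : {set 'I_0} -> V) : \sum_S F S = F set0.
Proof.
rewrite (bigD1 set0) //= big1 ?addr0 // => S /eqP[]; apply/setP => -[] //.
Qed.

Lemma sum_set1 (V : nmodType) (F : {set 'I_1} -> V) : \sum_S F S = F set0 + F setT.
Proof.
rewrite (bigD1 set0) //= (bigD1 setT) //=; last first.
  by apply/eqP => /setP/(_ ord0); rewrite !inE.
rewrite big1 ?addr0 // => S /andP[S0 S1].
case: (boolP (ord0 \in S)) => h.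
  by case/eqP: S1; apply/setP => t; rewrite (ord1 t) inE h.
by case/eqP: S0; apply/setP => t; rewrite (ord1 t) inE (negPf h).
Qed.

Lemma ord2P (t : 'I_2) : t = ord0 \/ t = ord_max.
Proof. by case: t => -[|[|//]] lt; [left|right]; apply: val_inj. Qed.

Lemma sum_set2 (V : nmodType) (F : {set 'I_2} -> V) :
  \sum_S F S = F set0 + F [set ord0] + F [set ord_max] + F setT.
Proof.
have neq (S T : {set 'I_2}) t : (t \in S) != (t \in T) -> S != T.
  by apply: contra_neq => ->.
rewrite (bigD1 set0) //= (bigD1 [set ord0]) //=; last first.
  by apply: (neq _ _ ord0); rewrite !inE.
rewrite (bigD1 [set ord_max]) //=; last first.
  by rewrite (neq _ _ ord_max) ?(neq [set ord_max] [set ord0] ord0) // !inE.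
rewrite (bigD1 setT) //=; last first.
  rewrite (neq setT set0 ord0) ?(neq setT [set ord0] ord_max) ?(neq setT [set ord_max] ord0) //;
  by rewrite !inE.
rewrite big1 ?addr0 ?addrA // => S /andP[/andP[/andP[h0 h1] h2] h3].
case: (boolP (ord0 \in S)) => i0; case: (boolP (ord_max \in S)) => i1.
- by case/eqP: h3; apply/setP => t; case: (ord2P t) => ->; rewrite inE ?i0 ?i1.
- by case/eqP: h1; apply/setP => t; case: (ord2P t) => ->; rewrite inE ?i0 ?(negPf i1).
- by case/eqP: h2; apply/setP => t; case: (ord2P t) => ->; rewrite inE ?(negPf i0) ?i1.
by case/eqP: h0; apply/setP => t; case: (ord2P t) => ->; rewrite inE ?(negPf i0) ?(negPf i1).
Qed.

Lemma sum_ffun0 (V : nmodType) (T : finType) (F : {ffun 'I_0 -> T} -> V) (f0 : {ffun 'I_0 -> T}) :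
  \sum_f F f = F f0.
Proof.
rewrite (bigD1 f0) //= big1 ?addr0 // => f /eqP[]; apply/ffunP => -[] //.
Qed.

Lemma sum_ffun1 (V : nmodType) (T : finType) (F : {ffun 'I_1 -> T} -> V) :
  \sum_f F f = \sum_q F [ffun=> q].
Proof.
rewrite (reindex (fun q : T => [ffun=> q] : {ffun 'I_1 -> T})) //.
exists (fun f : {ffun 'I_1 -> T} => f ord0) => [q _|f _]; first by rewrite ffunE.
by apply/ffunP => t; rewrite ffunE (ord1 t).
Qed.

Lemma sum_ffun2 (V : nmodType) (T : finType) (F : {ffun 'I_2 -> T} -> V) :
  \sum_f F f = \sum_p \sum_q F [ffun t : 'I_2 => if t == ord0 then p else q].
Proof.
rewrite pair_big /= (reindex (fun pq : T * T =>
  [ffun t : 'I_2 => if t == ord0 then pq.1 else pq.2] : {ffun 'I_2 -> T})) //.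
exists (fun f : {ffun 'I_2 -> T} => (f ord0, f ord_max)) => [[p q] _|f _]; first by rewrite !ffunE.
by apply/ffunP => t; rewrite ffunE; case: (ord2P t) => ->.
Qed.

Lemma enum_setTE k : enum [set: 'I_k] = enum 'I_k.
Proof. exact/eq_enum/in_setT. Qed.

Lemma enum_setT0 : enum [set: 'I_0] = [::].
Proof. by apply: size0nil; rewrite -cardE cardsT card_ord. Qed.

Lemma enum_setT1 : enum [set: 'I_1] = [:: ord0].
Proof. by rewrite enum_setTE enum_ordSl -enum_setTE enum_setT0. Qed.

Lemma enum_setT2 : enum [set: 'I_2] = [:: ord0; ord_max].
Proof.
rewrite enum_setTE !enum_ordSl -enum_setTE enum_setT0 /=; congr [:: _; _].
exact: val_inj.
Qed.

Lemma insertion0 K H : insertion K H [::] = H [:: K [::]].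
Proof.
rewrite insertionE (sum_ffun0 _ [ffun=> ord0]) (@sum_set0 _ (@insterm K H [::] _)) /insterm.
by rewrite big_set0 expr0 scale1r setC0 enum_set0 enum_setT0.
Qed.

Lemma insertion1 K H X : insertion K H [:: X] =
  \sum_(p < r.+1) (H [:: K [::]; component p X] + H [:: K [:: component p X]]).
Proof.
rewrite insertionE (@sum_ffun1 _ _ _); apply: eq_bigr => p _.
rewrite (@sum_set1 _ (@insterm K H [:: X] _)) /insterm; congr (_ + _).
  by rewrite big_set0 expr0 scale1r setC0 enum_set0 enum_setT1 /= ffunE.
rewrite big1 ?expr0 ?scale1r ?setCT ?enum_set0 ?enum_setT1 /= ?ffunE // => t _.
by rewrite big1 // => u /andP[]; rewrite !inE.
Qed.

Lemma insertion2 K H X Y : insertion K H [:: X; Y] =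
  \sum_(p < r.+1) \sum_(q < r.+1)
    (H [:: K [::]; component p X; component q Y]
     + H [:: K [:: component p X]; component q Y]
     + (-1) ^+ (p * q) *: H [:: K [:: component q Y]; component p X]
     + H [:: K [:: component p X; component q Y]]).
Proof.
rewrite insertionE (@sum_ffun2 _ _ _); apply: eq_bigr => p _; apply: eq_bigr => q _.
have C0 : ~: [set ord0] = [set ord_max] :> {set 'I_2}.
  by apply/setP => t; case: (ord2P t) => ->; rewrite !inE.
have C1 : ~: [set ord_max] = [set ord0] :> {set 'I_2}.
  by apply/setP => t; case: (ord2P t) => ->; rewrite !inE.
rewrite (@sum_set2 _ (@insterm K H [:: X; Y] _)) /insterm; congr (_ + _ + _ + _).
- by rewrite big_set0 expr0 scale1r setC0 enum_set0 enum_setT2 /= !ffunE.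
- rewrite big_set1 C0 big_mkcondr big_set1 /= expr0 scale1r !enum_set1 /= !ffunE.
  by [].
- rewrite big_set1 C1 big_mkcondr big_set1 /= !enum_set1 /= !ffunE.
  by [].
rewrite big1 ?expr0 ?scale1r ?setCT ?enum_set0 ?enum_setT2 /= ?ffunE // => t _.
by rewrite big1 // => u /andP[]; rewrite !inE.
Qed.

End SmallInsertions.

(** * Brackets with a constant and a linear map *)

Section SmallForms.
Variables (R : realType) (n : nat) (M : manifold R n) (r : nat).
Implicit Types (K H : vform M r) (X Y P : fam M r) (xs : seq (fam M r)).

Lemma insertion_eq0 K H xs :
  (forall ys zs, (size ys + size zs = size xs)%N -> H (K ys :: zs) = 0) ->
  insertion K H xs = 0.
Proof.
move=> h; rewrite insertionE big1 // => p _; rewrite big1 // => S _.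
rewrite /insterm h ?scaler0 // !size_map -!cardE.
by rewrite finset.cardsC card_ord.
Qed.

(** A constant and a linear map: both j and k are of this kind. *)
Definition jform P f : vform M r := vform0 P + vform1 f.

Lemma jform_nil P f : jform P f [::] = P.
Proof. exact: addr0. Qed.

Lemma jform_one P f X : jform P f [:: X] = f X.
Proof. exact: add0r. Qed.

Lemma jform_big P f xs : (1 < size xs)%N -> jform P f xs = 0.
Proof. by case: xs => [|X [|Y xs]] // _; apply: addr0. Qed.

Lemma vform1_jform f : vform1 f = jform 0 f.
Proof. by apply/funext => -[|X [|Y xs]]; rewrite /jform [RHS]add0r. Qed.

Lemma component0 p : component p (0 : fam M r) = 0.
Proof. by apply/funext => i; apply/funext => x; apply/funext => q; exact: linear0. Qed.

(** A form with at most two arguments which vanishes as soon as one of them does: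
    brackets with [jform] stay in this class and have few terms. *)
Record small H : Prop := Small {
  small_nil : H [::] = 0;
  small_one : H [:: 0] = 0;
  small_left : forall X, H [:: 0; X] = 0;
  small_right : forall X, H [:: X; 0] = 0;
  small_big : forall xs, (2 < size xs)%N -> H xs = 0 }.

Section BracketJ.
Variables (P : fam M r) (f : fam M r -> fam M r) (H : vform M r).
Hypothesis f0 : f 0 = 0.
Hypothesis sH : small H.
Local Notation J := (jform P f).

Let vbE xs : vbracket 0 1 J H xs = insertion J H xs - insertion H J xs.
Proof. by rewrite /vbracket mul0r expr0 scale1r. Qed.

Lemma vbracket_nil : vbracket 0 1 J H [::] = H [:: P].
Proof. by rewrite vbE !insertion0 jform_one jform_nil small_nil // f0 subr0. Qed.

Lemma vbracket_one X : vbracket 0 1 J H [:: X] =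
  \sum_(p < r.+1) (H [:: P; component p X] + H [:: f (component p X)]
                   - f (H [:: component p X])).
Proof.
rewrite vbE !insertion1 -sumrB; apply: eq_bigr => p _.
by rewrite jform_nil !jform_one (jform_big P f (xs := [:: _; _]) isT) add0r.
Qed.

Lemma vbracket_two X Y : vbracket 0 1 J H [:: X; Y] =
  \sum_(p < r.+1) \sum_(q < r.+1)
    (H [:: f (component p X); component q Y]
     + (-1) ^+ (p * q) *: H [:: f (component q Y); component p X]
     - f (H [:: component p X; component q Y])).
Proof.
rewrite vbE !insertion2 -sumrB; apply: eq_bigr => p _.
rewrite -sumrB; apply: eq_bigr => q _.
rewrite (small_big sH (xs := [:: _; _; _]) isT) add0r !jform_one.
rewrite !(jform_big P f (xs := [:: _; _]) isT) (small_one sH) addr0.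
by rewrite (jform_big P f (xs := [:: _; _; _]) isT) scaler0 !add0r.
Qed.

Lemma vbracket_big xs : (2 < size xs)%N -> vbracket 0 1 J H xs = 0.
Proof.
move=> sx; rewrite vbE !insertion_eq0 ?subr0 // => ys zs e.
  case: zs e => [|Z zs]; last first.
    by move=> _; apply: jform_big.
  by rewrite addn0 => e; rewrite (small_big sH) ?e // jform_one.
case: (leqP (size ys) 1) => sy; last first.
  rewrite jform_big //; case: zs e => [|Z [|Z' zs]] _; first exact: small_one sH.
    exact: small_left.
  exact: small_big.
by apply: (small_big sH) => //=; lia.
Qed.

Lemma small_vbracket : H [:: P] = 0 -> small (vbracket 0 1 J H).
Proof.
move=> hP; split; last exact: vbracket_big.
- by rewrite vbracket_nil.
- rewrite vbracket_one big1 // => p _.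
  by rewrite component0 f0 !(small_one sH) (small_right sH) f0 subr0 addr0.
- move=> X; rewrite vbracket_two big1 // => p _; rewrite big1 // => q _.
  by rewrite component0 f0 !(small_left sH) !(small_right sH) f0 scaler0 subr0 addr0.
move=> X; rewrite vbracket_two big1 // => p _; rewrite big1 // => q _.
by rewrite component0 f0 !(small_right sH) !(small_left sH) f0 scaler0 subr0 addr0.
Qed.

End BracketJ.

Lemma bracket0r F : bracket F 0 = 0 :> fam M r.
Proof.
apply/funext => i; apply/funext => x; apply/funext => p; rewrite bracketE.
rewrite !big1 ?addr0 // => [a _|c _].
  by rewrite -[(0 : fam M r) i x p]/0 !linear0 addr0.
by rewrite !gd_cst !wedge0r subr0.
Qed.

Lemma bracket0l F : bracket 0 F = 0 :> fam M r.
Proof.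
apply/funext => i; apply/funext => x; apply/funext => p; rewrite bracketE.
rewrite !big1 ?addr0 // => [a _|c _].
  by rewrite -[(0 : fam M r) i x p]/0 !linear0 !wedge0l addr0.
by rewrite !gd_cst !wedge0l subr0.
Qed.

Lemma small_l2 mu : small (l2 mu).
Proof.
split=> [|||X|] //=; first by move=> X; rewrite !bracket0r bracket0l.
  exact: bracket0r.
by case=> [|X [|Y [|Z xs]]].
Qed.

Lemma vbracket00 P f g xs : f 0 = 0 -> g 0 = 0 ->
  (forall p X, (p < r.+1)%N -> g (f (component p X)) = f (g (component p X))) ->
  vbracket 0 0 (jform P f) (jform 0 g) xs = if xs is [::] then g P else 0.
Proof.
move=> f0 g0 fg; rewrite /vbracket mul0r expr0 scale1r.
case: xs => [|X [|Y xs]].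
- by rewrite !insertion0 !jform_one !jform_nil f0 subr0.
- rewrite !insertion1 -sumrB big1 // => p _.
  rewrite !jform_one (jform_big 0 g (xs := [:: _; _])) //.
  by rewrite (jform_big P f (xs := [:: _; _])) // !add0r (fg _ _ (ltn_ord p)) subrr.
rewrite !insertion_eq0 ?subr0 // => ys [|Z zs] e; do ?exact: jform_big.
  by rewrite (jform_big 0 g) ?jform_one //; rewrite addn0 in e; rewrite e.
by rewrite (jform_big P f) ?jform_one //; rewrite addn0 in e; rewrite e.
Qed.

End SmallForms.

(** * Brackets of vector-valued forms on first jets *)

Section JetOperations.
Variables (R : realType) (n r : nat).
Local Notation jetfun := ('I_n -> grass R r).
Local Notation op := (grass R r -> jetfun -> grass R r -> jetfun -> grass R r).

(** Operations on first jets: bilinearity undoes the splitting of the arguments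
    into components in [insertion], and symmetry undoes its Koszul signs. *)
Definition jbilinear (E : op) :=
  (forall u du k v dv w dw, E u du (k *: v + w) (fun c => k *: dv c + dw c) =
     k *: E u du v dv + E u du w dw) /\
  (forall u du k v dv w dw, E (k *: v + w) (fun c => k *: dv c + dw c) u du =
     k *: E v dv u du + E w dw u du).

Definition jsymmetric (E : op) := forall p q u du v dv, hdeg p u -> hdeg q v ->
  (forall c, hdeg p (du c)) -> (forall c, hdeg q (dv c)) ->
  E u du v dv = (-1) ^+ (p * q) *: E v dv u du.

Lemma jbracket_bilinear rho s : jbilinear (@jbracket R n r rho s).
Proof. by split=> *; rewrite (jbracket_linear_l, jbracket_linear_r). Qed.

Lemma jact_linear B (dB : 'I_n -> 'M[R]_r) k v (dv : jetfun) w dw :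
  jact B dB (k *: v + w) (fun c => k *: dv c + dw c) =
  (fun c => k *: jact B dB v dv c + jact B dB w dw c).
Proof.
apply/funext => c; rewrite /jact !nactD !nactZ scalerDr.
by rewrite addrACA.
Qed.

Lemma jcommutator_bilinear B (dB : 'I_n -> 'M[R]_r) E : jbilinear E -> jbilinear (jcommutator B dB E).
Proof.
move=> [hr hl]; split=> u du k v dv w dw; rewrite /jcommutator !nactD !nactZ jact_linear.
  rewrite !hr !nactD !nactZ; gring.
by rewrite !hl !nactD !nactZ; gring.
Qed.

(** The unary part of the double bracket of u + N with a binary form E. *)
Definition jmixed B (dB : 'I_n -> 'M[R]_r) (E : op) : op := fun u du v dv =>
  E (nact B u) (jact B dB u du) v dv + 2 *: E u du (nact B v) (jact B dB v dv)
  - 2 *: nact B (E u du v dv).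

Lemma jmixed_bilinear B (dB : 'I_n -> 'M[R]_r) E : jbilinear E -> jbilinear (jmixed B dB E).
Proof.
move=> [hr hl]; split=> u du k v dv w dw; rewrite /jmixed !nactD !nactZ jact_linear.
  by rewrite !hr !nactD !nactZ; gring.
by rewrite !hl !nactD !nactZ; gring.
Qed.

Lemma jcommutator_symmetric B (dB : 'I_n -> 'M[R]_r) E :
  jsymmetric E -> jsymmetric (jcommutator B dB E).
Proof.
move=> hE p q u du v dv hu hv hdu hdv; rewrite /jcommutator.
have hBu : hdeg p (nact B u) by apply: hdeg_nact.
have hBv : hdeg q (nact B v) by apply: hdeg_nact.
have hju c : hdeg p (jact B dB u du c) by apply: hdeg_jact.
have hjv c : hdeg q (jact B dB v dv c) by apply: hdeg_jact.
rewrite (hE p q (nact B u)) // (hE p q u du (nact B v)) // (hE p q u du v) //.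
by rewrite nactZ !scalerDr scalerN; congr (_ - _); rewrite addrC.
Qed.

Section Sums.
Variable E : op.
Hypothesis hE : jbilinear E.

Lemma jbil0r u du : E u du 0 (fun=> 0) = 0.
Proof.
have [h _] := hE; have := h u du (-1) 0 (fun=> 0) 0 (fun=> 0).
have -> : (fun c : 'I_n => -1 *: 0 + 0 : grass R r) = fun=> 0.
  by apply/funext => c; rewrite scaler0 addr0.
by rewrite scaler0 addr0 scaleN1r addNr.
Qed.

Lemma jbil0l u du : E 0 (fun=> 0) u du = 0.
Proof.
have [_ h] := hE; have := h u du (-1) 0 (fun=> 0) 0 (fun=> 0).
have -> : (fun c : 'I_n => -1 *: 0 + 0 : grass R r) = fun=> 0.
  by apply/funext => c; rewrite scaler0 addr0.
by rewrite scaler0 addr0 scaleN1r addNr.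
Qed.

Lemma jbil_sumr u du I (e : seq I) v (dv : I -> jetfun) :
  E u du (\sum_(t <- e) v t) (fun c => \sum_(t <- e) dv t c) =
  \sum_(t <- e) E u du (v t) (dv t).
Proof.
have [h _] := hE; elim: e => [|t e IH].
  have -> : (fun c => \sum_(t <- [::]) dv t c) = fun=> 0 by apply/funext => c; rewrite big_nil.
  by rewrite !big_nil jbil0r.
rewrite !big_cons -IH.
have -> : (fun c => \sum_(t <- t :: e) dv t c) = fun c => 1 *: dv t c + \sum_(t <- e) dv t c.
  by apply/funext => c; rewrite big_cons scale1r.
by rewrite -{1}[v t]scale1r h scale1r.
Qed.

Lemma jbil_suml u du I (e : seq I) v (dv : I -> jetfun) :
  E (\sum_(t <- e) v t) (fun c => \sum_(t <- e) dv t c) u du =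
  \sum_(t <- e) E (v t) (dv t) u du.
Proof.
have [_ h] := hE; elim: e => [|t e IH].
  have -> : (fun c => \sum_(t <- [::]) dv t c) = fun=> 0 by apply/funext => c; rewrite big_nil.
  by rewrite !big_nil jbil0l.
rewrite !big_cons -IH.
have -> : (fun c => \sum_(t <- t :: e) dv t c) = fun c => 1 *: dv t c + \sum_(t <- e) dv t c.
  by apply/funext => c; rewrite big_cons scale1r.
by rewrite -{1}[v t]scale1r h scale1r.
Qed.

Lemma jbilZl k u du v dv : E (k *: u) (fun c => k *: du c) v dv = k *: E u du v dv.
Proof.
have [_ h] := hE; rewrite -[RHS]addr0 -(jbil0l v dv) -h addr0.
by congr (E _ _ _ _); apply/funext => c; rewrite addr0.
Qed.

Lemma jbilZr k u du v dv : E u du (k *: v) (fun c => k *: dv c) = k *: E u du v dv.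
Proof.
have [h _] := hE; rewrite -[RHS]addr0 -(jbil0r u du) -h addr0.
by congr (E _ _ _ _); apply/funext => c; rewrite addr0.
Qed.

Lemma jbil_gproj_r u du v dv : thonly v -> (forall c, thonly (dv c)) ->
  \sum_(q < r.+1) E u du (gproj q v) (fun c => gproj q (dv c)) = E u du v dv.
Proof.
move=> tv tdv; rewrite -jbil_sumr sum_gproj //; congr (E _ _ _ _).
by apply/funext => c; rewrite sum_gproj.
Qed.

Lemma jbil_gproj_l u du v dv : thonly v -> (forall c, thonly (dv c)) ->
  \sum_(q < r.+1) E (gproj q v) (fun c => gproj q (dv c)) u du = E v dv u du.
Proof.
move=> tv tdv; rewrite -jbil_suml sum_gproj //; congr (E _ _ _ _).
by apply/funext => c; rewrite sum_gproj.
Qed.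

End Sums.
End JetOperations.

Section JetForms.
Variables (R : realType) (n : nat) (M : manifold R n) (r : nat) (A : vbundle M r).
Implicit Types (K H : vform M r) (X Y P : fam M r) (xs : seq (fam M r)).
Variables (N : tensor11 M r).
Hypothesis hN : is_tensor11 A N.
Variables (i : chart_index M) (x : 'rV[R]_n).
Hypothesis cx : cod i x.

(** The binary part of H at the point depends on first jets only, through E.  This
    description passes to brackets without differentiating any value of H. *)
Definition jet2 H E := forall X Y p, nice X -> nice Y ->
  H [:: X; Y] i x p = E (val X i x) (der X i x) (val Y i x) (der Y i x).

Lemma val_component k X : val (component k X) i x = gproj k (val X i x).
Proof. by []. Qed.

Lemma der_componentE k X : nice X ->
  der (component k X) i x = fun c => gproj k (der X i x c).
Proof. by move=> nX; apply/funext => c; apply: der_component. Qed.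

Lemma act0 : act N 0 = 0.
Proof.
apply/funext => j; apply/funext => y; apply/funext => q; rewrite actE.
by rewrite -[(0 : fam M r) j y q]/0 linear0.
Qed.

Lemma jet2_vbracket P H E : small H -> jet2 H E -> jbilinear E -> jsymmetric E ->
  jet2 (vbracket 0 1 (jform P (act N)) H)
       (jcommutator (N i x) (derN N i x) E).
Proof.
move=> sH hH bE sE X Y p nX nY.
have bC := jcommutator_bilinear (N i x) (derN N i x) bE.
rewrite vbracket_two // !fct_sumE.
rewrite -(jbil_gproj_l bC) //; try by [exact: thonly_val | move=> c; exact: thonly_der].
apply: eq_bigr => k _; rewrite !fct_sumE.
rewrite -(jbil_gproj_r bC) //; try by [exact: thonly_val | move=> c; exact: thonly_der].
apply: eq_bigr => l _; set Xk := component k X; set Yl := component l Y.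
have nXk : nice Xk by apply: nice_component.
have nYl : nice Yl by apply: nice_component.
rewrite -[LHS]/(H [:: act N Xk; Yl] i x p
  + (-1) ^+ (k * l) *: H [:: act N Yl; Xk] i x p - act N (H [:: Xk; Yl]) i x p).
rewrite actE !hH //; try by apply: (nice_act hN).
rewrite !(der_act hN) // !val_act -!val_component -!der_componentE // /jcommutator.
congr (_ + _ - _).
rewrite (sE k l (val Xk i x) _ (nact _ _)) //.
- exact: hdeg_gproj.
- by apply: hdeg_nact; exact: hdeg_gproj.
- by move=> c; rewrite der_componentE //; exact: hdeg_gproj.
move=> c; apply: hdeg_jact; first exact: hdeg_gproj.
by move=> d; rewrite der_componentE //; exact: hdeg_gproj.
Qed.

Variables (mu : fam M r) (rho : 'I_n -> 'rV[R]_r) (sg : grass R r).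
Hypothesis hmu : symbol mu i x rho sg.
Local Notation E := (jbracket rho (structure sg)).
Local Notation B := (N i x).
Local Notation dB := (derN N i x).

Lemma jbracket_symmetric : jsymmetric E.
Proof. by move=> p q u du v dv *; apply: jbracketC => // *; apply: structure_anti. Qed.

Lemma jet2_l2 : jet2 (l2 mu) E.
Proof. by move=> X Y p nX nY; apply: (l2_jet cx hmu p nX nY). Qed.

Variable P : fam M r.
Hypothesis nP : nice P.
Local Notation J := (jform P (act N)).

Lemma small_deform : small (vbracket 0 1 J (l2 mu)).
Proof. by apply: small_vbracket; [exact: act0 | exact: small_l2 |]. Qed.

Lemma deform_one X p : nice X -> vbracket 0 1 J (l2 mu) [:: X] i x p =
  E (val P i x) (der P i x) (val X i x) (der X i x).
Proof.
move=> nX; rewrite vbracket_one !fct_sumE.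
rewrite -(jbil_gproj_r (jbracket_bilinear _ _)); try by [exact: thonly_val | move=> c; exact: thonly_der].
apply: eq_bigr => k _; rewrite -val_component -der_componentE //.
rewrite -(jet2_l2 p) //; last exact: nice_component.
rewrite -[LHS]/(l2 mu [:: P; component k X] i x p + 0 - act N 0 i x p).
by rewrite act0 subr0 addr0.
Qed.

Lemma jet2_deform : jet2 (vbracket 0 1 J (l2 mu)) (jcommutator B dB E).
Proof.
apply: jet2_vbracket; [exact: small_l2 | exact: jet2_l2 | exact: jbracket_bilinear|].
exact: jbracket_symmetric.
Qed.

Lemma jet2_deform2 :
  jet2 (vbracket 0 1 J (vbracket 0 1 J (l2 mu))) (jcommutator B dB (jcommutator B dB E)).
Proof.
apply: jet2_vbracket; [exact: small_deform | exact: jet2_deform | |].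
  exact/jcommutator_bilinear/jbracket_bilinear.
exact/jcommutator_symmetric/jbracket_symmetric.
Qed.

Lemma deform2_nil p : vbracket 0 1 J (vbracket 0 1 J (l2 mu)) [::] i x p =
  E (val P i x) (der P i x) (val P i x) (der P i x).
Proof. by rewrite (vbracket_nil P act0 small_deform) deform_one. Qed.

Lemma deform2_one X p : nice X ->
  vbracket 0 1 J (vbracket 0 1 J (l2 mu)) [:: X] i x p =
    E (nact B (val P i x)) (jact B dB (val P i x) (der P i x)) (val X i x) (der X i x)
    + 2 *: E (val P i x) (der P i x) (nact B (val X i x)) (jact B dB (val X i x) (der X i x))
    - 2 *: nact B (E (val P i x) (der P i x) (val X i x) (der X i x)).
Proof.
move=> nX; rewrite vbracket_one !fct_sumE.
have bG := jmixed_bilinear B dB (jbracket_bilinear rho (structure sg)).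
rewrite -[RHS]/(jmixed _ _ _ _ _ _ _) -(jbil_gproj_r bG); try by [exact: thonly_val | move=> c; exact: thonly_der].
apply: eq_bigr => k _; rewrite -val_component -der_componentE //.
set Xk := component k X; have nXk : nice Xk by apply: nice_component.
rewrite -[LHS]/(vbracket 0 1 J (l2 mu) [:: P; Xk] i x p
  + vbracket 0 1 J (l2 mu) [:: act N Xk] i x p
  - act N (vbracket 0 1 J (l2 mu) [:: Xk]) i x p).
rewrite actE !deform_one //; last exact: (nice_act hN).
rewrite (jet2_deform p nP nXk) (der_act hN) // val_act /jcommutator /jmixed.
by gring.
Qed.

Lemma scaled_euler (lambda : R) k X : (k < r.+1)%N ->
  - lambda *: euler (component k X) = (- lambda * (k%:R - 2)) *: component k X.
Proof.
move=> lk; rewrite -scalerA; congr (_ *: _); rewrite /euler (bigD1 (Ordinal lk)) //=.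
rewrite big1 ?addr0 => [|q ne].
  congr (_ *: _); apply/funext => j; apply/funext => y; apply/funext => p.
  by apply/ffunP => S; rewrite !ffunE; case: eqP.
apply/funext => j; apply/funext => y; apply/funext => p.
apply/ffunP => S; rewrite grassZ !ffunE; case: eqP => [eq|_]; last by rewrite mulr0.
case: eqP => [ek|_]; last by rewrite mulr0.
by case/eqP: ne; apply: val_inj; rewrite /= -eq ek.
Qed.

End JetForms.

(** * Degrees of N and of the Euler map *)

Section Degrees.
Variables (R : realType) (n : nat) (M : manifold R n) (r : nat) (A : vbundle M r).
Implicit Types (X Y P F : fam M r) (xs : seq (fam M r)).

Section LocalForms.
Variables (i : chart_index M) (k l : nat).
Local Notation field := (chart_index M -> M -> 'rV[R]_n -> grass R r).

(** [isF] in one source chart, with an arbitrary finite index type so that sums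
    can be formed. *)
Definition local_form (f : field) := exists (I : finType)
    (c : I -> 'rV[R]_n -> R) (w : I -> seq (gen n r)),
  (forall t, smooth_on (cod i) (c t) /\ bideg (w t) = (k, l)) /\
  (forall j m p, dom i m -> dom j m ->
     f j m p = \sum_t c t (chart i m) *: eval_word (coord_change A i j m p) (w t)).

Lemma local_form_eq f g : (forall j m p, dom i m -> dom j m -> f j m p = g j m p) ->
  local_form f -> local_form g.
Proof.
move=> fg [I [c [w [h1 h2]]]]; exists I, c, w; split=> // j m p im jm.
by rewrite -fg // h2.
Qed.

Lemma local_form0 : local_form (fun _ _ _ => 0).
Proof.
exists void, (fun (t : void) _ => 0), (fun=> [::]); split; first by case.
by move=> j m p _ _; rewrite big1 //; case.
Qed.

Lemma local_formD f g : local_form f -> local_form g ->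
  local_form (fun j m p => f j m p + g j m p).
Proof.
move=> [I [c [w [h1 h2]]]] [I' [c' [w' [h1' h2']]]].
exists (I + I')%type, (fun t => match t with inl t => c t | inr t => c' t end),
  (fun t => match t with inl t => w t | inr t => w' t end); split.
  by case=> t.
by move=> j m p im jm; rewrite big_sumType h2 // h2'.
Qed.

Lemma local_formZ (a : 'rV[R]_n -> R) f : smooth_on (cod i) a -> local_form f ->
  local_form (fun j m p => a (chart i m) *: f j m p).
Proof.
move=> sa [I [c [w [h1 h2]]]]; exists I, (fun t x => a x * c t x), w; split.
  move=> t; have [sc bw] := h1 t; split=> // d.
  by apply: tdM => //; apply: cod_open.
move=> j m p im jm; rewrite h2 // scaler_sumr; apply: eq_bigr => t _.
by rewrite scalerA.
Qed.

Lemma local_form_sum I (s : seq I) (f : I -> field) :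
  (forall t, local_form (f t)) -> local_form (fun j m p => \sum_(t <- s) f t j m p).
Proof.
move=> h; elim: s => [|t s IH].
  by apply: local_form_eq local_form0 => j m p _ _; rewrite big_nil.
apply: local_form_eq (local_formD (h t) IH) => j m p _ _.
by rewrite big_cons.
Qed.

Lemma local_form_word w : bideg w = (k, l) ->
  local_form (fun j m p => eval_word (coord_change A i j m p) w).
Proof.
move=> bw; exists unit, (fun _ _ => 1), (fun=> w); split.
  by move=> _; split=> // d; apply: td_cst.
by move=> j m p _ _; rewrite big_const card_unit /= addr0 scale1r.
Qed.

End LocalForms.

Lemma isF_local_form k l F :
  isF A k l F <-> forall i, local_form i k l (fun j m p => F j (chart j m) p).
Proof.
split=> h i.
  have [s [c [w [h1 h2]]]] := h i.
  by exists 'I_s, c, w.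
have [I [c [w [h1 h2]]]] := h i.
exists #|I|, (fun t => c (enum_val t)), (fun t => w (enum_val t)); split=> [t|j m p im jm].
  exact: h1.
by rewrite h2 // big_enum_val.
Qed.

Lemma isF_feq k l F G : feq F G -> isF A k l F -> isF A k l G.
Proof.
move=> FG /isF_local_form h; apply/isF_local_form => i.
apply: local_form_eq (h i) => j m p _ jm; apply: FG.
exact: cod_dom.
Qed.

Lemma isF0 k l : isF A k l 0.
Proof. by apply/isF_local_form => i; apply: local_form0. Qed.

Lemma isFZ k l (u : R) F : isF A k l F -> isF A k l (u *: F).
Proof.
move=> /isF_local_form h; apply/isF_local_form => i.
apply: local_form_eq (local_formZ (a := fun=> u) _ (h i)) => // d; exact: td_cst.
Qed.

Section Tensor.
Variable N : tensor11 M r.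
Hypothesis hN : is_tensor11 A N.

(** N can be applied in either chart, by its equivariance; a word thus stays a
    combination of words, with entries of N as coefficients. *)
Lemma nact_coord_change i j m p b : dom i m -> dom j m ->
  nact (N j (chart j m)) (coord_change A i j m p (Gth n b)) =
  \sum_f N i (chart i m) f b *: coord_change A i j m p (Gth n f).
Proof.
move=> im jm; rewrite /coord_change nact_sum; set B := N j _; set T := trans A j i m.
have BT : B *m T = T *m N i (chart i m) by rewrite -(hN.2 i j m im jm).
transitivity (\sum_a T a b *: nact B (th R a)).
  by apply: eq_bigr => a _; apply: nactZ.
transitivity (\sum_e (B *m T) e b *: th R e).
  under eq_bigr do rewrite nact_th scaler_sumr.
  rewrite exchange_big; apply: eq_bigr => e _; rewrite mxE scaler_suml.
  by apply: eq_bigr => a _; rewrite scalerA mulrC.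
transitivity (\sum_f \sum_e N i (chart i m) f b *: (T e f *: th R e)); last first.
  by apply: eq_bigr => f _; rewrite -scaler_sumr.
rewrite exchange_big BT; apply: eq_bigr => e _; rewrite mxE scaler_suml.
by apply: eq_bigr => f _; rewrite scalerA mulrC.
Qed.

Lemma local_form_th i k b f : local_form i k 0 f ->
  local_form i k.+1 0 (fun j m p => wedge (coord_change A i j m p (Gth n b)) (f j m p)).
Proof.
move=> [I [c [w [h1 h2]]]]; exists I, c, (fun t => Gth n b :: w t); split=> [t|j m p im jm].
  have [sc bw] := h1 t; split=> //.
  by rewrite bideg_cons bw.
by rewrite h2 // wedge_sumr; apply: eq_bigr => t _; rewrite wedgeZr.
Qed.

Lemma local_form_nact_word i k w : bideg w = (k, 0)%N ->
  local_form i k 0 (fun j m p =>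
    nact (N j (chart j m)) (eval_word (coord_change A i j m p) w)).
Proof.
elim: w k => [|g w IH] k; first by move=> _; apply: local_form_eq (local_form0 _ _ _)
  => j m p _ _; rewrite nact_hdeg0 //; apply: hdeg_one.
rewrite bideg_cons => -[]; case: g => [c|b|b] <- // w2.
have ew : bideg w = ((bideg w).1, 0)%N by rewrite [LHS]surjective_pairing -w2.
apply: (@local_form_eq _ _ _ (fun j m p =>
  \sum_f N i (chart i m) f b *: wedge (coord_change A i j m p (Gth n f))
                                   (eval_word (coord_change A i j m p) w)
  + wedge (coord_change A i j m p (Gth n b))
      (nact (N j (chart j m)) (eval_word (coord_change A i j m p) w)))).
  move=> j m p im jm; have -> : eval_word (coord_change A i j m p) (Gth n b :: w) = wedge
    (coord_change A i j m p (Gth n b)) (eval_word (coord_change A i j m p) w) by [].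
  rewrite nact_wedge.
  rewrite (nact_coord_change p b im jm) [in RHS]wedge_suml; congr (_ + _).
  by apply: eq_bigr => f _; rewrite wedgeZl.
rewrite -[(_ + _)%N]/((bideg w).1.+1).
apply: local_formD; last exact/local_form_th/IH.
apply: local_form_sum => f; apply: (local_formZ (a := fun x => N i x f b)).
  exact: hN.1.
exact/local_form_th/local_form_word.
Qed.

Lemma isF_act k F : isF A k 0 F -> isF A k 0 (act N F).
Proof.
move=> hF; apply/isF_local_form => i; have [s [c [w [h1 h2]]]] := hF i.
apply: (@local_form_eq _ _ _ (fun j m p => \sum_(t < s) c t (chart i m) *:
    nact (N j (chart j m)) (eval_word (coord_change A i j m p) (w t)))).
  move=> j m p im jm; rewrite actE h2 // nact_sum.
  by apply: eq_bigr => t _; rewrite nactZ.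
apply: local_form_sum => t; have [sc bw] := h1 t.
exact/local_formZ/local_form_nact_word.
Qed.

End Tensor.

Lemma euler_hdeg k F i x p : thonly (F i x p) -> hdeg k (F i x p) ->
  euler F i x p = (k%:R - 2) *: F i x p.
Proof.
move=> tF hF; rewrite /euler !fct_sumE.
transitivity (\sum_(q < r.+1) (q%:R - 2 : R) *: (if q == k :> nat then F i x p else 0)).
  by apply: eq_bigr => q _; rewrite -(gproj_hdeg q hF).
case: (ltnP k r.+1) => [lk|lk].
  rewrite (bigD1 (Ordinal lk)) //= eqxx big1 ?addr0 // => q ne.
  by rewrite ifN ?scaler0.
rewrite big1 => [|q _]; first by rewrite (thonly_hdeg_gt tF hF) ?scaler0.
by rewrite ifN ?scaler0 // neq_ltn (leq_trans (ltn_ord q)).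
Qed.

Lemma isF_euler k F : isF A k 0 F -> isF A k 0 (euler F).
Proof.
move=> hF; apply: isF_feq (isFZ (k%:R - 2) hF) => i x p cx.
have [e _ tF] := isF_nice hF cx; have hk := isF_hdeg hF cx.
by rewrite (@euler_hdeg k) // e.
Qed.

Lemma feqZ (u : R) F G : feq F G -> feq (u *: F) (u *: G).
Proof. by move=> e i x p cx; rewrite -[LHS]/(u *: F i x p) e. Qed.

Lemma act_feq N F G : feq F G -> feq (act N F) (act N G).
Proof. by move=> e i x p cx; rewrite !actE e. Qed.

Lemma act_linear N u F G : act N (u *: F + G) = u *: act N F + act N G.
Proof.
apply/funext => i; apply/funext => x; apply/funext => p.
by rewrite -[RHS]/(u *: act N F i x p + act N G i x p) !actE -nactZ -nactD.
Qed.

Lemma component_linear k u F G :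
  component k (u *: F + G) = u *: component k F + component k G :> fam M r.
Proof.
apply/funext => i; apply/funext => x; apply/funext => p.
exact: (linearP (@gproj R r k)).
Qed.

Lemma euler_linear u F G : euler (u *: F + G) = u *: euler F + euler G :> fam M r.
Proof.
rewrite /euler scaler_sumr -big_split; apply: eq_bigr => k _ /=.
by rewrite component_linear scalerDr !scalerA mulrC.
Qed.

Lemma euler_feq F G : feq F G -> feq (euler F) (euler G).
Proof.
move=> e i x p cx; rewrite /euler !fct_sumE; apply: eq_bigr => k _.
by rewrite -[LHS]/(_ *: gproj k (F i x p)) e.
Qed.

Lemma in_degree_pres (f : fam M r -> fam M r) : f 0 = 0 ->
  (forall F G, feq F G -> feq (f F) (f G)) ->
  (forall k F, isF A k 0 F -> isF A k 0 (f F)) ->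
  forall d F, in_degree A d F -> in_degree A d (f F).
Proof.
move=> f0 fe fF d F; rewrite /in_degree; case: (d + 2) => k; first exact: fF.
by rewrite -{2}f0; apply: fe.
Qed.

Lemma in_degree0 d : in_degree A d 0.
Proof. by rewrite /in_degree; case: (d + 2) => // k; apply: isF0. Qed.

(** Symmetry is void: with two arguments every value is zero. *)
Lemma is_vform_jform P f : isF A 2 0 P ->
  (forall u F G, f (u *: F + G) = u *: f F + f G) ->
  (forall F G, feq F G -> feq (f F) (f G)) ->
  (forall k F, isF A k 0 F -> isF A k 0 (f F)) ->
  is_vform A 0 (jform P f).
Proof.
move=> hP fl fe fF.
have f0 : f 0 = 0.
  by have := fl (-1) 0 0; rewrite scaler0 addr0 scaleN1r addNr.
have big2 s1 X Y s2 : jform P f (s1 ++ X :: Y :: s2) = 0.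
  by apply: jform_big; rewrite size_cat /=; lia.
split.
- move=> s1 X Y s2 _ _ _ _ XY; case: (ltnP 0 (size s1 + size s2)) => h.
    by rewrite !jform_big // size_cat /=; lia.
  have [/size0nil -> /size0nil ->] : size s1 = 0%N /\ size s2 = 0%N by lia.
  by rewrite !jform_one; apply: fe.
- move=> s1 X Y s2 u _ _ _ _; case: (ltnP 0 (size s1 + size s2)) => h.
    by rewrite !jform_big ?scaler0 ?addr0 // size_cat /=; lia.
  have [/size0nil -> /size0nil ->] : size s1 = 0%N /\ size s2 = 0%N by lia.
  by rewrite !jform_one fl.
- by move=> s1 X Y s2 d e _ _ _ _; rewrite !big2 scaler0.
move=> ds xs; case: xs => [|X [|Y xs]]; last by move=> *; rewrite jform_big //; apply: in_degree0.
  by case: ds => // _ _; rewrite big_nil addr0 jform_nil.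
case: ds => [|d [|e ds]] //= _ h; rewrite big_cons big_nil !addr0 jform_one.
exact: (in_degree_pres f0 fe fF (h 0%N isT)).
Qed.

End Degrees.

(** * The bracket of the Euler map with l2 *)

Section EulerBracket.
Variables (R : realType) (n : nat) (M : manifold R n) (r : nat) (A : vbundle M r).
Implicit Types (X Y P F : fam M r) (xs : seq (fam M r)).
Variables (mu : fam M r) (lambda : R).
Local Notation K := (jform 0 (fun F : fam M r => - lambda *: euler F)).

Lemma scaled_euler_linear u F G : - lambda *: euler (u *: F + G) =
  u *: (- lambda *: euler F) + - lambda *: euler G :> fam M r.
Proof. by rewrite euler_linear scalerDr !scalerA mulrC. Qed.

Lemma scaled_euler0 : - lambda *: euler (0 : fam M r) = 0.
Proof.
have := scaled_euler_linear (-1) 0 0.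
by rewrite scaler0 addr0 [X in _ = X + _]scaleN1r addNr.
Qed.

Lemma euler_bracket_small xs : size xs != 2 -> vbracket 0 1 K (l2 mu) xs = 0.
Proof.
have f0 := scaled_euler0; case: xs => [|X [|Y [|Z xs]]] // _.
- by rewrite (@vbracket_nil _ _ _ _ _ _ _ f0 (small_l2 mu)).
- rewrite vbracket_one big1 // => k _.
  by rewrite (small_left (small_l2 mu)) f0 subr0 addr0.
by rewrite (@vbracket_big _ _ _ _ _ _ _ f0 (small_l2 mu)).
Qed.

Variables (i : chart_index M) (x : 'rV[R]_n).
Variables (rho : 'I_n -> 'rV[R]_r) (sg : grass R r).
Hypothesis cx : cod i x.
Hypothesis hmu : symbol mu i x rho sg.
Local Notation E := (jbracket rho (structure sg)).

(** l2 has degree one: (p + q - 1 - 2) - (p - 2) - (q - 2) = 1 for arguments in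
    the exterior powers p and q.  The predecessor of p + q is truncated when
    p = q = 0, but then l2 is zero. *)
Lemma jet2_euler : jet2 i x (vbracket 0 1 K (l2 mu))
  (fun u du v dv => lambda *: E u du v dv).
Proof.
move=> X Y p nX nY; have bE := jbracket_bilinear rho (structure sg).
rewrite (vbracket_two _ _ (small_l2 mu)) !fct_sumE.
rewrite -(jbil_gproj_l bE) ?[RHS]scaler_sumr; try by [exact: thonly_val | move=> c; exact: thonly_der].
apply: eq_bigr => k _; rewrite !fct_sumE.
rewrite -(jbil_gproj_r bE) ?[RHS]scaler_sumr; try by [exact: thonly_val | move=> c; exact: thonly_der].
apply: eq_bigr => l _; rewrite !scaled_euler //.
rewrite -!val_component -!(der_componentE cx) //.
set Xk := component k X; set Yl := component l Y.
have nXk : nice Xk by apply: nice_component.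
have nYl : nice Yl by apply: nice_component.
have hX : hdeg k (val Xk i x) by apply: hdeg_gproj.
have hY : hdeg l (val Yl i x) by apply: hdeg_gproj.
have hdX c : hdeg k (der Xk i x c) by rewrite (der_componentE cx) //; apply: hdeg_gproj.
have hdY c : hdeg l (der Yl i x c) by rewrite (der_componentE cx) //; apply: hdeg_gproj.
have tX := thonly_val nXk cx; have tY := thonly_val nYl cx.
have tdX c := thonly_der c nXk cx; have tdY c := thonly_der c nYl cx.
have e2 := jet2_l2 cx hmu.
transitivity (l2 mu [:: (- lambda * (k%:R - 2)) *: Xk; Yl] i x p
  + (-1) ^+ (k * l) *: l2 mu [:: (- lambda * (l%:R - 2)) *: Yl; Xk] i x p
  - (- lambda *: euler (l2 mu [:: Xk; Yl]) i x p)); first by [].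
have eE := e2 _ _ p nXk nYl.
have hE : hdeg (k + l).-1 (l2 mu [:: Xk; Yl] i x p) by rewrite eE; apply: hdeg_jbracket.
have tE : thonly (l2 mu [:: Xk; Yl] i x p) by rewrite eE; apply: thonly_jbracket.
rewrite (euler_hdeg tE hE) eE !e2 //; try exact: nice_scale.
rewrite !der_scale // -[val (_ *: Xk) i x]/(_ *: val Xk i x).
rewrite -[val (_ *: Yl) i x]/(_ *: val Yl i x) !(jbilZl bE).
have sE := @jbracket_symmetric _ _ _ rho sg _ _ _ _ _ _ hX hY hdX hdY.
have swap (b : R) (u v : grass R r) : u = (-1) ^+ (k * l) *: v ->
  (-1) ^+ (k * l) *: (b *: v) = b *: u by move=> ->; rewrite !scalerA mulrC.
rewrite (swap _ _ _ sE).
case: (posnP (k + l)%N) => kl.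
  move: hX hY; have [-> ->] : k = 0%N :> nat /\ l = 0%N :> nat by lia.
  by move=> hX hY; rewrite jbracket_hdeg0 // !scaler0 !addr0 subrr.
have -> : ((k + l).-1%:R : R) = k%:R + l%:R - 1.
  by rewrite -natrD; case: (k + l)%N kl => // m _; rewrite -[m.+1]addn1 natrD addrK addn1.
rewrite !scalerA -scalerDl -scalerBl; congr (_ *: _); ring.
Qed.

End EulerBracket.

(** * The equivalence *)

Lemma torsion_algebra (R : realType) (r : nat) (B : 'M[R]_r) lambda (q u v w : grass R r) :
  nact B (nact B w) = lambda *: w ->
  lambda *: w + q - nact B u + (q + lambda *: w - nact B v)
    - nact B (u + v - nact B w) - lambda *: w
  = 2 *: (q - nact B (u + v - nact B w)).
Proof.
move=> hw; rewrite -[- nact B w]scaleN1r !nactD nactZ hw.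
move: (nact B u) (nact B v) => {hw}u {}v.
gring.
Qed.

Section Equivalence.
Variables (R : realType) (n : nat) (M : manifold R n) (r : nat) (A : vbundle M r).
Variables (mu pi : fam M r) (N : tensor11 M r) (lambda : R).
Hypothesis hmu : isF A 1 2 mu.
Hypothesis hpi : isF A 2 0 pi.
Hypothesis hN : is_tensor11 A N.
Hypothesis hcomp : compatible A pi N.
Hypothesis hN2 : forall i x, cod i x -> N i x *m N i x = lambda%:M.
Local Notation J := (jform (- 1 *: pi) (act N)).
Local Notation K := (jform 0 (fun F : fam M r => - lambda *: euler F)).
(* The two sides of the equation for the square of j. *)
Local Notation dd := (vbracket 0 1 J (vbracket 0 1 J (l2 mu))).
Local Notation kl := (vbracket 0 1 K (l2 mu)).

Let npi : nice pi. Proof. exact: isF_nice hpi. Qed.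
Let nNpi : nice (-1 *: pi). Proof. exact: nice_scale. Qed.
Let hp i x : cod i x -> hdeg 2 (val pi i x). Proof. by move=> cx; apply: isF_hdeg hpi cx. Qed.
Let hdp i x c : cod i x -> hdeg 2 (der pi i x c).
Proof. by move=> cx; apply: hdeg_der cx => y cy; apply: hp. Qed.
Let pcomp i x : cod i x -> forall v, iota (v *m N i x) (val pi i x) = nact (N i x) (iota v (val pi i x)).
Proof. by move=> cx v; apply: (compatible_jet hN npi hcomp cx). Qed.

Lemma section_inL X : is_section A X -> inL A X.
Proof.
(* The degree of a summand is its index. *)
move=> hX; exists 2, (fun t : 'I_2 => if t == ord0 then 0 else X); split.
  move=> [[|[|//]] lt]; first exact: isF0.
  exact: hX.
by move=> i x p _; rewrite !big_ord_recl big_ord0 /= add0r addr0.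
Qed.

Section Point.
Variables (i : chart_index M) (x : 'rV[R]_n).
Variables (rho : 'I_n -> 'rV[R]_r) (sg : grass R r).
Hypothesis cx : cod i x.
Hypothesis smu : symbol mu i x rho sg.
Local Notation E := (jbracket rho (structure sg)).
Local Notation B := (N i x).
Local Notation dB := (derN N i x).
Local Notation C := (mm_coef rho (structure sg) B dB (val pi i x) (der pi i x)).

Let hdpx c : hdeg 2 (der pi i x c). Proof. exact: hdp. Qed.

Lemma dd_nil p : dd [::] i x p = - bracket (bracket pi mu) pi i x p.
Proof.
rewrite (deform2_nil N cx smu nNpi) der_scale // -[val (_ *: _) i x]/(_ *: val pi i x).
have bE := jbracket_bilinear rho (structure sg).
rewrite (jbilZl bE) (jbilZr bE) scalerA mulrNN mulr1 scale1r.
by rewrite (schouten_jet cx smu p npi npi (hp cx) hdpx) expr1 scaleN1r opprK.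
Qed.

Lemma dd_one X p : nice X ->
  dd [:: X] i x p = - 2 *: \sum_b wedge (C b) (gder (th_idx b) (val X i x)).
Proof.
move=> nX; rewrite (deform2_one hN cx smu nNpi p nX) der_scale //.
have bG := jmixed_bilinear B dB (jbracket_bilinear rho (structure sg)).
transitivity (-1 *: jmixed B dB E (val pi i x) (der pi i x) (val X i x) (der X i x)).
  exact: (jbilZl bG).
rewrite /jmixed (jbracket_mm_coef rho (structure sg) dB (hp cx) hdpx (pcomp cx)) scalerA.
by congr (_ *: _); ring.
Qed.

Lemma kl_two X Y p : nice X -> nice Y -> kl [:: X; Y] i x p =
  lambda *: E (val X i x) (der X i x) (val Y i x) (der Y i x).
Proof. exact: (jet2_euler _ cx smu). Qed.

(** An identity over the whole chart, so that it also holds for derivatives. *)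
Lemma act_act X : is_section A X -> feq (act N (act N X)) (lambda *: X).
Proof.
move=> hX j y q cy; have nX := isF_nice hX; have hdX := isF_hdeg hX cy.
have [e _ tX] := nX j y cy.
rewrite !actE -[RHS]/(lambda *: X j y q) e (nact_nact1 _ _ tX hdX) hN2 //.
exact: nact_scalar1.
Qed.

Definition torsion X Y : fam M r := lie mu (act N X) (act N Y)
  - act N (lie mu (act N X) Y + lie mu X (act N Y) - act N (lie mu X Y)).

(** N applied twice to the same argument, and N^2 applied to the section l2(X, Y),
    give three times lambda l2(X, Y), one of which [k, l2] removes. *)
Lemma torsion_jet X Y p : is_section A X -> is_section A Y ->
  dd [:: X; Y] i x p - kl [:: X; Y] i x p = 2 *: torsion X Y i x p.
Proof.
move=> hX hY; have nX := isF_nice hX; have nY := isF_nice hY.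
have nNX := nice_act hN nX; have nNY := nice_act hN nY.
rewrite (jet2_deform2 hN cx smu (- 1 *: pi) p nX nY) kl_two //.
have hXx := isF_hdeg hX cx; have hYx := isF_hdeg hY cx.
have hdX c : hdeg 1 (der X i x c) by apply: hdeg_der cx => y cy; apply: isF_hdeg hX cy.
have hdY c : hdeg 1 (der Y i x c) by apply: hdeg_der cx => y cy; apply: isF_hdeg hY cy.
have lieE Z Z' : nice Z -> nice Z' -> hdeg 1 (val Z i x) -> (forall c, hdeg 1 (der Z i x c)) ->
    lie mu Z Z' i x p = E (val Z i x) (der Z i x) (val Z' i x) (der Z' i x).
  by move=> nZ nZ' hZ hdZ; rewrite /lie (schouten_jet cx smu p nZ nZ' hZ hdZ) expr0 scale1r.
have hNX : hdeg 1 (val (act N X) i x) by rewrite val_act; apply: hdeg_nact.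
have hdNX c : hdeg 1 (der (act N X) i x c).
  by rewrite (der_act hN nX cx); apply: hdeg_jact.
rewrite -[torsion X Y i x p]/(lie mu (act N X) (act N Y) i x p
  - act N (lie mu (act N X) Y + lie mu X (act N Y) - act N (lie mu X Y)) i x p).
rewrite [in RHS]actE -[(_ + _ - _) i x p]/(lie mu (act N X) Y i x p
  + lie mu X (act N Y) i x p - act N (lie mu X Y) i x p) [in RHS]actE !lieE //.
rewrite !(der_act hN) // !val_act.
have NN Z : is_section A Z -> nact B (nact B (val Z i x)) = lambda *: val Z i x /\
    jact B dB (nact B (val Z i x)) (jact B dB (val Z i x) (der Z i x))
      = (fun c => lambda *: der Z i x c).
  move=> hZ; have nZ := isF_nice hZ; have nNZ := nice_act hN nZ.
  have e := act_act hZ; split.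
    by rewrite -[RHS]/(val (lambda *: Z) i x) -(val_feq e cx) !val_act.
  by rewrite -(der_scale lambda nZ cx) -(der_feq e cx) !(der_act hN) // val_act.
have [XX dXX] := NN X hX; have [YY dYY] := NN Y hY.
have bE := jbracket_bilinear rho (structure sg).
rewrite /jcommutator XX dXX YY dYY !(jbilZl bE) !(jbilZr bE).
set w := E (val X i x) _ _ _; have hw : nact B (nact B w) = lambda *: w.
  rewrite nact_nact1 ?hN2 // ?nact_scalar1 //; try exact: (@hdeg_jbracket _ _ _ _ _ 1 1).
    by apply: thonly_jbracket => [||c|c]; do ?[exact: thonly_val | exact: thonly_der].
  by apply: thonly_jbracket => [||c|c]; do ?[exact: thonly_val | exact: thonly_der].
exact: torsion_algebra hw.
Qed.

End Point.

Lemma nil_poisson : feq (dd [::]) (kl [::]) <-> is_poisson mu pi.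
Proof.
rewrite euler_bracket_small //; split=> h i x p cx;
  have [rho [sg smu]] := symbol_exists hmu cx.
  have := h i x p cx; rewrite (dd_nil cx smu) -[(0 : fam M r) i x p]/0 => e.
  by apply: oppr_inj; rewrite e oppr0.
by rewrite (dd_nil cx smu) h // oppr0.
Qed.

(** Both conditions say that the bivectors [mm_coef] are zero: this is seen by testing
    the first on X with value th R b, the second on one-forms with values xi R a
    and xi R a', at a given point. *)
Lemma one_concomitant :
  (forall X, inL A X -> feq (dd [:: X]) (kl [:: X])) <-> concomitant_zero A mu pi N.
Proof.
split=> [h al be hal hbe i x p cx|h X hX i x p cx];
  have [rho [sg smu]] := symbol_exists hmu cx; last first.
  have nX := inL_nice hX.
  rewrite euler_bracket_small // (dd_one cx smu p nX) -[RHS]/0 big1 ?scaler0 // => b _.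
  rewrite (_ : mm_coef _ _ _ _ _ _ _ = 0) ?wedge0l //.
  apply: bil_eq0.
  - apply: thonly_mm_coef => [|c]; first exact: thonly_val.
    exact: thonly_der.
  - by apply: hdeg_mm_coef => [|c]; [exact: hp | exact: hdp].
  move=> a a'; case: cx smu nX => m im <- smu nX.
  have cx := cod_dom im.
  have [al [hal eal]] := oneform_exists A a im.
  have [be [hbe ebe]] := oneform_exists A a' im.
  have ca := coef_xi (eal 0); have cb := coef_xi (ebe 0).
  have := concomitant_jet hN npi hp pcomp 0 cx smu (oneform_xnice hal) (oneform_xnice hbe).
  rewrite (h al be hal hbe i _ 0 cx) subrr ca cb.
  move=> /esym; rewrite -(linear0 (@xrow R r)) => /xrow_inj/rowP/(_ b).
  by rewrite !mxE.
have xal := oneform_xnice hal; have xbe := oneform_xnice hbe.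
apply/eqP; rewrite -subr_eq0; apply/eqP.
rewrite (concomitant_jet hN npi hp pcomp p cx smu xal xbe) -[RHS](linear0 (@xrow R r)).
congr xrow; apply/rowP => b; rewrite mxE [RHS]mxE.
have -> : mm_coef rho (structure sg) (N i x) (derN N i x) (val pi i x) (der pi i x) b = 0.
  case: cx smu => m im <- smu; have cx := cod_dom im.
  have [X [hX eX]] := section_exists A b im.
  have nX := isF_nice hX.
  have := h X (section_inL hX) i _ 0 cx; rewrite euler_bracket_small //.
  rewrite (dd_one cx smu 0 nX) /val eX -[RHS]/0 (bigD1 b) //= big1 => [|c ne].
    rewrite gder_gen eqxx scale1r wedge1r addr0 => /eqP; rewrite scaler_eq0 oppr_eq0.
    by rewrite pnatr_eq0 => /eqP.
  by rewrite gder_gen eq_th_th (negPf ne) scale0r wedge0r.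
by rewrite /bil !linear0 /scal grass0.
Qed.

(** The difference of the two sides is tensorial, hence it vanishes on L if it does
    on sections with prescribed values at a point. *)
Lemma two_torsion :
  (forall X Y, inL A X -> inL A Y -> feq (dd [:: X; Y]) (kl [:: X; Y])) <-> torsion_free A mu N.
Proof.
split=> [h X Y hX hY i x p cx|h X Y hX hY i x p cx];
  have [rho [sg smu]] := symbol_exists hmu cx.
  apply/eqP; rewrite -subr_eq0; apply/eqP.
  have := torsion_jet cx smu p hX hY; rewrite (h _ _ (section_inL hX) (section_inL hY) i x p cx) subrr => /esym/eqP.
  by rewrite scaler_eq0 pnatr_eq0 => /eqP.
have nX := inL_nice hX; have nY := inL_nice hY.
apply/eqP; rewrite -subr_eq0; apply/eqP.
have [z hz] := jbracket_double_commutator (derN N i x) rho (structure sg) (hN2 cx).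
rewrite (jet2_deform2 hN cx smu (- 1 *: pi) p nX nY) (kl_two cx smu) // hz.
have z0 a b d : z a b d = 0.
  case: cx smu hz => m im <- smu hz; have cx := cod_dom im.
  have [X' [hX' eX]] := section_exists A a im; have [Y' [hY' eY]] := section_exists A b im.
  have nX' := isF_nice hX'; have nY' := isF_nice hY'.
  have := torsion_jet cx smu 0 hX' hY'.
  rewrite (jet2_deform2 hN cx smu (- 1 *: pi) 0 nX' nY') (kl_two cx smu) // hz.
  rewrite /val eX eY tsum_th => e; apply: (th_free (z := z a b)).
  rewrite e -[torsion _ _ _ _ _]/(_ i (chart i m) 0 - _) h // subrr.
  by rewrite scaler0.
by rewrite big1 // => a _; rewrite big1 // => b _; rewrite big1 // => d _; rewrite z0 scale0r.
Qed.

Lemma dd_big xs : (2 < size xs)%N -> dd xs = 0.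
Proof.
move=> sx; apply: vbracket_big sx; first exact: act0.
exact: small_deform.
Qed.

Lemma form_equation : vform_eq A dd kl <-> poisson_nijenhuis A mu pi N.
Proof.
split=> [h|[_ h0 h2 h1]].
  split=> //.
  - by apply/nil_poisson; apply: h => -[].
  - apply/two_torsion => X Y hX hY; apply: h => -[|[|]] //.
  by apply/one_concomitant => X hX; apply: h => -[].
case=> [|X [|Y [|Z xs]]] hxs.
- exact: (nil_poisson.2 h0).
- exact: (one_concomitant.2 h1 X (hxs 0%N isT)).
- exact: (two_torsion.2 h2 X Y (hxs 0%N isT) (hxs 1%N isT)).
by rewrite dd_big // euler_bracket_small.
Qed.

(** N preserves the degree, hence commutes with the Euler map, and pi has degree
    zero in L. *)
Lemma bracket_jk xs : feq (vbracket 0 0 J K xs) 0.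
Proof.
rewrite vbracket00; [|exact: act0|exact: scaled_euler0|].
  case: xs => [|X xs] // i x p cx; rewrite -[LHS]/(- lambda *: euler (-1 *: pi) i x p).
  have nP := nNpi cx; have [e _ tP] := nP.
  rewrite (@euler_hdeg _ _ _ _ 2) ?subrr ?scale0r ?scaler0 // e //.
  exact/hdegZ/hp.
move=> k X lk; rewrite scaled_euler // -[_ *: component k X]addr0 act_linear act0 addr0.
have -> : act N (component k X) = component k (act N X).
  apply/funext => i; apply/funext => x; apply/funext => p.
  by rewrite actE /component actE gproj_nact.
by rewrite scaled_euler.
Qed.

Lemma nijenhuis_equivalence : poisson_nijenhuis A mu pi N <->
  nijenhuis_form A (l2 mu) J K.
Proof.
rewrite -form_equation; split=> [h|[]//]; split=> //; last by move=> xs _; apply: bracket_jk.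
  apply: is_vform_jform; [exact: isFZ | exact: act_linear | exact: act_feq | exact: isF_act].
apply: is_vform_jform; first exact: isF0.
- exact: scaled_euler_linear.
- by move=> F G e; apply/feqZ/euler_feq.
by move=> k F hF; apply/isFZ/isF_euler.
Qed.

End Equivalence.

Theorem corollary5p11 (R : realType) (n : nat) (M : manifold R n) (r : nat)
    (A : vbundle M r) (mu pi : fam M r) (N : tensor11 M r) (lambda : R)
    (hmu : is_lie_algebroid A mu)
    (hpi : is_bivector A pi)
    (hN : is_tensor11 A N)
    (hcomp : compatible A pi N)
    (hN2 : forall i x, cod i x -> N i x *m N i x = lambda%:M) :
  poisson_nijenhuis A mu pi N <->
  nijenhuis_form A (l2 mu)
    (vform0 (- pi) + vform1 (act N))
    (vform1 (fun P => - lambda *: euler P)).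
Proof.
rewrite (vform1_jform (fun P : fam M r => - lambda *: euler P)) -[- pi]scaleN1r.
exact: (nijenhuis_equivalence hmu.1 hpi hN hcomp hN2).
Qed.
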